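(* Let $\mathcal{F}$ be any fixed finite set of operations over the boolean domain $\{0,1\}$. Then $\textsc{Membership}_{\mathcal{F}}$ is solvable in polynomial time, and $\textsc{EnumClosure}_{\mathcal{F}}$ can be solved with polynomial delay (i.e. $\textsc{EnumClosure}_{\mathcal{F}} \in \mathsf{DelayP}$).
   Context: An operation of arity $t$ over a finite set $D$ is a map $f: D^t \to D$; it acts on $t$-tuples of vectors of $D^n$ coordinate-wise: $f(v^1,\dots,v^t)_i = f(v^1_i,\dots,v^t_i)$. For a set $\mathcal{F}$ of operations and a set $\mathcal{S}\subseteq D^n$, the closure $Cl_{\mathcal{F}}(\mathcal{S})$ is the smallest subset of $D^n$ containing $\mathcal{S}$ and closed under all operations of $\mathcal{F}$. $\textsc{Membership}_{\mathcal{F}}$: given a finite set $\mathcal{S}$ of vectors of length $n$ and a vector $v$ of length $n$, decide whether $v\in Cl_{\mathcal{F}}(\mathcal{S})$. $\textsc{EnumClosure}_{\mathcal{F}}$: given a finite set $\mathcal{S}$ of vectors of length $n$, output every element of $Cl_{\mathcal{F}}(\mathcal{S})$ exactly once. An enumeration algorithm (in the RAM model) has polynomial delay if, after a precomputation of time polynomial in the input size, the time before the first output, between any two consecutive outputs, and after the last output is bounded by a polynomial in the input size; $\mathsf{DelayP}$ is the class of enumeration problems solvable with polynomial delay. *)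

(* Defs.v *)
From HB Require Import structures.
From mathcomp Require Import all_boot all_order all_algebra.
Set Implicit Arguments.
Unset Strict Implicit.
Unset Printing Implicit Defensive.

(** ** Operations and closure *)

(* The arity is arbitrary; in particular nullary operations are allowed. *)
Definition operation (D : finType) : Type :=
  {t : nat & {ffun t.-tuple D -> D}}.

Definition apply_op (D : finType) (n t : nat) (f : {ffun t.-tuple D -> D})
    (vs : t.-tuple (n.-tuple D)) : n.-tuple D :=
  [tuple f [tuple tnth (tnth vs j) i | j < t] | i < n].

Definition closed_under (D : finType) (n : nat) (F : seq (operation D))
    (C : {set n.-tuple D}) : bool :=
  all (fun f : operation D =>
         [forall vs : (tag f).-tuple (n.-tuple D),
            all (mem C) vs ==> (apply_op (tagged f) vs \in C)]) F.

Definition Cl (D : finType) (n : nat) (F : seq (operation D))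
    (S : {set n.-tuple D}) : {set n.-tuple D} :=
  \bigcap_(C : {set n.-tuple D} | (S \subset C) && closed_under F C) C.

(** ** Random access machines *)

Definition word : Type := seq bool.

(* Uniform-cost RAM. Registers hold natural numbers; there is no
   multiplication, so that k instructions lengthen a register by at most k bits
   and uniform cost is polynomially related to Turing machine time. The input
   is a read-only binary word with random access. A solution is written one bit
   at a time to a buffer, then output as a whole by [Emit]. *)
Inductive instr : Type :=
| Const of nat & nat         (* Const r c: R_r := c *)
| Add of nat & nat & nat     (* Add r a b: R_r := R_a + R_b *)
| Sub of nat & nat & nat     (* Sub r a b: R_r := max (R_a - R_b) 0 *)
| LoadAt of nat & nat        (* LoadAt r a: R_r := R_(R_a) *)
| StoreAt of nat & nat       (* StoreAt r a: R_(R_r) := R_a *)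
| Length of nat              (* Length r: R_r := length of the input *)
| Read of nat & nat          (* Read r a: R_r := input bit at position R_a *)
| Jump of nat
| JumpZ of nat & nat         (* JumpZ r l: if R_r = 0 then go to l *)
| Write of nat               (* Write r: append the bit [R_r != 0] *)
| Emit
| Halt.

Definition program : Type := seq instr.

Record config : Type := Config {
  pc : nat;
  reg : nat -> nat;
  buffer : word;
  emitted : seq word (* solutions output so far, oldest first *)
}.

Definition init : config := Config 0 (fun=> 0) [::] [::].

(* Running past the end of the program halts. *)
Definition fetch (P : program) (c : config) : instr := nth Halt P (pc c).

Definition halted (P : program) (c : config) : bool :=
  if fetch P c is Halt then true else false.

Definition set_reg (c : config) (r x : nat) : config :=
  Config (pc c).+1 [eta reg c with r |-> x] (buffer c) (emitted c).

Definition goto (c : config) (l : nat) : config :=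
  Config l (reg c) (buffer c) (emitted c).

Definition step (P : program) (w : word) (c : config) : config :=
  match fetch P c with
  | Const r x => set_reg c r x
  | Add r a b => set_reg c r (reg c a + reg c b)
  | Sub r a b => set_reg c r (reg c a - reg c b)
  | LoadAt r a => set_reg c r (reg c (reg c a))
  | StoreAt r a => set_reg c (reg c r) (reg c a)
  | Length r => set_reg c r (size w)
  | Read r a => set_reg c r (nth false w (reg c a))
  | Jump l => goto c l
  | JumpZ r l => goto c (if reg c r == 0 then l else (pc c).+1)
  | Write r =>
      Config (pc c).+1 (reg c) (rcons (buffer c) (reg c r != 0)) (emitted c)
  | Emit => Config (pc c).+1 (reg c) [::] (rcons (emitted c) (buffer c))
  | Halt => c
  end.

Definition run (P : program) (w : word) (k : nat) : config :=
  iter k (step P w) init.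

(** ** Polynomial time and polynomial delay *)

(* An instance may have several encodings (a finite set can be listed in any
   order); an algorithm has to be correct on all of them. *)
Record decision_problem : Type := DecisionProblem {
  dec_instance : Type;
  dec_encodes : dec_instance -> word -> Prop;
  dec_yes : dec_instance -> Prop
}.

Record enum_problem : Type := EnumProblem {
  enum_instance : Type;
  enum_encodes : enum_instance -> word -> Prop;
  enum_solution : enum_instance -> word -> Prop
}.

Definition polynomial_time (A : decision_problem) : Prop :=
  exists (P : program) (p : {poly nat}),
    forall (x : dec_instance A) (w : word), dec_encodes x w ->
    exists k : nat,
      [/\ k <= p.[size w]%R, halted P (run P w k)
        & reg (run P w k) 0 != 0 <-> dec_yes x].

(* The precomputation ends at time [t0]; from any later time [k], in particular
   from [t0] and from the time of any output, the next output or the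
   termination occurs within [q.[size w]] steps. A run can be exponentially long,
   so uniform cost is only meaningful for registers of polynomial bit length:
   hence the bound [r]. *)
Definition DelayP (A : enum_problem) : Prop :=
  exists (P : program) (p q r : {poly nat}),
    forall (x : enum_instance A) (w : word), enum_encodes x w ->
    [/\ exists t0 : nat,
          [/\ t0 <= p.[size w]%R, emitted (run P w t0) = [::]
            & forall k : nat, t0 <= k ->
              exists d : nat,
                d <= q.[size w]%R /\
                (halted P (run P w (k + d)) \/
                 size (emitted (run P w k)) < size (emitted (run P w (k + d))))],
        forall k i : nat, reg (run P w k) i < 2 ^ r.[size w]%R
      & exists k : nat,
          [/\ halted P (run P w k), uniq (emitted (run P w k))
            & forall y : word,
                y \in emitted (run P w k) <-> enum_solution x y]].

(** ** The two problems over the boolean domain *)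

Record membership_instance : Type := MembershipInstance {
  mem_len : nat;
  mem_set : {set mem_len.-tuple bool};
  mem_vec : mem_len.-tuple bool
}.

Record closure_instance : Type := ClosureInstance {
  clo_len : nat;
  clo_set : {set clo_len.-tuple bool}
}.

Definition encode_len (n : nat) : word := rcons (nseq n true) false.

(* Each vector is preceded by the bit 1, so that the number of vectors is
   determined by the encoding even when n = 0. *)
Definition encode_vectors (n : nat) (s : seq (n.-tuple bool)) : word :=
  flatten [seq true :: tval v | v <- s].

Definition lists (n : nat) (s : seq (n.-tuple bool))
    (S : {set n.-tuple bool}) : Prop :=
  uniq s /\ s =i S.

Definition Membership (F : seq (operation bool)) : decision_problem :=
  {| dec_instance := membership_instance;
     dec_encodes := fun x w =>
       exists2 s, lists s (mem_set x) &
         w = encode_len (mem_len x) ++ tval (mem_vec x) ++ encode_vectors s;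
     dec_yes := fun x => mem_vec x \in Cl F (mem_set x) |}.

Definition EnumClosure (F : seq (operation bool)) : enum_problem :=
  {| enum_instance := closure_instance;
     enum_encodes := fun x w =>
       exists2 s, lists s (clo_set x) &
         w = encode_len (clo_len x) ++ encode_vectors s;
     enum_solution := fun x y =>
       exists2 v, v \in Cl F (clo_set x) & y = tval v |}.

(* Main.v *)
Require Import Defs.
From HB Require Import structures.
From mathcomp Require Import all_boot all_order all_algebra.
From mathcomp Require Import zify.
From Stdlib Require Import ClassicalEpsilon.
Set Implicit Arguments.
Unset Strict Implicit.
Unset Printing Implicit Defensive.

(** The vectors of the closure of [S] are the [f (s_1, ..., s_m)] for [f] in the clone
   generated by [F]. If [F] contains a non-affine operation, then the clone contains
   [x /\ y], [x \/ y] or the majority operation, and, up to duality, one of the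
   following holds:
   - majority is in the clone: by Baker-Pixley a vector is in the closure iff its
     projections on pairs of coordinates are;
   - [F] consists of constants and conjunctions: a non-constant [v] is in the closure
     iff it is the meet of the vectors of [S] above it;
   - [x /\ (y \/ z)] is in the clone: below a fixed element, the closure is a lattice,
     hence determined by its projections on pairs of coordinates, and it remains to
     find an element above [v]. If some [f] in [F] is not below any of its variables,
     this is a condition on projections on a bounded number of coordinates; otherwise
     any such element is below an element of [S].
   In all these cases, and if all operations are essentially unary, membership is
   expressed by a fixed first-order formula over coordinates and given vectors, which
   nested loops evaluate in polynomial time. In the remaining case all operations are
   affine and [x + y + z] is in the clone; membership is then decided by Gaussian
   elimination.

   The prefixes of length [l] of the closure are the closure of the prefixes of [S].
   Hence membership tests tell which prefixes extend to a solution, and the next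
   solution in lexicographic order is found by going back to the last 0 that can be
   changed into a 1 and then completing greedily. *)

(** * Closures *)

(** The clone is never built. An operation counts as present when all closures, over all index
    types, are stable under it ([has2], [has3], [has4]); deriving an operation is then composing
    closure properties, and projecting vectors is precomposition with a map of indices. Arbitrary
    arities are cut down to four by identifying variables, which leaves finitely many truth tables
    to inspect by computation. Nullary operations and the empty set of vectors shape many
    statements: a constant of positive arity is produced only if there is something to apply it to.
    Hence the proposition [b] in [unary_in] and the separate conditions that the closure is
    inhabited. The program may depend on [F] non-constructively: facts about the clone are decided
    classically ([holds]) and built into the formula or the code. On the machine side, each
    correctness statement carries a time bound and a bound [B] on all registers at all intermediate
    times, since polynomial delay over a possibly exponential run also requires short registers. *)

Definition ap (f : operation bool) (x : 'I_(tag f) -> bool) : bool :=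
  tagged f [tuple x j | j < tag f].

Lemma eq_ap (f : operation bool) (x y : 'I_(tag f) -> bool) :
  x =1 y -> ap x = ap y.
Proof. by move=> e; congr (tagged f _); apply: eq_mktuple. Qed.

(** Vectors are Boolean functions on an arbitrary index type, compared pointwise, so that closures
    on different sets of coordinates can be related by maps between the indices. *)
Inductive clo (F : seq (operation bool)) (I : Type) (S : (I -> bool) -> Prop) :
  (I -> bool) -> Prop :=
| clo_gen s v : S s -> s =1 v -> clo F S v
| clo_op (f : operation bool) (vs : 'I_(tag f) -> I -> bool) v :
    List.In f F -> (forall j, clo F S (vs j)) ->
    (forall i, v i = ap (fun j => vs j i)) -> clo F S v.

Section Closure.

Variable F : seq (operation bool).

Lemma clo_mem (I : Type) (S : (I -> bool) -> Prop) s : S s -> clo F S s.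
Proof. by move=> Ss; exact: (clo_gen F Ss (frefl s)). Qed.

Lemma clo_app (I : Type) (S : (I -> bool) -> Prop) f (vs : 'I_(tag f) -> I -> bool) :
  List.In f F -> (forall j, clo F S (vs j)) ->
  clo F S (fun i => ap (fun j => vs j i)).
Proof. by move=> Ff cl; exact: (clo_op Ff cl). Qed.

Lemma clo_ext (I : Type) (S : (I -> bool) -> Prop) v w :
  v =1 w -> clo F S v -> clo F S w.
Proof.
move=> e c; case: c e => [s u Ss su e|f vs u Ff cl uE e].
  by apply: (clo_gen _ Ss) => i; rewrite su.
by apply: (clo_op Ff cl) => i; rewrite -e.
Qed.

Lemma clo_sub (I J : Type) (S : (I -> bool) -> Prop) (S' : (J -> bool) -> Prop)
    (e : J -> I) v :
  (forall s, S s -> clo F S' (s \o e)) -> clo F S v -> clo F S' (v \o e).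
Proof.
move=> gen; elim=> {v} [s v Ss sv|f vs v Ff _ IH vE].
  by apply: clo_ext (gen _ Ss) => j /=; rewrite sv.
by apply: (clo_op (vs := fun k => vs k \o e) Ff IH) => j /=; rewrite vE.
Qed.

(** Closure commutes with projection: preimages chosen for the arguments of an operation are
    combined by the same operation. With [clo_sub] for the other inclusion, this lets prefixes and
    bounded projections be tested in place of whole vectors. *)
Lemma clo_lift (I J : Type) (S : (I -> bool) -> Prop) (e : J -> I) v :
  clo F (fun s => exists2 r, S r & s =1 r \o e) v ->
  exists2 w, clo F S w & v =1 w \o e.
Proof.
elim=> {v} [s v [r Sr sr] sv|f vs v Ff _ IH vE].
  by exists r => [|i]; [exact: (@clo_gen _ _ _ r) | rewrite -sv sr].
have [ws cws wsE] := fin_all_exists2 IH.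
exists (fun i => ap (fun j => ws j i)) => [|i /=]; first exact: clo_app.
by rewrite vE; apply: eq_ap => j; rewrite wsE.
Qed.

Lemma clo_eq_gen (I : Type) (S S' : (I -> bool) -> Prop) v :
  (forall s, S s -> exists2 s', S' s' & s' =1 s) -> clo F S v -> clo F S' v.
Proof.
move=> SS'; apply: (@clo_sub _ _ _ _ id) => s /SS' [s' S's' e].
exact: clo_gen S's' e.
Qed.

(** This says that [op] belongs to the clone: taking all pairs of bits as coordinates and the two
    projections as generators recovers the usual definition. *)
Definition has2 (op : bool -> bool -> bool) : Prop :=
  forall (I : Type) (S : (I -> bool) -> Prop) a b,
    clo F S a -> clo F S b -> clo F S (fun i => op (a i) (b i)).

Definition has3 (op : bool -> bool -> bool -> bool) : Prop :=
  forall (I : Type) (S : (I -> bool) -> Prop) a b c,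
    clo F S a -> clo F S b -> clo F S c -> clo F S (fun i => op (a i) (b i) (c i)).

Definition has4 (op : bool -> bool -> bool -> bool -> bool) : Prop :=
  forall (I : Type) (S : (I -> bool) -> Prop) a b c d,
    clo F S a -> clo F S b -> clo F S c -> clo F S d ->
    clo F S (fun i => op (a i) (b i) (c i) (d i)).

Lemma has2_ext op op' : (forall x y, op x y = op' x y) -> has2 op -> has2 op'.
Proof.
by move=> e h I S a b ca cb; apply: clo_ext (h _ _ _ _ ca cb) => i /=.
Qed.

Lemma has3_ext op op' :
  (forall x y z, op x y z = op' x y z) -> has3 op -> has3 op'.
Proof.
by move=> e h I S a b c ca cb cc; apply: clo_ext (h _ _ _ _ _ ca cb cc) => i /=.
Qed.

(** [k] sorts the arguments into four groups, and each group receives one variable. *)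
Lemma has4_minor f (k : 'I_(tag f) -> bool * bool) : List.In f F ->
  has4 (fun x y z w => ap (fun j => match k j with
    | (false, false) => x | (false, true) => y
    | (true, false) => z | (true, true) => w end)).
Proof.
move=> Ff I S a b c d ca cb cc cd.
pose vs j := match k j with
    | (false, false) => a | (false, true) => b
    | (true, false) => c | (true, true) => d end.
apply: (@clo_ext _ _ (fun i => ap (fun j => vs j i))) => [i|].
  by apply: eq_ap => j; rewrite /vs; case: (k j) => [[] []].
by apply: (@clo_app _ _ _ vs) => // j; rewrite /vs; case: (k j) => [[] []].
Qed.

(** * Non-affine operations *)

Definition maj3 (x y z : bool) := x && y || z && (x || y).

(** The assumed operation is the Pixley operation [p], and [p x (p x y z) z] is the majority. *)
Lemma has3_pixley :
  has3 (fun x y z => if x == z then x else if x == y then z else x) -> has3 maj3.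
Proof.
move=> p I S a b c ca cb cc.
apply: clo_ext (p _ _ _ _ _ ca (p _ _ _ _ _ ca cb cc) cc) => i /=.
by case: (a i) (b i) (c i) => [] [] [].
Qed.

Fixpoint lists_of (T : Type) (s : seq T) (n : nat) : seq (seq T) :=
  if n is n'.+1 then [seq x :: l | x <- s, l <- lists_of s n'] else [:: [::]].

Lemma mem_lists_of (T : eqType) (s l : seq T) :
  all (mem s) l -> l \in lists_of s (size l).
Proof.
elim: l => //= x l IH /andP[sx /IH sl].
by apply/allpairsP; exists (x, l).
Qed.

Lemma lists_ofSP (T : eqType) (s l : seq T) n : l \in lists_of s n.+1 ->
  exists x l', [/\ x \in s, l' \in lists_of s n & l = x :: l'].
Proof. by case/allpairsP=> -[x l'] [sx sl' ->]; exists x, l'. Qed.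

Definition tab2 (g : bool -> bool -> bool) : seq bool :=
  [:: g false false; g false true; g true false; g true true].
Definition tab3 (g : bool -> bool -> bool -> bool) : seq bool :=
  tab2 (g false) ++ tab2 (g true).
Definition tab4 (g : bool -> bool -> bool -> bool -> bool) : seq bool :=
  tab3 (g false) ++ tab3 (g true).

Definition fn2 (l : seq bool) (x y : bool) : bool :=
  if x then (if y then nth false l 3 else nth false l 2)
  else (if y then nth false l 1 else nth false l 0).
Definition fn3 l (x : bool) := fn2 (if x then drop 4 l else l).
Definition fn4 l (x : bool) := fn3 (if x then drop 8 l else l).

Lemma fn2K g x y : fn2 (tab2 g) x y = g x y.
Proof. by case: x y => [] []. Qed.
Lemma fn3K g x y z : fn3 (tab3 g) x y z = g x y z.
Proof. by case: x y z => [] [] []. Qed.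
Lemma fn4K g x y z w : fn4 (tab4 g) x y z w = g x y z w.
Proof. by case: x y z w => [] [] [] []. Qed.

Lemma tab3P g h : tab3 g = tab3 h -> forall x y z, g x y z = h x y z.
Proof. by move=> e x y z; rewrite -fn3K e fn3K. Qed.

Definition all_bits : nat -> seq (seq bool) := lists_of [:: false; true].

Lemma all_bitsP (l : seq bool) : l \in all_bits (size l).
Proof. by apply: mem_lists_of; apply/allP => -[]. Qed.

Definition sel3 (k : nat) (x y z : bool) : bool :=
  match k with 0 => x | 1 => y | _ => z end.

Definition minor (g : bool -> bool -> bool -> bool -> bool) (ks : seq nat)
    (x y z : bool) : bool :=
  g (sel3 (nth 0 ks 0) x y z) (sel3 (nth 0 ks 1) x y z)
    (sel3 (nth 0 ks 2) x y z) (sel3 (nth 0 ks 3) x y z).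

Definition maj_targets : seq (seq bool) :=
  [:: tab3 (fun x y _ => x && y); tab3 (fun x y _ => x || y); tab3 maj3;
      tab3 (fun x y z => if x == z then x else if x == y then z else x)].

(** This is the coefficient of the product of the two variables; a Boolean function is affine iff it
    vanishes on all two-dimensional faces. *)
Definition odd_face (g : bool -> bool -> bool) : bool :=
  g false false (+) g false true (+) g true false (+) g true true.

(* Written with [if] and [find] to be lazy under [vm_compute]. *)
Definition idempotent_check (l : seq bool) : bool :=
  let g := fn4 l in
  if g false false false false then true else
  if g true true true true then
    if odd_face (fun x y => g x y false true) then
      let kss := lists_of [:: 0; 1; 2] 4 in
      find (fun ks => tab3 (minor g ks) \in maj_targets) kss < size kss
    else true
  else true.

(** Exhaustive over the 2^16 truth tables of arity four: each idempotent one with the odd face has,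
    among its 81 ternary minors, a conjunction, a disjunction, the majority or the Pixley
    operation. *)
Lemma all_idempotent_check : all idempotent_check (all_bits 16).
Proof. by vm_compute. Qed.

Lemma has3_minor g ks : has4 g -> has3 (minor g ks).
Proof.
move=> hg I S a b c ca cb cc.
pose v k := match k with 0 => a | 1 => b | _ => c end.
have cv k : clo F S (v k) by case: k => [|[|k]].
apply: clo_ext (hg _ _ _ _ _ _ (cv (nth 0 ks 0)) (cv (nth 0 ks 1))
  (cv (nth 0 ks 2)) (cv (nth 0 ks 3))) => i; rewrite /minor.
suff e k : v k i = sel3 k (a i) (b i) (c i) by rewrite !e.
by case: k => [|[|k]].
Qed.

Definition and_or_maj : Prop := [\/ has2 andb, has2 orb | has3 maj3].

Lemma and_or_maj_idempotent g : has4 g ->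
    g false false false false = false -> g true true true true = true ->
    odd_face (fun x y => g x y false true) -> and_or_maj.
Proof.
move=> hg g0 g1 og; have := allP all_idempotent_check _ (all_bitsP (tab4 g)).
rewrite /idempotent_check; cbv zeta; rewrite !fn4K g0 g1.
have -> : odd_face (fun x y => fn4 (tab4 g) x y false true) by rewrite /odd_face !fn4K.
rewrite -has_find => /hasP[ks _ h].
have hm : has3 (minor (fn4 (tab4 g)) ks).
  apply: has3_ext (has3_minor ks hg) => x y z; by rewrite /minor fn4K.
have use op : tab3 (minor (fn4 (tab4 g)) ks) = tab3 op -> has3 op.
  by move=> /tab3P e; apply: has3_ext hm.
move: h; rewrite !inE => /or4P[] /eqP /use h.
- by constructor 1 => I S a b ca cb; exact: (h _ _ _ _ _ ca cb ca).
- by constructor 2 => I S a b ca cb; exact: (h _ _ _ _ _ ca cb ca).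
- by constructor 3.
- by constructor 3; apply: has3_pixley.
Qed.

(** One round of composition with [h]. Filtering [all_bits 4] discards duplicates, so the result has
    at most 16 tables and the next round stays small. *)
Definition compose_round (h : bool -> bool -> bool -> bool) (L : seq (seq bool)) :
  seq (seq bool) :=
  let L' := L ++ [seq tab2 (fun x y => h (fn2 (nth [::] t 0) x y)
       (fn2 (nth [::] t 1) x y) (fn2 (nth [::] t 2) x y)) | t <- lists_of L 3] in
  [seq l <- all_bits 4 | l \in L'].

Definition binary_round2 (h : bool -> bool -> bool -> bool) (c : bool) :=
  compose_round h (compose_round h
    [:: tab2 (fun x y => x); tab2 (fun x y => y); tab2 (fun x y => c)]).

Definition constant_check (c : bool) (l : seq bool) : bool :=
  if odd_face (fun x y => fn3 l x y (~~ c)) then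
    let L := binary_round2 (fn3 l) c in (tab2 andb \in L) || (tab2 orb \in L)
  else true.

(** Exhaustive over the 2^8 ternary tables: with the constant [c] at hand and an odd face where the
    third argument is not [c], two rounds of composition reach a conjunction or a disjunction. *)
Lemma all_constant_check c : all (constant_check c) (all_bits 8).
Proof. by case: c; vm_compute. Qed.

Lemma compose_roundP h L : has3 h ->
  (forall l, l \in L -> has2 (fn2 l)) ->
  forall l, l \in compose_round h L -> has2 (fn2 l).
Proof.
move=> hh hL l; rewrite mem_filter mem_cat => /andP[/orP[/hL //|] + _].
case/mapP=> t /lists_ofSP[l0 [t0 [Ll0 + ->]]].
case/lists_ofSP=> l1 [t1 [Ll1 + ->]]; case/lists_ofSP=> l2 [t2 [Ll2 _ ->]] ->.
apply: (@has2_ext (fun x y => h (fn2 l0 x y) (fn2 l1 x y) (fn2 l2 x y))).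
  by move=> x y; rewrite fn2K.
move=> I S a b ca cb.
exact: (hh _ _ _ _ _ (hL _ Ll0 _ _ _ _ ca cb) (hL _ Ll1 _ _ _ _ ca cb)
  (hL _ Ll2 _ _ _ _ ca cb)).
Qed.

Lemma and_or_maj_constant h c : has3 h -> has2 (fun _ _ => c) ->
  odd_face (fun x y => h x y (~~ c)) -> and_or_maj.
Proof.
move=> hh hc oh; have := allP (all_constant_check c) _ (all_bitsP (tab3 h)).
have oh' : odd_face (fun x y => fn3 (tab3 h) x y (~~ c)) by rewrite /odd_face !fn3K.
rewrite /constant_check; cbv zeta; rewrite oh'.
have hh' : has3 (fn3 (tab3 h)) by apply: has3_ext hh => *; rewrite fn3K.
have base l : l \in [:: tab2 (fun x y => x); tab2 (fun x y => y); tab2 (fun x y => c)] ->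
    has2 (fn2 l).
  rewrite !inE => /or3P[] /eqP ->; last by apply: has2_ext hc => *; rewrite fn2K.
  - by move=> I S a b ca cb; apply: clo_ext ca => i; rewrite fn2K.
  - by move=> I S a b ca cb; apply: clo_ext cb => i; rewrite fn2K.
case/orP=> /(compose_roundP hh' (compose_roundP hh' base)) hop.
- by constructor 1; apply: has2_ext hop => *; rewrite fn2K.
- by constructor 2; apply: has2_ext hop => *; rewrite fn2K.
Qed.

(** * Affine operations as those whose two-dimensional faces are even *)

Definition flip (T : eqType) (x : T -> bool) (i : T) : T -> bool :=
  fun k => x k (+) (k == i).

Definition even_faces t (g : ('I_t -> bool) -> bool) : Prop :=
  forall x i j, i != j ->
    g x (+) g (flip x i) (+) g (flip x j) (+) g (flip (flip x j) i) = false.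

Definition affine t (g : ('I_t -> bool) -> bool) : Prop :=
  exists c (a : 'I_t -> bool), forall x,
    g x = c (+) \big[addb/false]_i (a i && x i).

(** Even faces make the derivative [der] in each direction independent of the base point, so [g] is
    recovered by flipping coordinates one at a time from the zero vector, each contributing a fixed
    bit. *)
Lemma affine_even_faces t (g : ('I_t -> bool) -> bool) :
  (forall x y, x =1 y -> g x = g y) -> even_faces g -> affine g.
Proof.
move=> eg ev; pose der x i := g x (+) g (flip x i).
have der_flip x i j : der (flip x j) i = der x i.
  rewrite /der; case: (altP (i =P j)) => [->|ij].
    rewrite addbC; congr (_ (+) _); apply: eg => k.
    by rewrite /flip; case: (k == j) (x k) => [] [].
  by have := ev x i j ij; case: (g _) (g _) (g _) (g _) => [] [] [] [].
exists (g xpred0), (der xpred0) => x.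
(* [r l] is [x] with all coordinates outside [l] reset to 0. *)
pose r (l : seq 'I_t) k := (k \in l) && x k.
have step l k : k \notin l -> r (k :: l) =1 if x k then flip (r l) k else r l.
  move=> kl i; rewrite /r inE /flip; case: ifP => xk /=.
    by case: eqP => [->|_]; rewrite ?(negPf kl) ?xk ?addbF.
  by case: eqP => [->|_]; rewrite ?(negPf kl) ?xk.
have claim l : uniq l -> (forall i, der (r l) i = der xpred0 i) /\
    g (r l) = g xpred0 (+) \big[addb/false]_(k <- l) (der xpred0 k && x k).
  elim: l => [_|k l IH /= /andP[kl /IH [dl gl]]].
    split=> [i|]; last by rewrite big_nil addbF; apply: eg.
    by rewrite /der; congr (_ (+) _); apply: eg.
  have e := step l k kl; rewrite big_cons; case: ifP e => xk e; last first.
    split=> [i|]; last by rewrite (eg _ _ e) andbF.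
    by rewrite -dl /der (eg _ _ e); congr (_ (+) _); apply: eg => j; rewrite /flip e.
  split=> [i|].
    rewrite -dl -(der_flip (r l) i k) /der (eg _ _ e).
    by congr (_ (+) _); apply: eg => j; rewrite /flip e.
  by rewrite (eg _ _ e) andbT -dl addbCA -gl /der addbAC addbb.
have [_] := claim (enum 'I_t) (enum_uniq _).
rewrite (eg _ x) => [->|k]; last by rewrite /r mem_enum.
by rewrite big_enum.
Qed.

Lemma and_or_maj_nonaffine f : List.In f F -> ~ affine (@ap f) -> and_or_maj.
Proof.
move=> Ff naff.
have [x [i [j [ij ox]]]] : exists x i j, i != j /\
    @ap f x (+) @ap f (flip x i) (+) @ap f (flip x j) (+) @ap f (flip (flip x j) i) = true.
  apply: NNPP => no; case: naff; apply: (affine_even_faces (@eq_ap f)) => x i j ij.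
  by apply/negbTE/negP => ox; case: no; exists x, i, j.
(* The two directions of the odd face become the first two variables; the other arguments are merged
   by their value at [x], which is why the face lies at 0 and 1 in the last two variables. *)
pose k l := if l == i then (false, false) else if l == j then (false, true)
            else (true, x l).
have := has4_minor k Ff; set g := (fun x y z w : bool => _) => hg.
have og : odd_face (fun a b => g a b false true).
  have vE a b : g a b false true =
      @ap f (fun l => if l == i then a else if l == j then b else x l).
    apply: eq_ap => l; rewrite /k; case: (l == i); case: (l == j) => //.
    by case: (x l).
  have fE a b : @ap f (fun l => if l == i then a else if l == j then b else x l) =
      @ap f (fun l => x l (+) ((x i (+) a) && (l == i)) (+) ((x j (+) b) && (l == j))).
    apply: eq_ap => l; case: (altP (l =P i)) => [->|li].
      by rewrite (negPf ij) andbT andbF addbF addbA addbb.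
    rewrite andbF addbF; case: (altP (l =P j)) => [->|lj].
      by rewrite andbT addbA addbb.
    by rewrite andbF addbF.
  have e0 : @ap f x = @ap f (fun l => x l (+) (false && (l == i)) (+) (false && (l == j))).
    by apply: eq_ap => l; rewrite /= !addbF.
  have e1 : @ap f (flip x i) = @ap f (fun l => x l (+) (true && (l == i)) (+) (false && (l == j))).
    by apply: eq_ap => l; rewrite /= !addbF.
  have e2 : @ap f (flip x j) = @ap f (fun l => x l (+) (false && (l == i)) (+) (true && (l == j))).
    by apply: eq_ap => l; rewrite /= !addbF.
  have e3 : @ap f (flip (flip x j) i) =
      @ap f (fun l => x l (+) (true && (l == i)) (+) (true && (l == j))).
    by apply: eq_ap => l; rewrite /flip /= -!addbA [(l == j) (+) _]addbC.
  move: ox; rewrite /odd_face !vE !fE e0 e1 e2 e3.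
  by case: (x i) (x j) => [] [] /=; case: (ap _) (ap _) (ap _) (ap _) => [] [] [] [].
have hdiag : has2 (fun a _ => g a a a a) by move=> I S a b ca cb; exact: hg.
(* The diagonal of [g] is a unary function of the clone: a constant replaces one of the last two
   arguments, a negation makes [g] idempotent after composition, and the identity means that it
   already is. *)
case g0 : (g false false false false); case g1 : (g true true true true).
- apply: (@and_or_maj_constant (fun a b d => g a b d true) true) og.
    move=> I S a b c ca cb cc.
    apply: clo_ext (hg _ _ _ _ _ _ ca cb cc (hdiag _ _ _ _ ca ca)) => l /=.
    by case: (a l); rewrite ?g0 ?g1.
  by apply: has2_ext hdiag => -[] _.
- have hneg I S a : @clo F I S a -> clo F S (fun l => ~~ a l).
    move=> ca; apply: clo_ext (hdiag _ _ _ _ ca ca) => l /=.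
    by case: (a l); rewrite ?g0 ?g1.
  apply: (@and_or_maj_idempotent (fun a b c d => ~~ g a b c d)).
  + by move=> I S a b c d ca cb cc cd; apply: hneg; apply: hg.
  + by rewrite g0.
  + by rewrite g1.
  + by move: og; rewrite /odd_face; case: (g _ _ _ _) (g _ _ _ _) (g _ _ _ _) (g _ _ _ _) => [] [] [] [].
- exact: (and_or_maj_idempotent hg).
- apply: (@and_or_maj_constant (fun a b d => g a b false d) false) og.
    move=> I S a b c ca cb cc.
    apply: clo_ext (hg _ _ _ _ _ _ ca cb (hdiag _ _ _ _ ca ca) cc) => l /=.
    by case: (a l); rewrite ?g0 ?g1.
  by apply: has2_ext hdiag => -[] _.
Qed.

End Closure.

(** * Essentially unary operations and affine operations *)

Section Cases.

Variable F : seq (operation bool).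

(* [x |-> c + p x] is a unary function of the clone; if [b] fails, only nullary
   operations may be used to build it. *)
Definition unary_in (b : Prop) (c p : bool) : Prop :=
  clo F (fun s : bool -> bool => b /\ s =1 id) (fun x => c (+) (p && x)).

Lemma unary_in_eq (b b' : Prop) c p : (b <-> b') -> unary_in b c p -> unary_in b' c p.
Proof.
by move=> bb'; apply: clo_eq_gen => s [hb sE]; exists s => //; split=> //; apply/bb'.
Qed.

Lemma unary_in_id (b : Prop) : b -> unary_in b false true.
Proof. by move=> hb; apply: (@clo_gen _ _ _ id). Qed.

Lemma unary_in_ap (b : Prop) f (c p : 'I_(tag f) -> bool) (c' p' : bool) :
  List.In f F -> (forall j, unary_in b (c j) (p j)) ->
  (forall x, ap (fun j => c j (+) (p j && x)) = c' (+) (p' && x)) -> unary_in b c' p'.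
Proof.
by move=> Ff u e; apply: clo_ext (clo_app Ff u) => x; rewrite e.
Qed.

Lemma unary_in_clo (I : Type) (S : (I -> bool) -> Prop) s c p :
  unary_in (exists s, S s) c p -> ((exists s, S s) -> clo F S s) ->
  clo F S (fun i => c (+) (p && s i)).
Proof.
move=> u cs; apply: (@clo_sub _ _ _ _ _ s _ _ u) => r [ne rE].
by apply: clo_ext (cs ne) => i /=; rewrite rE.
Qed.

(** A constant function is indifferent to its argument: any generator will do, and if there is none,
    the function was built from nullary operations alone. *)
Lemma unary_in_const (I : Type) (S : (I -> bool) -> Prop) c :
  unary_in (exists s, S s) c false -> clo F S (fun=> c).
Proof.
move=> u; have [[s Ss]|no] := classic (exists s, S s).
  by apply: clo_ext (unary_in_clo u (fun=> clo_mem F Ss)) => i; rewrite addbF.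
have cs : (exists s, S s) -> clo F S (fun=> c) by [].
by apply: clo_ext (unary_in_clo u cs) => i; rewrite addbF.
Qed.

(** Identifying all generators turns a derivation into a unary function. It supplies fillers for
    arguments that an operation ignores but must still receive. *)
Lemma clo_unary_in (I : Type) (S : (I -> bool) -> Prop) v :
  clo F S v -> exists cp, unary_in (exists s, S s) cp.1 cp.2.
Proof.
elim=> {v} [s v Ss _|f vs v Ff _ /fin_all_exists [cp u] _].
  by exists (false, true); apply: unary_in_id; exists s.
pose g x := ap (fun j => (cp j).1 (+) ((cp j).2 && x)).
exists (g false, g false (+) g true); apply: (unary_in_ap Ff u) => -[] /=.
  by rewrite andbT addbA addbb.
by rewrite andbF addbF.
Qed.

Definition const_or_unary (f : operation bool) : Prop :=
  exists c, (forall x, @ap f x = c) \/ (exists i, forall x, @ap f x = c (+) x i).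

Lemma clo_unaryP (I : Type) (S : (I -> bool) -> Prop) v :
  (forall f, List.In f F -> const_or_unary f) ->
  clo F S v <-> exists c,
    unary_in (exists s, S s) c false /\ v =1 (fun=> c) \/
    unary_in (exists s, S s) c true /\ exists2 s, S s & v =1 (fun i => c (+) s i).
Proof.
move=> hF; split=> [|[c [[u vE]|[u [s Ss vE]]]]].
- elim=> {v} [s v Ss sv|f vs v Ff cl IH vE].
    exists false; right; split; last by exists s => // i; rewrite -sv.
    by apply: unary_in_id; exists s.
  have [c [fE|[i fE]]] := hF f Ff.
    exists c; left; split=> [|i]; last by rewrite vE fE.
    have [cp u] := fin_all_exists (fun j => clo_unary_in (cl j)).
    by apply: (unary_in_ap Ff u) => x; rewrite fE addbF.
  have [cp u] := fin_all_exists (fun j => clo_unary_in (cl j)).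
  have [c' IHi] := IH i; exists (c (+) c').
  have tr p : unary_in (exists s, S s) c' p -> unary_in (exists s, S s) (c (+) c') p.
    (* Argument [i] receives the function under study, the ignored arguments any available one. *)
    move=> u'; pose cp' j := if j == i then (c', p) else cp j.
    apply: (@unary_in_ap _ f (fun j => (cp' j).1) (fun j => (cp' j).2)) => // [j|x].
      by rewrite /cp'; case: ifP => _ //; exact: u.
    by rewrite fE /cp' eqxx addbA.
  case: IHi => [[u' vsE]|[u' [s Ss vsE]]]; [left|right]; split; try exact: tr.
    by move=> k; rewrite vE fE vsE.
  by exists s => // k; rewrite vE fE vsE addbA.
- by apply: clo_ext (unary_in_const u) => i; rewrite vE.
- by apply: clo_ext (unary_in_clo u (fun=> clo_mem F Ss)) => i; rewrite vE.
Qed.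

Definition has_minority : Prop := has3 F (fun x y z => x (+) y (+) z).

(** Identifying the remaining arguments gives [c + x + y + d z], where [d] is the parity of their
    coefficients; nesting this once in itself cancels [c] and leaves a single [z]. *)
Lemma minority_of_affine f c (a : 'I_(tag f) -> bool) (i j : 'I_(tag f)) :
  List.In f F -> (forall x, @ap f x = c (+) \big[addb/false]_k (a k && x k)) ->
  i != j -> a i -> a j -> has_minority.
Proof.
move=> Ff fE ij ai aj.
pose k l := if l == i then (false, false) else if l == j then (false, true)
            else (true, false).
have := has4_minor k Ff; set g := (fun x y z w : bool => _) => hg.
pose d := \big[addb/false]_(l | (l != i) && (l != j)) a l.
have gE x y z w : g x y z w = c (+) (x (+) y (+) (d && z)).
  rewrite /g fE (bigD1 i) //= (bigD1 j) 1?eq_sym //= /k eqxx ai aj /= eq_sym.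
  rewrite (negPf ij) eqxx -addbA; congr (_ (+) (_ (+) (_ (+) _))).
  rewrite big_distrl /=; apply: eq_bigr => l /andP[/negPf -> /negPf ->] //.
case dE: d; rewrite {}dE /= in gE.
  move=> I S x y z cx cy cz.
  apply: clo_ext (hg _ _ _ _ _ _ (hg _ _ _ _ _ _ cx cy cz cz) cz cz cz) => l /=.
  by rewrite !gE; case: (x l) (y l) (z l) (c) => [] [] [] [].
move=> I S x y z cx cy cz.
apply: clo_ext (hg _ _ _ _ _ _ cx (hg _ _ _ _ _ _ cy cz cz cz) cz cz) => l /=.
by rewrite !gE; case: (x l) (y l) (z l) (c) => [] [] [] [].
Qed.

Lemma affine_dichotomy : (forall f, List.In f F -> affine (@ap f)) ->
  (forall f, List.In f F -> const_or_unary f) \/ has_minority.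
Proof.
move=> aff; have [m|nom] := classic has_minority; [by right | left => f Ff].
have [c [a fE]] := aff f Ff; exists c.
have [[i ai]|no] := classic (exists i, a i).
  right; exists i => x; rewrite fE (bigD1 i) //= ai big1 ?addbF // => j ji.
  case aj: (a j) => //; case: nom; exact: (minority_of_affine Ff fE ji aj ai).
left=> x; rewrite fE big1 ?addbF // => j _; case aj: (a j) => //.
by case: no; exists j.
Qed.

Definition xor_list (I : Type) (l : seq (I -> bool)) (i : I) : bool :=
  \big[addb/false]_(s <- l) s i.

Fixpoint all_in (I : Type) (S : (I -> bool) -> Prop) (l : seq (I -> bool)) : Prop :=
  if l is s :: l' then S s /\ all_in S l' else True.

Lemma all_in_cat (I : Type) (S : (I -> bool) -> Prop) l1 l2 :
  all_in S l1 -> all_in S l2 -> all_in S (l1 ++ l2).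
Proof. by elim: l1 => //= s l1 IH [Ss /IH h] /h. Qed.

Lemma all_in_flatten (I : Type) (S : (I -> bool) -> Prop) (J : Type)
    (r : seq J) (l : J -> seq (I -> bool)) :
  (forall j, all_in S (l j)) -> all_in S (flatten [seq l j | j <- r]).
Proof. by move=> h; elim: r => //= j r IH; apply: all_in_cat. Qed.

Lemma odd_sumn (s : seq nat) : odd (sumn s) = \big[addb/false]_(n <- s) odd n.
Proof. by elim: s => [|n s IH]; rewrite ?big_nil // big_cons /= oddD IH. Qed.

(** Identifying the generators in [c + xor_list l] leaves [c + p x] with [p] the parity of [size l].
    This unary trace is the only obstruction: the minority adds two generators at a time and so
    reaches every list of the same parity. *)
Lemma clo_affineP (I : Type) (S : (I -> bool) -> Prop) v :
  (forall f, List.In f F -> affine (@ap f)) -> has_minority ->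
  clo F S v <-> exists c l, [/\ unary_in (exists s, S s) c (odd (size l)),
    all_in S l & v =1 (fun i => c (+) xor_list l i)].
Proof.
move=> aff hmin; split=> [|[c [l [u Sl vE]]]].
  elim=> {v} [s v Ss sv|f vs v Ff _ IH vE].
    exists false, [:: s]; split=> // [|i]; last by rewrite /xor_list big_seq1 sv.
    by apply: unary_in_id; exists s.
  have [c /fin_all_exists [l h]] := fin_all_exists IH.
  have [c0 [a fE]] := aff f Ff.
  pose r := [seq j <- enum 'I_(tag f) | a j].
  have sumE (g : 'I_(tag f) -> bool) :
      \big[addb/false]_j (a j && g j) = \big[addb/false]_(j <- r) g j.
    rewrite big_filter -big_enum /= [RHS]big_mkcond; apply: eq_bigr => j _.
    by case: (a j).
  exists (ap c), (flatten [seq l j | j <- r]); split.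
  - apply: (unary_in_ap (c := c) (p := fun j => odd (size (l j))) Ff) => [j|x].
      by have [] := h j.
    rewrite !fE !sumE -addbA; congr (_ (+) _); rewrite big_split /=; congr (_ (+) _).
    rewrite -big_distrl /= size_flatten odd_sumn /shape -map_comp big_map.
    by case: x.
  - by apply: all_in_flatten => j; have [] := h j.
  - move=> i; rewrite vE !fE -addbA; congr (_ (+) _); rewrite !sumE.
    rewrite /xor_list big_flatten /= big_map -big_split /=.
    by apply: eq_bigr => j _; have [_ _ ->] := h j.
(* Two vectors are removed at once, which keeps the parity in [u]; lists of length 0 or 1 are
   covered by the unary functions themselves. *)
suff cl m : size l <= m -> clo F S (fun i => c (+) xor_list l i).
  by apply: clo_ext (cl _ (leqnn _)) => i; rewrite vE.
elim: m l u Sl {v vE} => [|m IH] [|s [|s' l]] //= u.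
- by move=> _ _; apply: clo_ext (unary_in_const u) => i; rewrite /xor_list big_nil addbF.
- by move=> _ _; apply: clo_ext (unary_in_const u) => i; rewrite /xor_list big_nil addbF.
- move=> [Ss _] _.
  apply: clo_ext (unary_in_clo u (fun=> clo_mem F Ss)) => i.
  by rewrite /xor_list big_seq1.
- move=> [Ss [Ss' Sl]] lm; rewrite negbK in u.
  have cl := IH l u Sl (ltnW lm).
  apply: clo_ext (hmin _ _ _ _ _ cl (clo_mem F Ss) (clo_mem F Ss')) => i.
  by rewrite /xor_list !big_cons; case: (c) (s i) (s' i) (bigop _ _ _) => [] [] [] [].
Qed.

(** * Conjunctions *)

Definition meet_morph (f : operation bool) : Prop :=
  forall x y, @ap f (fun j => x j && y j) = ap x && ap y.

(** If [f] is 1 at the all-one vector, each other input is a meet of vectors with a single 0, so [f]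
    is known from its values on these; the value 1 at the zero vector forces a constant. *)
Lemma meet_morphP f : meet_morph f ->
  (exists c, forall x, @ap f x = c) \/
  (exists a : 'I_(tag f) -> bool, (exists i, a i) /\
     forall x, @ap f x = [forall i, a i ==> x i]).
Proof.
move=> mf; case f1: (@ap f (fun=> true)); last first.
  left; exists false => x; have := mf x (fun=> true).
  by rewrite f1 andbF => <-; apply: eq_ap => j; rewrite andbT.
case f0: (@ap f (fun=> false)).
  by left; exists true => x; have := mf (fun=> false) x; rewrite /= f0 => /esym.
(* Argument [i] matters exactly when setting it alone to 0 makes [f] vanish. *)
right; pose a i := ~~ @ap f (fun k => k != i); exists a.
have fE x : @ap f x = [forall i, a i ==> x i].
  have claim (l : seq 'I_(tag f)) : ap (fun k => (k \in l) ==> x k) =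
      all (fun i => a i ==> x i) l.
    elim: l => [|i l IH]; first exact: f1.
    rewrite /= -IH; have -> : a i ==> x i = ap (fun k => (k == i) ==> x i).
      rewrite /a; case: (x i); first by rewrite implybT -[LHS]f1; apply: eq_ap => k; rewrite implybT.
      by rewrite implybF negbK; apply: eq_ap => k; rewrite implybF.
    rewrite -mf; apply: eq_ap => k; rewrite inE; case: eqP => [->|] //=.
    by case: (i \in l); rewrite ?andbb ?andbT.
  rewrite -(@eq_ap f (fun k => (k \in enum 'I_(tag f)) ==> x k)); last first.
    by move=> k; rewrite mem_enum.
  rewrite claim; apply/allP/forallP => h i; first by apply: h; rewrite mem_enum.
  by move=> _; apply: h.
split=> //; apply: NNPP => no; move: f0; rewrite fE => /forallP; apply=> i.
by case ai: (a i) => //; case: no; exists i.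
Qed.

Lemma all_in_counter (I : Type) (S : (I -> bool) -> Prop) l (j : I) :
  all_in S l -> ~~ all (fun r => r j) l ->
  exists2 r, S r & (forall i, all (fun r => r i) l -> r i) /\ r j = false.
Proof.
elim: l => //= s l IH [Ss Sl]; rewrite negb_and => /orP[/negbTE sj|nl].
  by exists s => //; split=> // i /andP[].
have [r Sr [lr rj]] := IH Sl nl.
by exists r => //; split=> // i /andP[_]; exact: lr.
Qed.

Lemma clo_meet_sound (I : Type) (S : (I -> bool) -> Prop) v :
  (forall f, List.In f F -> meet_morph f) -> clo F S v ->
  (exists c, unary_in (exists s, S s) c false /\ v =1 (fun=> c)) \/
  exists s l, [/\ S s, all_in S l & v =1 (fun i => all (fun r => r i) (s :: l))].
Proof.
move=> hF; elim=> {v} [s v Ss sv|f vs v Ff cl IH vE].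
  by right; exists s, [::]; split=> // i; rewrite /= andbT sv.
have [[c fE]|[a [[i0 ai0] fE]]] := meet_morphP (hF f Ff).
  left; exists c; split=> [|i]; last by rewrite vE fE.
  have [cp u] := fin_all_exists (fun j => clo_unary_in (cl j)).
  by apply: (unary_in_ap Ff u) => x; rewrite fE addbF.
set U := unary_in (exists s, S s) in IH *.
have [[j [aj [u vj]]]|no0] :=
    classic (exists j, a j /\ U false false /\ vs j =1 (fun=> false)).
  left; exists false; split=> // i; rewrite vE fE.
  by apply/negbTE/forallPn; exists j; rewrite aj vj.
(* An argument that is the constant 1 contributes the empty list, and the fact that 1 is available
   is recorded for the case where all lists are empty. *)
have /fin_all_exists [l h] : forall j, exists l, all_in S l /\ (a j ->
    vs j =1 (fun i => all (fun r => r i) l) /\ (l = [::] -> U true false)).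
  move=> j; have [[c [u vj]]|[s [l [Ss Sl vj]]]] := IH j.
    exists [::]; split=> // aj; case: c u vj => u vj //.
    by case: no0; exists j.
  by exists (s :: l).
pose L := flatten [seq l j | j <- enum 'I_(tag f) & a j].
have vL i : v i = all (fun r => r i) L.
  have -> : all (fun r => r i) L = all (fun j => all (fun r => r i) (l j))
      [seq j <- enum 'I_(tag f) | a j].
    by rewrite /L; elim: [seq j <- _ | _] => //= j r IHr; rewrite all_cat IHr.
  rewrite vE fE; apply/forallP/allP => [v1 j|v1 j].
    rewrite mem_filter => /andP[aj _]; have [_ /(_ aj)[<- _]] := h j.
    by have := v1 j; rewrite aj.
  apply/implyP => aj; have [_ /(_ aj)[-> _]] := h j.
  by apply: v1; rewrite mem_filter aj mem_enum.
have SL : all_in S L by apply: all_in_flatten => j; have [] := h j.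
case LE: L => [|s L']; last first.
  by right; exists s, L'; move: SL; rewrite LE => -[Ss SL']; split=> // i; rewrite vL LE.
left; exists true; split=> [|i]; last by rewrite vL LE.
have [_ /(_ ai0)[_]] := h i0; apply; move: LE; rewrite /L.
have : i0 \in [seq j <- enum 'I_(tag f) | a j] by rewrite mem_filter ai0 mem_enum.
elim: [seq j <- _ | _] => //= j r IHr; rewrite inE => /orP[/eqP <-|/IHr {}IHr].
  by case: (l i0).
by case: (l j).
Qed.

(** The meet is taken over one given vector per coordinate, above the target and agreeing with it
    there. The first conjunct supplies the vector that starts the meet, also when there is no
    coordinate. *)
Lemma clo_meetP (I : finType) (S : (I -> bool) -> Prop) v :
  (forall f, List.In f F -> meet_morph f) -> has2 F andb ->
  clo F S v <-> (exists c, unary_in (exists s, S s) c false /\ v =1 (fun=> c)) \/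
    ((exists2 s, S s & forall i, v i -> s i) /\
     forall j, exists2 s, S s & (forall i, v i -> s i) /\ s j = v j).
Proof.
move=> hF hand; split=> [cl|[[c [u vE]]|[[s Ss vs] h]]].
- have [?|[s [l [Ss Sl vE]]]] := clo_meet_sound hF cl; [by left | right].
  have s1 i : v i -> s i by rewrite vE => /andP[].
  split=> [|j]; first by exists s.
  case vj: (v j); first by exists s; rewrite ?s1 // vj.
  have Ssl : all_in S (s :: l) by [].
  have [|r Sr [vr rj]] := all_in_counter (j := j) Ssl; first by rewrite -vE vj.
  by exists r => //; split=> // i; rewrite vE; exact: vr.
- by apply: clo_ext (unary_in_const u) => i; rewrite vE.
- have claim (l : seq I) : exists2 w, clo F S w &
      (forall i, v i -> w i) /\ forall j, j \in l -> w j = v j.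
    elim: l => [|j l [w cw [vw wl]]]; first by exists s => //; exact: clo_mem.
    have [r Sr [vr rj]] := h j.
    exists (fun i => w i && r i); first exact: (hand _ _ _ _ cw (clo_mem F Sr)).
    split=> [i vi|k]; first by rewrite vw ?vr.
    case vk: (v k); first by rewrite vw ?vr.
    rewrite inE => /orP[/eqP kj|/wl ->]; last by rewrite vk.
    by rewrite kj rj -kj vk andbF.
  have [w cw [_ wE]] := claim (enum I).
  by apply: clo_ext cw => i; rewrite wE // mem_enum.
Qed.

End Cases.

(** * Closures determined by projections *)

Section Local.

Variable F : seq (operation bool).

(** With positive [k] and no coordinate this holds vacuously, whence the separate assumptions that
    the closure is inhabited. *)
Definition locally_in (k : nat) (I : Type) (S : (I -> bool) -> Prop) (v : I -> bool) :
  Prop :=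
  forall J : 'I_k -> I, exists2 w, clo F S w & forall i, w (J i) = v (J i).

Lemma locally_in_clo k (I : Type) (S : (I -> bool) -> Prop) (v : I -> bool) :
  clo F S v -> locally_in k S v.
Proof. by move=> cv J; exists v. Qed.

Lemma locally_in_seq k (I : eqType) (S : (I -> bool) -> Prop) v (l : seq I) :
  (exists w, clo F S w) -> locally_in k S v -> size l <= k ->
  exists2 w, clo F S w & {in l, w =1 v}.
Proof.
case: l => [[w cw]|x0 l ne loc lk]; first by exists w.
have [w cw wv] := loc (fun i => nth x0 (x0 :: l) i); exists w => // x lx.
have xk : index x (x0 :: l) < k by apply: leq_trans lk; rewrite index_mem.
by have := wv (Ordinal xk); rewrite /= nth_index.
Qed.

Lemma eqfun_in_enum (I : finType) (w v : I -> bool) : {in enum I, w =1 v} -> w =1 v.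
Proof. by move=> e i; apply: e; rewrite mem_enum. Qed.

(* Baker--Pixley for a majority operation. *)
Lemma clo_maj_local (I : finType) (S : (I -> bool) -> Prop) (v : I -> bool) :
  has3 F maj3 -> (exists w, clo F S w) -> locally_in 2 S v -> clo F S v.
Proof.
move=> hm ne loc.
have claim m (l : seq I) : size l <= m -> exists2 w, clo F S w & {in l, w =1 v}.
  elim: m l => [|m IH] l lm; first by apply: (locally_in_seq ne loc); apply: leq_trans lm _.
  have [lm2|] := leqP (size l) 2; first exact: (locally_in_seq ne loc).
  case: l lm => [|a [|b [|c l]]] //= lm _.
  have [|wa ca ea] := IH (b :: c :: l); first by [].
  have [|wb cb eb] := IH (a :: c :: l); first by [].
  have [|wc cc ec] := IH (a :: b :: l); first by [].
  (* Each of [a], [b], [c] is left uncontrolled by one of the three vectors only, and the other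
     elements by none, so at least two of the three agree with [v] everywhere on the list. *)
  exists (fun i => maj3 (wa i) (wb i) (wc i)); first exact: (hm _ _ _ _ _ ca cb cc).
  have use w (r : seq I) i : {in r, w =1 v} -> i \in r -> w i = v i by move=> e /e.
  move=> i; rewrite !inE => /or4P[/eqP->|/eqP->|/eqP->|il].
  - rewrite (use _ _ _ eb) ?(use _ _ _ ec) ?inE ?eqxx ?orbT //.
    by rewrite /maj3; case: (v a) (wa a) => [] [].
  - rewrite (use _ _ _ ea) ?(use _ _ _ ec) ?inE ?eqxx ?orbT //.
    by rewrite /maj3; case: (v b) (wb b) => [] [].
  - rewrite (use _ _ _ ea) ?(use _ _ _ eb) ?inE ?eqxx ?orbT //.
    by rewrite /maj3; case: (v c) (wc c) => [] [].
  - rewrite (use _ _ _ ea) ?(use _ _ _ eb) ?(use _ _ _ ec) ?inE ?il ?orbT //.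
    by rewrite /maj3; case: (v i).
have [w cw wE] := claim _ (enum I) (leqnn _).
by apply: clo_ext cw; apply: eqfun_in_enum.
Qed.

Definition and_or (x y z : bool) := x && (y || z).

(* Below a fixed element, closed sets are lattices. *)
Lemma clo_and_or_local (I : finType) (S : (I -> bool) -> Prop) (v u : I -> bool) :
  has3 F and_or -> clo F S u -> (forall i, v i -> u i) -> locally_in 2 S v ->
  clo F S v.
Proof.
move=> hs cu vu loc.
have meet a b : @clo F I S a -> clo F S b -> clo F S (fun i => a i && b i).
  by move=> ca cb; apply: clo_ext (hs _ _ _ _ _ ca cb cb) => i; rewrite /and_or orbb.
have ne : exists w, clo F S w by exists u.
have pair i j : exists2 w, clo F S w & w i = v i /\ w j = v j.
  have [|w cw wE] := locally_in_seq (l := [:: i; j]) ne loc; first by [].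
  by exists w => //; rewrite !wE ?inE ?eqxx ?orbT.
(* The meet over all [j] of vectors agreeing with [v] at [i] and [j] lies below [v] and still has
   the bit of [v] at [i]. *)
have below i : exists2 w, clo F S w & (forall j, w j -> v j) /\ (v i -> w i).
  suff [w cw [wv wi]] : exists2 w, clo F S w &
      (forall j, j \in enum I -> w j -> v j) /\ (v i -> w i).
    by exists w => //; split=> // j; apply: wv; rewrite mem_enum.
  elim: (enum I) => [|j l [w cw [wv wi]]]; first by exists u => //; split=> //; exact: vu.
  have [r cr [ri rj]] := pair i j; exists (fun k => w k && r k); first exact: meet.
  split=> [k|vi]; last by rewrite wi // ri.
  rewrite inE => /orP[/eqP->|lk]; first by rewrite rj => /andP[].
  by case/andP=> wk _; exact: wv.
have base : exists2 w, clo F S w & forall j, w j -> v j.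
  have [[i _]|no] := classic (exists i : I, True).
    by have [w cw [wv _]] := below i; exists w.
  by exists u => // j; case: no; exists j.
suff [w cw [wv wl]] : exists2 w, clo F S w & (forall j, w j -> v j) /\
    (forall j, j \in enum I -> v j -> w j).
  apply: clo_ext cw => i; apply/idP/idP; first exact: wv.
  by apply: wl; rewrite mem_enum.
elim: (enum I) => [|i l [w cw [wv wl]]].
  by have [w cw wv] := base; exists w.
have [r cr [rv ri]] := below i.
(* Joins are available only below [u]; as [v] is below [u], cutting by [u] loses no bit of [v]. *)
exists (fun k => and_or (u k) (w k) (r k)); first exact: (hs _ _ _ _ _ cu cw cr).
split=> [j|j]; first by case/andP=> _ /orP[/wv|/rv].
rewrite inE /and_or => /orP[/eqP->|lj] vj; rewrite vu //=.
  by rewrite ri // orbT.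
by rewrite wl.
Qed.

(** These are the 1-separating functions of Post's lattice, the zero function included. *)
Definition separating (f : operation bool) : Prop :=
  (forall x, @ap f x = false) \/ (exists i, forall x, @ap f x -> x i).

(* If [f] is not below any variable, then the all-one vector is determined locally:
   if it were missing from the closure on a minimal set of more than [tag f]
   coordinates, then every other vector would be there, and [f] would yield it. *)
Lemma clo_upper_bound (I : finType) (S : (I -> bool) -> Prop) (v : I -> bool) f :
  has3 F and_or -> List.In f F -> ~ separating f -> (exists w, clo F S w) ->
  locally_in (tag f) S v -> exists2 u, clo F S u & forall i, v i -> u i.
Proof.
move=> hs Ff nsep ne loc.
have meet a b : @clo F I S a -> clo F S b -> clo F S (fun i => a i && b i).
  by move=> ca cb; apply: clo_ext (hs _ _ _ _ _ ca cb cb) => i; rewrite /and_or orbb.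
(* [X i] is accepted by [f] although its bit [i] is 0: these are the inputs from which the all-one
   vector is assembled. *)
have wit i : exists x, @ap f x && ~~ x i.
  apply: NNPP => no; apply: nsep; right; exists i => x fx.
  by apply/negPn/negP => xi; apply: no; exists x; rewrite fx.
have {wit} [X HX] := fin_all_exists wit.
have claim m (l : seq I) : size l <= m -> uniq l -> all v l ->
    exists2 u, clo F S u & {in l, u =1 v}.
  elim: m l => [|m IH] l lm ul vl.
    by apply: (locally_in_seq ne loc); apply: leq_trans lm _.
  have [|lt] := leqP (size l) (tag f); first exact: (locally_in_seq ne loc).
  have {IH} del j : j \in l -> exists2 u, clo F S u & {in rem j l, u =1 v}.
    move=> jl; apply: IH; rewrite ?rem_uniq ?size_rem //.
      by case: l lm jl {ul vl lt} => //= a l lm _.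
    by apply/allP => k /mem_rem /(allP vl).
  have vE k : k \in l -> v k by move/(allP vl).
  have [[j [jl [u cu [eu uj]]]]|no] := classic (exists j, j \in l /\
      exists2 u, clo F S u & {in rem j l, u =1 v} /\ u j).
    exists u => // k kl; have [->|kj] := eqVneq k j; first by rewrite uj vE.
    by apply: eu; rewrite (mem_rem_uniq _ ul) !inE kj.
  (* As the wanted vector is missing, a vector that is 1 on [l] except possibly at [j] must be 0 at
     [j]. *)
  have cut j : j \in l -> exists2 u, clo F S u & {in l, forall k, u k = (k != j)}.
    move=> jl; have [u cu eu] := del j jl; exists u => // k kl.
    have [->|kj] := eqVneq k j.
      by apply/negbTE/negP => uj; apply: no; exists j; split=> //; exists u.
    by rewrite eu ?vE // (mem_rem_uniq _ ul) !inE kj.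
  (* Meets of the vectors with a single 0 give on [l] every pattern that contains a 0. *)
  have pattern (q : I -> bool) : has (fun j => ~~ q j) l ->
      exists2 u, clo F S u & {in l, u =1 q}.
    move=> hq; have gen (r : seq I) : {subset r <= l} -> has (fun j => ~~ q j) r ->
        exists2 u, clo F S u & {in l, forall k, u k = all (fun j => ~~ q j ==> (k != j)) r}.
      elim: r => //= j r IHr sub; have jl : j \in l by apply: sub; rewrite inE eqxx.
      have sub' : {subset r <= l} by move=> k kr; apply: sub; rewrite inE kr orbT.
      have [u cu eu] := cut j jl; case: (boolP (has _ r)) => [hr _|nr].
        have [w cw ew] := IHr sub' hr.
        case qj: (q j); first by exists w => // k kl; rewrite ew.
        by exists (fun k => u k && w k) => [|k kl]; [exact: meet | rewrite eu ?ew].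
      rewrite orbF => nqj; exists u => // k kl; rewrite eu // nqj /=.
      rewrite -all_predC in nr; suff -> : all (fun j' => ~~ q j' ==> (k != j')) r by rewrite andbT.
      by apply/allP => i ir; have /= := allP nr i ir; rewrite negbK => ->.
    have [u cu eu] := gen l (fun _ => id) hq; exists u => // k kl; rewrite eu //.
    apply/allP/idP => [/(_ k kl)|qk j _]; first by rewrite eqxx implybF negbK.
    by case: eqVneq => [<-|]; rewrite ?qk ?implybT.
  have [x0 lx0] : exists x0, x0 \in l.
    by case: l lt {lm vl ul del vE no cut pattern} => // x0 l _; exists x0; rewrite inE eqxx.
  (* An operation without arguments that is not separating is the constant 1. *)
  have [f0|[i0 _]] : (forall x, @ap f x) \/ exists i : 'I_(tag f), True.
  + have [e|e] := posnP (tag f); last by right; exists (Ordinal e).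
    left=> x; apply: NNPP => nx; apply: nsep; left=> y; rewrite -(@eq_ap f x).
      by apply/negbTE/negP.
    by move=> i; have := ltn_ord i; rewrite {2}e.
  + have [w cw] := ne.
    exists (fun i => @ap f (fun=> w i)); first exact: (clo_app Ff).
    by move=> k kl; rewrite vE // f0.
  (* Coordinate [k] will feed [f] with the input [X (phi k)]. The [i]-th element of [l] gets [X i],
     so argument [i] has a 0 there and is one of the available patterns; [f] then returns 1 on all
     of [l]. *)
  pose phi k : 'I_(tag f) := insubd i0 (index k l).
  have nthl (i : 'I_(tag f)) : nth x0 l i \in l by rewrite mem_nth // (ltn_trans (ltn_ord i)).
  have phi_nth (i : 'I_(tag f)) : phi (nth x0 l i) = i.
    apply: val_inj; rewrite /phi index_uniq // ?(ltn_trans (ltn_ord i)) //.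
    by rewrite val_insubd ltn_ord.
  have args (i : 'I_(tag f)) : exists2 u, clo F S u & {in l, forall k, u k = X (phi k) i}.
    apply: pattern; apply/hasP; exists (nth x0 l i) => //; rewrite phi_nth.
    by have /andP[] := HX i.
  have [vs cvs evs] := fin_all_exists2 args.
  exists (fun k => @ap f (fun i => vs i k)); first exact: clo_app.
  move=> k kl; rewrite vE // (@eq_ap f _ (X (phi k))) => [|i]; last exact: evs.
  by have /andP[] := HX (phi k).
have [||u cu eu] := claim _ [seq i <- enum I | v i] (leqnn _).
- by rewrite filter_uniq ?enum_uniq.
- by apply/allP => i; rewrite mem_filter => /andP[].
- by exists u => // i vi; rewrite eu // mem_filter vi mem_enum.
Qed.

Lemma locally_in_mono k k' (I : Type) (S : (I -> bool) -> Prop) (v : I -> bool) :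
  k' <= k -> (exists w, clo F S w) -> locally_in k S v -> locally_in k' S v.
Proof.
move=> kk' ne loc J; case: k' => [|k'] in kk' J *; first by case: ne => w cw; exists w => // -[].
pose J' (i : 'I_k) := J (inord i).
have [w cw wE] := loc J'; exists w => // i.
by have := wE (widen_ord kk' i); rewrite /J' /= inord_val.
Qed.

Lemma clo_local_nonseparating (I : finType) (S : (I -> bool) -> Prop) (v : I -> bool) f :
  has3 F and_or -> List.In f F -> ~ separating f -> (exists w, clo F S w) ->
  locally_in (maxn (tag f) 2) S v -> clo F S v.
Proof.
move=> hs Ff nsep ne loc.
have [|u cu vu] := clo_upper_bound (v := v) hs Ff nsep ne.
  by apply: locally_in_mono loc => //; rewrite leq_maxl.
apply: (clo_and_or_local hs cu vu).
by apply: locally_in_mono loc => //; rewrite leq_maxr.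
Qed.

(** A separating operation returns a vector below one of its arguments, or zero, so each vector of
    the closure is below a given one or is zero; conversely such an upper bound is what
    [clo_and_or_local] asks for. *)
Lemma clo_separatingP (I : finType) (S : (I -> bool) -> Prop) (v : I -> bool) :
  has3 F and_or -> (forall f, List.In f F -> separating f) ->
  clo F S v <-> [/\ exists w, clo F S w, locally_in 2 S v &
    (exists2 s, S s & forall i, v i -> s i) \/ (forall i, v i = false)].
Proof.
move=> hs sep; split=> [cv|[ne loc [[s Ss vs]|v0]]]; last 1 first.
- have [w cw] := ne; apply: (clo_and_or_local hs cw) => // i; by rewrite v0.
- split; [by exists v | exact: locally_in_clo |].
  elim: cv => {v} [s v Ss sv|f vs v Ff _ IH vE].
    by left; exists s => // i; rewrite sv.
  have [f0|[i fi]] := sep f Ff; first by right=> i; rewrite vE f0.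
  case: (IH i) => [[s Ss vs_s]|vs0]; [left|right].
    by exists s => // j; rewrite vE => /fi; exact: vs_s.
  by move=> j; apply/negbTE/negP; rewrite vE => /fi; rewrite vs0.
- exact: (clo_and_or_local hs (clo_mem F Ss)).
Qed.

(** With [n x y] for [x && ~~ y], the operation is [n x (n (n x y) z)]. *)
Lemma has3_and_or_minus : has2 F (fun x y => x && ~~ y) -> has3 F and_or.
Proof.
move=> hn I S a b c ca cb cc.
apply: clo_ext (hn _ _ _ _ ca (hn _ _ _ _ (hn _ _ _ _ ca cb) cc)) => i.
by case: (a i) (b i) (c i) => [] [] [].
Qed.

(** Grouping the arguments by their pair of values in [x] and [y] leaves four variables. Failing to
    preserve the meet is either a drop from 1 to 0 along a chain, or a meet sent to 0 although both
    factors are sent to 1. *)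
Lemma has3_and_or_morph f : List.In f F -> has2 F andb -> ~ meet_morph f ->
  has3 F and_or.
Proof.
move=> Ff hand nm.
have [x [y xy]] : exists x y, @ap f (fun j => x j && y j) <> ap x && ap y.
  by apply: NNPP => no; apply: nm => x y; apply: NNPP => e; apply: no; exists x, y.
have := has4_minor (fun j => (x j, y j)) Ff; set g := (fun x y z w : bool => _) => hg.
have g1 : g false false false true = ap (fun j => x j && y j).
  by apply: eq_ap => j; case: (x j); case: (y j).
have g2 : g false false true true = ap x by apply: eq_ap => j; case: (x j); case: (y j).
have g3 : g false true false true = ap y by apply: eq_ap => j; case: (x j); case: (y j).
rewrite -g1 -g2 -g3 in xy; move: g hg {g1 g2 g3} xy => g hg xy.
have drop3 op : (forall x y z, op x y z = op x y x) -> has3 F op -> has2 F (fun x y => op x y x).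
  by move=> e h I S a b ca cb; apply: clo_ext (h _ _ _ _ _ ca cb ca).
(* [g'] is the minor of [g] along the chain [x /\ y <= x] (or [y]). *)
have chain (g' : bool -> bool -> bool -> bool) : has3 F g' ->
    g' false false true = true -> g' false true true = false -> has3 F and_or.
  move=> hg' e1 e2.
  (* For [x = 1] the arguments are [y && z], [y] and 1. If [e3] is true the value is [~~ y || z],
     and substituting it for [y] in itself gives [y || z]; otherwise [z = y] gives [x && ~~ y]. *)
  have ht : has3 F (fun x y z => x && g' (x && (y && z)) (x && y) x).
    move=> I S a b c ca cb cc; apply: (hand _ _ _ _ ca); apply: hg' => //.
      by apply: (hand _ _ _ _ ca); exact: hand.
    exact: hand.
  case e3: (g' true true true).
    move=> I S a b c ca cb cc.
    apply: clo_ext (ht _ _ _ _ _ ca (ht _ _ _ _ _ ca cb cc) cc) => i.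
    by case: (a i) (b i) (c i) => [] [] []; rewrite /= ?(e1, e2, e3) //= ?(e1, e2, e3).
  apply: has3_and_or_minus => I S a b ca cb.
  apply: clo_ext (ht _ _ _ _ _ ca cb cb) => i.
  by case: (a i) (b i) => [] [] /=; rewrite ?(e1, e2, e3).
case e1: (g false false false true) xy.
  case e2: (g false false true true) => /=; last first.
    move=> _; apply: (chain (fun x y z => g x x y z)) => //.
    by move=> I S a b c ca cb cc; exact: hg.
  case e3: (g false true false true) => // _.
  apply: (chain (fun x y z => g x y x z)) => //.
  by move=> I S a b c ca cb cc; exact: hg.
case e2: (g false false true true) => //=; case e3: (g false true false true) => // _.
(* For [x = 1] this is 0 at [y = z = 0], 1 where exactly one of [y], [z] is 1, and depends on [e4]
   at [y = z = 1]: it is the wanted operation, or an exclusive or, which gives [x && ~~ z] at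
   [y = x]. *)
have ht : has3 F (fun x y z => x && g (x && (y && z)) (x && z) (x && y) x).
  move=> I S a b c ca cb cc; apply: (hand _ _ _ _ ca); apply: hg => //.
  - by apply: (hand _ _ _ _ ca); exact: hand.
  - exact: hand.
  - exact: hand.
case e4: (g true true true true).
  apply: has3_ext ht => a b c.
  by case: a b c => [] [] []; rewrite /= ?(e1, e2, e3, e4).
apply: has3_and_or_minus => I S a b ca cb.
apply: clo_ext (ht _ _ _ _ _ ca ca cb) => i.
by case: (a i) (b i) => [] [] /=; rewrite ?(e1, e2, e3, e4).
Qed.

End Local.

(** * Duality *)

Definition dual (f : operation bool) : operation bool :=
  existT (fun t => {ffun t.-tuple bool -> bool}) (tag f)
    [ffun x => ~~ tagged f (map_tuple negb x)].

Definition negS (I : Type) (S : (I -> bool) -> Prop) (s : I -> bool) : Prop :=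
  exists2 r, S r & s =1 (fun i => ~~ r i).

Lemma ap_dual f (x : 'I_(tag f) -> bool) :
  @ap (dual f) x = ~~ @ap f (fun j => ~~ x j).
Proof.
rewrite /ap /= ffunE; congr (~~ tagged f _); apply: eq_from_tnth => j.
by rewrite tnth_map !tnth_mktuple.
Qed.

Lemma clo_dual F (I : Type) (S : (I -> bool) -> Prop) (v : I -> bool) :
  clo F S v -> clo (map dual F) (negS S) (fun i => ~~ v i).
Proof.
elim=> {v} [s v Ss sv|f vs v Ff _ IH vE].
  by apply: (@clo_gen _ _ _ (fun i => ~~ s i)) => [|i]; [exists s | rewrite sv].
apply: (@clo_op _ _ _ (dual f) (fun j i => ~~ vs j i)) => // [|i].
  exact: List.in_map.
by rewrite ap_dual vE; congr (~~ _); apply: eq_ap => j; rewrite negbK.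
Qed.

Lemma clo_undual F (I : Type) (S : (I -> bool) -> Prop) (v : I -> bool) :
  clo (map dual F) S v -> clo F (negS S) (fun i => ~~ v i).
Proof.
elim=> {v} [s v Ss sv|f vs v Ff _ IH vE].
  by apply: (@clo_gen _ _ _ (fun i => ~~ s i)) => [|i]; [exists s | rewrite sv].
have /List.in_map_iff [f' [e Ff']] := Ff; case: _ / e in vs vE IH Ff *.
apply: (@clo_op _ _ _ f' (fun j i => ~~ vs j i)) => // i.
by rewrite vE ap_dual negbK.
Qed.

Lemma clo_dualP F (I : Type) (S : (I -> bool) -> Prop) (v : I -> bool) :
  clo F S v <-> clo (map dual F) (negS S) (fun i => ~~ v i).
Proof.
split; first exact: clo_dual.
move/clo_undual => h; apply: (@clo_ext _ _ _ (fun i => ~~ ~~ v i)) => [i|].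
  by rewrite negbK.
apply: clo_eq_gen h => s [r [q Sq rq] sr]; exists q => // i.
by rewrite sr rq negbK.
Qed.

Lemma has2_dual F : has2 F orb -> has2 (map dual F) andb.
Proof.
move=> h I S a b /clo_undual ca /clo_undual cb.
have := clo_dual (h _ _ _ _ ca cb).
move/(clo_ext (w := fun i => a i && b i)) => c.
have {}c : clo [seq dual i | i <- F] (negS (negS S)) (fun i => a i && b i).
  by apply: c => i; rewrite negb_or !negbK.
apply: clo_eq_gen c => s [r [q Sq rq] sr]; exists q => // i.
by rewrite sr rq negbK.
Qed.

(** * First-order definable closures *)

(** Turns propositions about the fixed [F] into constants of a formula or program whose mere
    existence is claimed; no such decision takes place at run time. *)
Definition holds (P : Prop) : bool := if excluded_middle_informative P then true else false.

Lemma holdsP (P : Prop) : reflect P (holds P).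
Proof. by rewrite /holds; case: excluded_middle_informative => h; constructor. Qed.

(* Variables are de Bruijn levels: a quantifier met under [d] quantifiers binds
   variable [d]. Index variables range over coordinates, row variables over the
   given vectors. *)
Inductive fo_form : Type :=
| FTrue
| FTarget of nat          (* bit of the target vector at an index variable *)
| FRowBit of nat & nat    (* bit of a row variable at an index variable *)
| FNot of fo_form
| FAnd of fo_form & fo_form
| FAllIdx of fo_form
| FAllRow of fo_form.

Section Semantics.

Variables (len : nat) (rs : seq nat) (b : nat -> nat -> bool) (y : nat -> bool).

(** An atom with an unbound variable is false, so only the first [d] values of [e] matter ([eq_sat])
    and formulas need no closedness condition. *)
Fixpoint sat (d : nat) (phi : fo_form) (e : nat -> nat) : bool :=
  match phi with
  | FTrue => true
  | FTarget i => (i < d) && y (e i)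
  | FRowBit s i => [&& s < d, i < d & b (e s) (e i)]
  | FNot phi => ~~ sat d phi e
  | FAnd phi psi => sat d phi e && sat d psi e
  | FAllIdx phi => all (fun i => sat d.+1 phi [eta e with d |-> i]) (iota 0 len)
  | FAllRow phi => all (fun a => sat d.+1 phi [eta e with d |-> a]) rs
  end.

Lemma eq_sat d phi e e' : (forall i, i < d -> e i = e' i) -> sat d phi e = sat d phi e'.
Proof.
elim: phi d e e' => //= [i|s i|phi IH|phi IH1 psi IH2|phi IH|phi IH] d e e' ee.
- by case: ltnP => // id; rewrite ee.
- by case: ltnP => //= sd; case: ltnP => //= id; rewrite !ee.
- by rewrite (IH _ _ _ ee).
- by rewrite (IH1 _ _ _ ee) (IH2 _ _ _ ee).
- apply: eq_all => i; apply: IH => j; rewrite ltnS /= => jd.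
  by case: eqP => // /eqP nj; rewrite ee // ltn_neqAle nj.
- apply: eq_all => i; apply: IH => j; rewrite ltnS /= => jd.
  by case: eqP => // /eqP nj; rewrite ee // ltn_neqAle nj.
Qed.

End Semantics.

Fixpoint depth (phi : fo_form) : nat :=
  match phi with
  | FTrue | FTarget _ | FRowBit _ _ => 0
  | FNot phi => depth phi
  | FAnd phi psi => maxn (depth phi) (depth psi)
  | FAllIdx phi | FAllRow phi => (depth phi).+1
  end.

Definition FOr phi psi := FNot (FAnd (FNot phi) (FNot psi)).
Definition FImp phi psi := FNot (FAnd phi (FNot psi)).
Definition FExRow phi := FNot (FAllRow (FNot phi)).
Definition FConst (c : bool) := if c then FTrue else FNot FTrue.
Definition FBig_and (l : seq fo_form) := foldr FAnd FTrue l.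
Definition FBig_or (l : seq fo_form) := foldr FOr (FNot FTrue) l.
Definition FIff phi psi := FOr (FAnd phi psi) (FAnd (FNot phi) (FNot psi)).
Definition FIs (c : bool) phi := if c then phi else FNot phi.

Fixpoint FAllIdxn k phi := if k is k'.+1 then FAllIdx (FAllIdxn k' phi) else phi.

(** Only atoms with bound variables are negated: the others are false for a bit matrix and for its
    complement alike. *)
Fixpoint dual_form d phi :=
  match phi with
  | FTrue => FTrue
  | FTarget i => if i < d then FNot (FTarget i) else FTarget i
  | FRowBit s i =>
      if (s < d) && (i < d) then FNot (FRowBit s i) else FRowBit s i
  | FNot phi => FNot (dual_form d phi)
  | FAnd phi psi => FAnd (dual_form d phi) (dual_form d psi)
  | FAllIdx phi => FAllIdx (dual_form d.+1 phi)
  | FAllRow phi => FAllRow (dual_form d.+1 phi)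
  end.

Section SatLemmas.

Variables (len : nat) (rs : seq nat) (b : nat -> nat -> bool) (y : nat -> bool).

Local Notation sat := (sat len rs b y).

Lemma sat_not d phi e : sat d (FNot phi) e = ~~ sat d phi e.
Proof. by []. Qed.

Lemma sat_and d phi psi e : sat d (FAnd phi psi) e = sat d phi e && sat d psi e.
Proof. by []. Qed.

Lemma sat_or d phi psi e : sat d (FOr phi psi) e = sat d phi e || sat d psi e.
Proof. by rewrite /= negb_and !negbK. Qed.

Lemma sat_imp d phi psi e : sat d (FImp phi psi) e = (sat d phi e ==> sat d psi e).
Proof. by rewrite /= negb_and negbK implybE. Qed.

Lemma sat_exrow d phi e :
  sat d (FExRow phi) e = has (fun a => sat d.+1 phi [eta e with d |-> a]) rs.
Proof. by rewrite /= -has_predC; apply: eq_has => a /=; rewrite negbK. Qed.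

Lemma sat_const d c e : sat d (FConst c) e = c.
Proof. by case: c. Qed.

Lemma sat_is d c phi e : sat d (FIs c phi) e = (sat d phi e == c).
Proof. by case: c => /=; case: (sat d phi e). Qed.

Lemma sat_big_and d l e : sat d (FBig_and l) e = all (fun phi => sat d phi e) l.
Proof. by elim: l => //= phi l ->. Qed.

Lemma sat_big_or d l e : sat d (FBig_or l) e = has (fun phi => sat d phi e) l.
Proof.
by elim: l => //= phi l IH; rewrite negb_and !negbK -[RHS]/(_ || _) -IH.
Qed.

Lemma sat_allidxn k d phi e : sat d (FAllIdxn k phi) e <->
  forall J : 'I_k -> 'I_len, forall e', (forall j : nat, j < d -> e' j = e j) ->
    (forall j : 'I_k, e' (d + j) = J j) -> sat (d + k) phi e'.
Proof.
elim: k d e => [|k IH] d e /=.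
  split=> [se J e' ee' _|h].
    by rewrite addn0 (@eq_sat len rs b y d phi e' e).
  rewrite -[d]addn0; apply: (h (fun j : 'I_0 => False_rect _ (notF (ltn_ord j)))) => //.
  by case.
split=> [/allP h J e' ee' eJ|h].
  have /h/IH : (J ord0 : nat) \in iota 0 len by rewrite mem_iota ltn_ord.
  move/(_ (fun j => J (lift ord0 j))) => {}h.
  rewrite -addSnnS; apply: h => [j|j].
    rewrite ltnS leq_eqVlt => /orP[/eqP->|jd] /=; first by rewrite eqxx -[d]addn0 (eJ ord0).
    by rewrite (ltn_eqF jd) ee'.
  by rewrite addSnnS -(eJ (lift ord0 j)).
apply/allP => i; rewrite mem_iota add0n /= => il; apply/IH => J e' ee' eJ.
pose J' (j : 'I_k.+1) := if unlift ord0 j is Some j' then J j' else Ordinal il.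
rewrite addSnnS; apply: (h J') => j.
  by move=> jd; rewrite ee' ?ltnS ?(ltnW jd) //= (ltn_eqF jd).
rewrite /J'; case: unliftP => [j' ->|->] /=; first by rewrite /bump /= add1n -addSnnS eJ.
by rewrite addn0 ee' //= eqxx.
Qed.

End SatLemmas.

Lemma sat_dual len rs b y d phi e :
  sat len rs b y d (dual_form d phi) e =
  sat len rs (fun a i => ~~ b a i) (fun i => ~~ y i) d phi e.
Proof.
elim: phi d e => //= [i|s i|phi IH|phi IH1 psi IH2|phi IH|phi IH] d e.
- by case: ifP => /= ->.
- by rewrite andbA; case: ifP => /=; [case/andP=> -> -> | rewrite andbA => ->].
- by rewrite IH.
- by rewrite IH1 IH2.
- by apply: eq_all => i; rewrite IH.
- by apply: eq_all => a; rewrite IH.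
Qed.

Definition rowset (len : nat) (rs : seq nat) (b : nat -> nat -> bool)
    (s : 'I_len -> bool) : Prop :=
  exists2 a, a \in rs & s =1 (fun i => b a i).

(** One formula must serve all lengths, row lists and bit matrices. Rows are numbers so that they
    can later be positions in the input. *)
Definition fo_definable (F : seq (operation bool)) : Prop :=
  exists phi, forall len rs b (y : nat -> bool),
    clo F (rowset rs b) (fun i : 'I_len => y i) <-> sat len rs b y 0 phi (fun=> 0).

Lemma fo_definable_dual F : fo_definable (map dual F) -> fo_definable F.
Proof.
case=> phi h; exists (dual_form 0 phi) => len rs b y; rewrite sat_dual.
apply: iff_trans (clo_dualP _ _ _) _; apply: iff_trans (h _ _ _ _).
by split; apply: clo_eq_gen => s [];
  [move=> r [a ra rE] sE; exists (fun i => ~~ b a i) => [|i]; first (by exists a);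
   rewrite sE rE | move=> a ra sE; exists s => //; exists (fun i => b a i) => //; exists a].
Qed.

(** * Formulas for the definable cases *)

Section Formulas.

Variable F : seq (operation bool).

Section SatFormulas.

Variables (len : nat) (rs : seq nat) (b : nat -> nat -> bool) (y : nat -> bool).

Local Notation sat := (sat len rs b y).
Local Notation S := (@rowset len rs b).

Definition match_target k (p : k.-tuple bool) : fo_form :=
  FBig_and [seq FIs (tnth p j) (FTarget j) | j : 'I_k].

Definition match_row k (q : k.-tuple bool) : fo_form :=
  FBig_and [seq FIs (tnth q j) (FRowBit k j) | j : 'I_k].

Lemma sat_match_target k (p : k.-tuple bool) e :
  sat k (match_target p) e = (p == [tuple y (e j) | j < k]).
Proof.
rewrite sat_big_and all_map; apply/allP/eqP => [h|-> j _ /=].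
  apply: eq_from_tnth => j; have := h j (mem_enum _ _).
  by rewrite /= sat_is /= ltn_ord tnth_mktuple => /eqP.
by rewrite sat_is /= ltn_ord tnth_mktuple.
Qed.

Lemma sat_match_row k (q : k.-tuple bool) e :
  sat k (FExRow (match_row q)) e = (q \in [seq [tuple b a (e j) | j < k] | a <- rs]).
Proof.
rewrite sat_exrow; apply/hasP/mapP => -[a ra h]; exists a => //.
  apply: eq_from_tnth => j; move: h; rewrite sat_big_and all_map => /allP/(_ j (mem_enum _ _)).
  by rewrite /= sat_is /= ltnSn ltnW ?ltnS ?ltn_ord // eqxx (ltn_eqF (ltn_ord j)) tnth_mktuple => /eqP.
rewrite sat_big_and all_map; apply/allP => j _.
by rewrite /= sat_is /= ltnSn ltnW ?ltnS ?ltn_ord // eqxx (ltn_eqF (ltn_ord j)) h tnth_mktuple.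
Qed.

Definition tuple_clo k (Q : {set k.-tuple bool}) (p : k.-tuple bool) : Prop :=
  clo F (fun s => exists2 q, q \in Q & s =1 tnth q) (tnth p).

Definition local_case k (p : k.-tuple bool) (Q : {set k.-tuple bool}) : fo_form :=
  FAnd (match_target p)
    (FBig_and [seq FIs (q \in Q) (FExRow (match_row q)) | q : k.-tuple bool]).

(* Enumerates the possible projections [p] of the target and [Q] of the rows. *)
Definition local_form k : fo_form :=
  FBig_or [seq local_case pQ.1 pQ.2
    | pQ <- [seq pQ <- enum {: k.-tuple bool * {set k.-tuple bool}} |
              holds (tuple_clo pQ.2 pQ.1)]].

Lemma sat_local_form k e : sat k (local_form k) e <->
  clo F (fun s => exists2 a, a \in rs & s =1 (fun j : 'I_k => b a (e j)))
    (fun j : 'I_k => y (e j)).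
Proof.
pose Q0 := [set q in [seq [tuple b a (e j) | j < k] | a <- rs]].
have loc : tuple_clo Q0 [tuple y (e j) | j < k] <->
    clo F (fun s => exists2 a, a \in rs & s =1 (fun j : 'I_k => b a (e j)))
      (fun j : 'I_k => y (e j)).
  split=> /(clo_ext (w := _)) h.
    have {}h := h _ (tnth_mktuple _).
    apply: clo_eq_gen h => s [q]; rewrite inE => /mapP[a ra ->] sE.
    by exists s => //; exists a => // j; rewrite sE tnth_mktuple.
  have {}h := h (tnth [tuple y (e j) | j < k]) (fun j => esym (tnth_mktuple _ j)).
  apply: clo_eq_gen h => s [a ra sE]; exists s => //.
  exists [tuple b a (e j) | j < k] => [|j]; last by rewrite tnth_mktuple.
  by rewrite inE; apply/mapP; exists a.
rewrite -loc sat_big_or has_map; split=> [/hasP[[p Q]]|h].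
  rewrite mem_filter /= => /andP[/holdsP h _] /andP[].
  rewrite sat_match_target => /eqP pE; rewrite sat_big_and all_map => /allP hQ.
  rewrite -pE; have -> // : Q0 = Q.
  apply/setP => q; have := hQ q (mem_enum _ _).
  by rewrite /= sat_is sat_match_row !inE => /eqP.
apply/hasP; exists ([tuple y (e j) | j < k], Q0).
  by rewrite mem_filter mem_enum andbT; apply/holdsP.
rewrite /= sat_match_target eqxx sat_big_and all_map; apply/allP => q _.
by rewrite /= sat_is sat_match_row !inE.
Qed.

(** The formula speaks of closures of projections; [clo_lift] and [clo_sub] exchange these with
    projections of the closure. *)
Lemma sat_locally k e : sat 0 (FAllIdxn k (local_form k)) e <->
  locally_in F k S (fun i : 'I_len => y i).
Proof.
rewrite sat_allidxn; split=> h J.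
  pose e' j := if insub j is Some j' then J j' : nat else 0.
  have eJ (j : 'I_k) : e' j = J j.
    by rewrite /e' insubT //= => jk; congr (J _ : nat); apply: val_inj.
  have /sat_local_form := h J e' (fun j (j0 : j < 0) => False_ind _ (notF j0)) eJ.
  move=> c; have {}c : clo F (fun s => exists2 r, S r & s =1 r \o J) (fun j => y (J j)).
    apply: clo_ext (_ : clo F _ (fun j : 'I_k => y (e' j))) => [j|]; first by rewrite eJ.
    apply: clo_eq_gen c => s [a ra sE]; exists s => //.
    by exists (fun i : 'I_len => b a i) => [|j]; [exists a | rewrite sE eJ].
  by have [w cw wE] := clo_lift c; exists w => // j; rewrite [RHS]wE.
move=> e' _ eJ; apply/sat_local_form; rewrite add0n in eJ *.
have [w cw wE] := h J.
have : clo F (fun s => exists2 a, a \in rs & s =1 (fun j : 'I_k => b a (e' j))) (w \o J).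
  apply: clo_sub cw => s [a ra sE]; apply: clo_mem; exists a => // j.
  by rewrite /= sE eJ.
by apply: clo_ext => j; rewrite /= wE eJ.
Qed.

Lemma sat_allidx d phi e : sat d (FAllIdx phi) e <->
  forall i : 'I_len, sat d.+1 phi [eta e with d |-> i : nat].
Proof.
split=> [/allP h i|h]; first by apply: h; rewrite mem_iota ltn_ord.
by apply/allP => i; rewrite mem_iota add0n => /= il; exact: (h (Ordinal il)).
Qed.

Lemma sat_exrowP d phi e : sat d (FExRow phi) e <->
  exists2 a, a \in rs & sat d.+1 phi [eta e with d |-> a].
Proof. by rewrite sat_exrow; split=> [/hasP|h]; last apply/hasP. Qed.

Lemma sat_iff d phi psi e : sat d (FIff phi psi) e = (sat d phi e == sat d psi e).
Proof. by rewrite sat_or /=; case: (sat d phi e); case: (sat d psi e). Qed.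

Definition FNonempty : fo_form := FExRow FTrue.

Lemma sat_nonempty d e : sat d FNonempty e <-> exists s, S s.
Proof.
rewrite sat_exrowP; split=> [[a ra _]|[s [a ra _]]]; last by exists a.
by exists (fun i => b a i), a.
Qed.

(** Which unary functions are available depends on the instance only through the presence of a given
    vector; both answers are constants of the formula. *)
Definition unary_form c p : fo_form :=
  FOr (FAnd FNonempty (FConst (holds (unary_in F True c p))))
      (FAnd (FNot FNonempty) (FConst (holds (unary_in F False c p)))).

Lemma sat_unary_form d c p e :
  sat d (unary_form c p) e <-> unary_in F (exists s, S s) c p.
Proof.
rewrite sat_or !sat_and !sat_const sat_not.
have := sat_nonempty d e; case: (sat d FNonempty e) => h; rewrite ?orbF /=.
  have hT : True <-> exists s, S s by split=> // _; exact: h.1 isT.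
  split=> [/holdsP|u]; first exact: unary_in_eq hT.
  by apply/holdsP; exact: unary_in_eq (iff_sym hT) u.
have hF : False <-> exists s, S s by split=> // /h.2.
split=> [/holdsP|u]; first exact: unary_in_eq hF.
by apply/holdsP; exact: unary_in_eq (iff_sym hF) u.
Qed.

Definition clo_nonempty_form : fo_form :=
  FOr FNonempty (FConst (holds (exists f, List.In f F /\ tag f = 0))).

(** A derivation without generators must start from a nullary operation. *)
Lemma sat_clo_nonempty_form d e : sat d clo_nonempty_form e <-> exists w, clo F S w.
Proof.
rewrite sat_or sat_const; split=> [/orP[/sat_nonempty [s Ss]|/holdsP [f [Ff f0]]]|[w cw]].
- by exists s; exact: clo_mem.
- exists (fun i => @ap f (fun=> false)).
  apply: (@clo_app _ _ _ f (fun _ _ => false)) => // j.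
  by have := ltn_ord j; rewrite {2}f0.
- elim: cw => {w} [s v Ss _|f vs v Ff _ IH _].
    by apply/orP; left; apply/sat_nonempty; exists s.
  have [f0|f0] := posnP (tag f); last exact: IH (Ordinal f0).
  by apply/orP; right; apply/holdsP; exists f.
Qed.

Definition const_form c : fo_form :=
  FAnd (unary_form c false) (FAllIdx (FIs c (FTarget 0))).

Lemma sat_const_form c e : sat 0 (const_form c) e <->
  unary_in F (exists s, S s) c false /\ (fun i : 'I_len => y i) =1 (fun=> c).
Proof.
rewrite sat_and; split=> [/andP[/sat_unary_form u /sat_allidx h]|[u h]].
  by split=> // i; have := h i; rewrite sat_is /= => /eqP.
apply/andP; split; first exact/sat_unary_form.
by apply/sat_allidx => i; rewrite sat_is /=; apply/eqP; exact: h.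
Qed.

Definition xor_form c : fo_form :=
  FAnd (unary_form c true)
    (FExRow (FAllIdx (FIff (FTarget 1) (FIs (~~ c) (FRowBit 0 1))))).

Lemma sat_xor_form c e : sat 0 (xor_form c) e <->
  unary_in F (exists s, S s) c true /\
  exists2 s, S s & (fun i : 'I_len => y i) =1 (fun i => c (+) s i).
Proof.
rewrite sat_and; split=> [/andP[/sat_unary_form u /sat_exrowP [a ra h]]|[u [s [a ra sE] h]]].
  split=> //; exists (fun i => b a i) => [|i]; first by exists a.
  have := (sat_allidx _ _ _).1 h i; rewrite sat_iff sat_is /= => /eqP ->.
  by case: c {u h} => /=; case: (b a i).
apply/andP; split; first exact/sat_unary_form.
apply/sat_exrowP; exists a => //; apply/sat_allidx => i.
by rewrite sat_iff sat_is /=; have /= -> := h i; rewrite sE; case: (c); case: (b a i).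
Qed.

Definition above_form d r : fo_form := FAllIdx (FImp (FTarget d) (FRowBit r d)).

Lemma sat_above_form d r e : r < d -> sat d (above_form d r) e <->
  forall i : 'I_len, y i -> b (e r) i.
Proof.
move=> rd; rewrite sat_allidx; split=> h i; have := h i;
  rewrite sat_imp /= ltnSn eqxx (ltn_eqF rd) (leqW rd) /=; by [move/implyP | move/implyP].
Qed.

Definition meet_form : fo_form :=
  FAnd (FExRow (above_form 1 0))
       (FAllIdx (FExRow (FAnd (above_form 2 1) (FIff (FRowBit 1 0) (FTarget 0))))).

Lemma sat_meet_form e : sat 0 meet_form e <->
  (exists2 s, S s & forall i : 'I_len, y i -> s i) /\
  forall j : 'I_len, exists2 s, S s & (forall i : 'I_len, y i -> s i) /\ s j = y j.
Proof.
rewrite sat_and; split=> [/andP[/sat_exrowP [a ra h1] /sat_allidx h2]|[[s [a ra sE] h1] h2]].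
  split=> [|j].
    have h3 := (@sat_above_form 1 0 _ isT).1 h1.
    by exists (fun i => b a i); [exists a | exact: h3].
  have /sat_exrowP [a' ra'] := h2 j; rewrite sat_and => /andP[h3]; rewrite sat_iff /= => /eqP h4.
  exists (fun i => b a' i); first by exists a'.
  by split=> //; exact: ((@sat_above_form 2 1 _ isT).1 h3).
apply/andP; split.
  apply/sat_exrowP; exists a => //; apply/sat_above_form => // i /h1.
  by rewrite sE.
apply/sat_allidx => j; have [s' [a' ra' sE'] [h3 h4]] := h2 j.
apply/sat_exrowP; exists a' => //; rewrite sat_and; apply/andP; split.
  by apply/sat_above_form => // i /h3; rewrite sE'.
by rewrite sat_iff /= -sE' h4.
Qed.

End SatFormulas.

Lemma fo_definable_unary : (forall f, List.In f F -> const_or_unary f) -> fo_definable F.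
Proof.
move=> hF; exists (FOr (FOr (const_form false) (const_form true))
                        (FOr (xor_form false) (xor_form true))).
move=> len rs b y; apply: iff_trans (clo_unaryP _ _ hF) _; rewrite !sat_or.
split=> [[c [h|h]]|/orP[/orP[]|/orP[]] h].
- by apply/orP; left; apply/orP; case: c h => h; [right | left]; apply/sat_const_form.
- by apply/orP; right; apply/orP; case: c h => h; [right | left]; apply/sat_xor_form.
- by exists false; left; move/sat_const_form: h.
- by exists true; left; move/sat_const_form: h.
- by exists false; right; move/sat_xor_form: h.
- by exists true; right; move/sat_xor_form: h.
Qed.

Lemma fo_definable_meet : (forall f, List.In f F -> meet_morph f) -> has2 F andb ->
  fo_definable F.
Proof.
move=> hF hand; exists (FOr (FOr (const_form false) (const_form true)) meet_form).
move=> len rs b y; apply: iff_trans (clo_meetP _ _ hF hand) _; rewrite !sat_or.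
split=> [[[c h]|h]|/orP[/orP[]|] h].
- by apply/orP; left; apply/orP; case: c h => h; [right | left]; apply/sat_const_form.
- by apply/orP; right; apply/sat_meet_form.
- by left; exists false; move/sat_const_form: h.
- by left; exists true; move/sat_const_form: h.
- by right; move/sat_meet_form: h.
Qed.

Lemma fo_definable_local k :
  (forall (I : finType) (S : (I -> bool) -> Prop) v,
     (exists w, clo F S w) -> locally_in F k S v -> clo F S v) ->
  fo_definable F.
Proof.
move=> loc; exists (FAnd clo_nonempty_form (FAllIdxn k (local_form k))) => len rs b y.
rewrite sat_and; split=> [cv|/andP[]].
  apply/andP; split; first by apply/sat_clo_nonempty_form; eexists; exact: cv.
  by apply/sat_locally; exact: locally_in_clo.
by move=> /sat_clo_nonempty_form ne /sat_locally l; exact: loc.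
Qed.

Definition separating_form : fo_form :=
  FAnd clo_nonempty_form (FAnd (FAllIdxn 2 (local_form 2))
    (FOr (FExRow (above_form 1 0)) (FAllIdx (FNot (FTarget 0))))).

Lemma fo_definable_separating :
  has3 F and_or -> (forall f, List.In f F -> separating f) -> fo_definable F.
Proof.
move=> hs sep; exists separating_form => len rs b y.
apply: iff_trans (clo_separatingP _ _ hs sep) _.
rewrite !sat_and sat_or.
split=> [[ne loc h]|/and3P[/sat_clo_nonempty_form ne /sat_locally loc h]].
  apply/and3P; split; [exact/sat_clo_nonempty_form | exact/sat_locally |].
  case: h => [[s [a ra sE] h]|h]; apply/orP; [left | right].
    by apply/sat_exrowP; exists a => //; apply/sat_above_form => // i /h; rewrite sE.
  by apply/sat_allidx => i /=; have /= -> := h i.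
split=> //; case/orP: h => [/sat_exrowP [a ra /sat_above_form h]|/sat_allidx h]; [left | right].
  by exists (fun i : 'I_len => b a i); [exists a | exact: (h isT)].
by move=> i; apply/negbTE; have := h i.
Qed.

Lemma fo_definable_and_or : has3 F and_or -> fo_definable F.
Proof.
move=> hs; have [[f [Ff nsep]]|no] := classic (exists f, List.In f F /\ ~ separating f).
  by apply: (@fo_definable_local (maxn (tag f) 2)) => I S v; exact: clo_local_nonseparating nsep.
apply: fo_definable_separating => // f Ff; apply: NNPP => nsep.
by apply: no; exists f.
Qed.

Lemma fo_definable_and : has2 F andb -> fo_definable F.
Proof.
move=> hand; have [[f [Ff nm]]|no] := classic (exists f, List.In f F /\ ~ meet_morph f).
  by apply: fo_definable_and_or; exact: has3_and_or_morph Ff hand nm.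
apply: fo_definable_meet => // f Ff; apply: NNPP => nm.
by apply: no; exists f.
Qed.

End Formulas.

Theorem fo_definable_or_affine (F : seq (operation bool)) :
  fo_definable F \/ (forall f, List.In f F -> affine (@ap f)) /\ has_minority F.
Proof.
have [[f [Ff naff]]|no] := classic (exists f, List.In f F /\ ~ affine (@ap f)).
  left; case: (and_or_maj_nonaffine Ff naff) => h; first exact: fo_definable_and.
    by apply: fo_definable_dual; apply: fo_definable_and; exact: has2_dual.
  by apply: (@fo_definable_local _ 2) => I S v; exact: clo_maj_local.
have aff f : List.In f F -> affine (@ap f).
  by move=> Ff; apply: NNPP => naff; apply: no; exists f.
have [un|hmin] := affine_dichotomy aff; last by right.
by left; exact: fo_definable_unary.
Qed.

(** * Structured programs *)

Record state : Type := State { rg : nat -> nat; bf : word; em : seq word }.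

Definition at_pc (o : nat) (s : state) : config := Config o (rg s) (bf s) (em s).

Definition setr (s : state) (r x : nat) : state :=
  State [eta rg s with r |-> x] (bf s) (em s).

Lemma rg_setr s r x q : rg (setr s r x) q = if q == r then x else rg s q.
Proof. by []. Qed.

(* [For x st stp lim c] runs [c] for [R_x] = [R_st], [R_st + R_stp], ... as long as
   [R_x < R_lim]; it relies on register 2 holding 0 and uses register 1. *)
Inductive com : Type :=
| Do of instr
| Seq of com & com
| IfNZ of nat & com & com
| For of nat & nat & nat & nat & com.

Declare Scope com_scope.
Delimit Scope com_scope with com.
Bind Scope com_scope with com.
Notation "a ;; b" := (Seq a b) (at level 90, right associativity) : com_scope.
Local Open Scope com_scope.

Fixpoint csize (c : com) : nat :=
  match c with
  | Do _ => 1
  | a ;; b => csize a + csize b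
  | IfNZ _ a b => csize a + csize b + 2
  | For _ _ _ _ a => csize a + 5
  end.

Fixpoint compile (o : nat) (c : com) : program :=
  match c with
  | Do i => [:: i]
  | a ;; b => compile o a ++ compile (o + csize a) b
  | IfNZ r a b =>
      JumpZ r (o + csize a + 2) :: compile (o + 1) a ++
      Jump (o + csize a + csize b + 2) :: compile (o + csize a + 2) b
  | For x st stp lim a =>
      [:: Add x st 2; Defs.Sub 1 lim x; JumpZ 1 (o + csize a + 5)] ++ compile (o + 3) a ++
      [:: Add x x stp; Jump (o + 1)]
  end.

Lemma size_compile o c : size (compile o c) = csize c.
Proof.
elim: c o => //= [a IHa b IHb|r a IHa b IHb|x st stp lim a IHa] o.
- by rewrite size_cat IHa IHb.
- by rewrite size_cat /= IHa IHb; lia.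
- by rewrite size_cat /= IHa; lia.
Qed.

Definition embedded (P : program) (o : nat) (c : program) : Prop :=
  forall i, i < size c -> nth Halt P (o + i) = nth Halt c i.

Lemma embedded_cat P o a b :
  embedded P o (a ++ b) -> embedded P o a /\ embedded P (o + size a) b.
Proof.
move=> h; split=> i il.
  by rewrite h ?nth_cat ?il // size_cat; lia.
rewrite -addnA h ?size_cat ?nth_cat; last lia.
by rewrite ltnNge leq_addr /= addKn.
Qed.

Lemma embedded_cons P o i c :
  embedded P o (i :: c) -> nth Halt P o = i /\ embedded P (o + 1) c.
Proof.
move=> h; split; first by have := h 0 isT; rewrite addn0.
by move=> j jl; rewrite -addnA add1n h.
Qed.

Section Execution.

Variables (w : word) (B : nat).

Definition bounded (s : state) : Prop := forall r, rg s r <= B.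

Definition straight (i : instr) : bool :=
  match i with Jump _ | JumpZ _ _ | Halt => false | _ => true end.

Definition exe (i : instr) (s : state) : state :=
  match i with
  | Const r x => setr s r x
  | Add r a b => setr s r (rg s a + rg s b)
  | Defs.Sub r a b => setr s r (rg s a - rg s b)
  | LoadAt r a => setr s r (rg s (rg s a))
  | StoreAt r a => setr s (rg s r) (rg s a)
  | Length r => setr s r (size w)
  | Read r a => setr s r (nth false w (rg s a))
  | Write r => State (rg s) (rcons (bf s) (rg s r != 0)) (em s)
  | Emit => State (rg s) [::] (rcons (em s) (bf s))
  | _ => s
  end.

Definition fits (i : instr) (s : state) : Prop :=
  match i with
  | Const _ x => x <= B
  | Add _ a b => rg s a + rg s b <= B
  | Length _ => size w <= B
  | Read _ _ => 1 <= B
  | _ => True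
  end.

Lemma exe_bounded i s : fits i s -> bounded s -> bounded (exe i s).
Proof.
case: i => //= [r x|r a b|r a b|r a|r a|r|r a] h bs q //=; case: eqP => // _.
- by apply: leq_trans (leq_subr _ _) _.
- by apply: leq_trans (leq_b1 _) _.
Qed.

Lemma step_straight P o i s : straight i -> nth Halt P o = i ->
  step P w (at_pc o s) = at_pc o.+1 (exe i s).
Proof. by rewrite /step /fetch /= => si ->; case: i si. Qed.

Definition steps P c k c' : Prop :=
  iter k (step P w) c = c' /\ forall j, j <= k -> forall r, reg (iter j (step P w) c) r <= B.

Lemma steps_trans P c1 k1 c2 k2 c3 :
  steps P c1 k1 c2 -> steps P c2 k2 c3 -> steps P c1 (k1 + k2) c3.
Proof.
move=> [<- h1] [<- h2]; split=> [|j jk]; first by rewrite addnC iterD.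
have [jk1|/ltnW kj] := leqP j k1; first exact: h1.
by rewrite -(subnK kj) iterD; apply: h2; lia.
Qed.

Lemma steps1 P c c' : step P w c = c' -> (forall r, reg c r <= B) ->
  (forall r, reg c' r <= B) -> steps P c 1 c'.
Proof. by move=> e h h'; split=> // -[|[|]] //=; rewrite e. Qed.

(** Total correctness of the compiled code wherever it is placed, within [T] steps and with all
    registers at most [B] throughout. As [Q] may itself be an [ok] statement, sequences are treated
    from left to right. *)
Definition ok (c : com) (T : nat) (s : state) (Q : state -> Prop) : Prop :=
  forall P o, embedded P o (compile o c) -> bounded s ->
  exists k s', [/\ k <= T, steps P (at_pc o s) k (at_pc (o + csize c) s') & Q s'].

Lemma steps_bounded P c k o s : steps P c k (at_pc o s) -> bounded s.
Proof. by move=> [e h] r; have := h k (leqnn k) r; rewrite e. Qed.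

Lemma ok_weaken c T T' s (Q Q' : state -> Prop) :
  ok c T s Q -> T <= T' -> (forall s', bounded s' -> Q s' -> Q' s') -> ok c T' s Q'.
Proof.
move=> h TT' QQ' P o e bs; have [k [s' [kT st q]]] := h P o e bs.
exists k, s'; split=> //; first exact: leq_trans TT'.
exact: (QQ' _ (steps_bounded st)).
Qed.

Lemma ok_bounded c T s Q : (bounded s -> ok c T s Q) -> ok c T s Q.
Proof. by move=> h P o e bs; exact: h. Qed.

Lemma ok_do i T s (Q : state -> Prop) :
  0 < T -> straight i -> fits i s -> Q (exe i s) -> ok (Do i) T s Q.
Proof.
move=> T0 si fi q P o /embedded_cons [e _] bs; exists 1, (exe i s); split=> //.
by apply: steps1 => //; [rewrite (step_straight _ si e) addn1 | exact: exe_bounded].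
Qed.

Lemma ok_seq a b T1 T2 s Q :
  ok a T1 s (fun s' => ok b T2 s' Q) -> ok (a ;; b) (T1 + T2) s Q.
Proof.
move=> ha P o /= /embedded_cat [ea eb] bs; rewrite size_compile in eb.
have [k1 [s1 [k1T st1 hb]]] := ha P o ea bs.
have [k2 [s2 [k2T st2 q]]] := hb P _ eb (steps_bounded st1).
exists (k1 + k2), s2; split=> //; first exact: leq_add.
by rewrite addnA; exact: steps_trans st1 st2.
Qed.

Lemma ok_do_seq i b T s Q :
  straight i -> fits i s -> ok b T (exe i s) Q -> ok (Do i ;; b) T.+1 s Q.
Proof. by move=> si fi h; apply: (@ok_seq _ _ 1); exact: ok_do. Qed.

Lemma ok_if r a b T s Q :
  ok (if rg s r == 0 then b else a) T s Q -> ok (IfNZ r a b) (T + 2) s Q.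
Proof.
move=> h P o /= /embedded_cons [e0 /embedded_cat [ea]] /embedded_cons [e1 eb] bs.
rewrite size_compile in e1 eb.
have st0 : steps P (at_pc o s) 1
    (at_pc (if rg s r == 0 then o + csize a + 2 else o + 1) s).
  by apply: steps1 => //; rewrite /step /fetch /= e0 /= addn1.
case: eqP => r0 in h st0.
  rewrite (_ : o + 1 + csize a + 1 = o + csize a + 2) in eb; last lia.
  have [k [s' [kT st q]]] := h P _ eb bs.
  exists (1 + k), s'; split=> //; first lia.
  by have := steps_trans st0 st; rewrite (_ : _ + 2 + _ = o + (csize a + csize b + 2)) //; lia.
have [k [s' [kT st q]]] := h P _ ea bs.
exists (1 + k + 1), s'; split=> //; first lia.
apply: steps_trans (steps_trans st0 st) _.
apply: steps1; try exact: steps_bounded st.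
rewrite /step /fetch /= e1 /=; congr Config; lia.
Qed.

Definition same_off (X : pred nat) (s s' : state) : Prop :=
  forall r, ~~ X r -> rg s' r = rg s r.

Lemma same_off_trans (X : pred nat) s1 s2 s3 :
  same_off X s1 s2 -> same_off X s2 s3 -> same_off X s1 s3.
Proof. by move=> h1 h2 r Xr; rewrite h2 // h1. Qed.

Lemma same_off_sub (X Y : pred nat) s s' :
  subpred X Y -> same_off X s s' -> same_off Y s s'.
Proof. by move=> XY h r Yr; apply: h; apply: contra Yr; exact: XY. Qed.

Lemma same_off_setr (X : pred nat) s r x : X r -> same_off X s (setr s r x).
Proof. by move=> Xr q Xq; rewrite rg_setr; case: eqP => // qr; rewrite qr Xr in Xq. Qed.

Section ForLoop.

Variables (x st stp lim : nat) (body : com) (s0 : state) (m v0 dv L T : nat).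
Variables (X : pred nat) (J : nat -> state -> Prop).

Hypotheses (Xx : X x) (X1 : X 1) (X2 : ~~ X 2) (Xstp : ~~ X stp) (Xlim : ~~ X lim).
Hypotheses (x1 : x != 1) (z0 : rg s0 2 = 0).
Hypotheses (st0 : rg s0 st = v0) (stp0 : rg s0 stp = dv) (lim0 : rg s0 lim = L).
Hypotheses (below : forall k, k < m -> v0 + k * dv < L) (stop : L <= v0 + m * dv).
Hypothesis fit : v0 + m * dv <= B.
Hypothesis stable : forall k s r v, r \in [:: x; 1] -> J k s -> J k (setr s r v).
Hypothesis J0 : J 0 s0.
Hypothesis body_ok : forall k s, k < m -> same_off X s0 s -> rg s x = v0 + k * dv ->
  J k s -> ok body T s (fun s' => [/\ same_off X s s', rg s' x = rg s x & J k.+1 s']).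

(** Each iteration costs four instructions besides the body (subtraction, test, increment, jump
    back); the 3 pays for the initialization and for the last subtraction and test. [stable] is
    there because the loop itself overwrites [x] and register 1. *)
Lemma ok_for_gen :
  ok (For x st stp lim body) (m * (T + 4) + 3) s0
    (fun s' => same_off X s0 s' /\ J m s').
Proof.
move=> P o /= /embedded_cons [e0 /embedded_cons [e1 /embedded_cons [e2]]].
have -> : o + 1 + 1 + 1 = o + 3 by lia.
move=> /embedded_cat [eb]; rewrite size_compile => /embedded_cons [e3 /embedded_cons [e4 _]] bs0.
have {}e2 : nth Halt P (o + 2) = JumpZ 1 (o + (csize body + 5)).
  by rewrite (_ : o + 2 = o + 1 + 1) ?e2 //; [congr JumpZ |]; lia.
have {}e4 : nth Halt P (o + 4 + csize body) = Jump (o + 1).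
  by rewrite (_ : o + 4 + csize body = o + 3 + csize body + 1) ?e4 //; lia.
have loop j k s : j + k = m -> same_off X s0 s -> rg s x = v0 + k * dv -> J k s ->
    bounded s -> exists t s', [/\ t <= j * (T + 4) + 2,
      steps P (at_pc (o + 1) s) t (at_pc (o + (csize body + 5)) s') &
      same_off X s0 s' /\ J m s'].
  elim: j k s => [|j IH] k s jk ss sx Jk bs.
    rewrite add0n in jk; rewrite {}jk in sx Jk.
    have limE : rg s lim = L by rewrite ss.
    exists 2, (setr s 1 (rg s lim - rg s x)).
    have bs1 : bounded (setr s 1 (rg s lim - rg s x)).
      exact: (@exe_bounded (Defs.Sub 1 lim x)).
    split=> //; last first.
      split; last by apply: stable => //; rewrite !inE eqxx orbT.
      by apply: same_off_trans ss _; exact: same_off_setr.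
    apply: (@steps_trans P _ 1 (at_pc (o + 2) (setr s 1 (rg s lim - rg s x))) 1).
      by apply: steps1 => //; rewrite (step_straight _ _ e1) //; congr at_pc; lia.
    apply: steps1 => //; rewrite /step /fetch /= e2 /= limE sx.
    have -> : L - (v0 + m * dv) = 0 by lia.
    by rewrite /goto /=; congr Config; lia.
  have km : k < m by lia.
  have limE : rg s lim = L by rewrite ss.
  set s1 := setr s 1 (rg s lim - rg s x).
  have bs1 : bounded s1 by exact: (@exe_bounded (Defs.Sub 1 lim x)).
  have st1 : steps P (at_pc (o + 1) s) 1 (at_pc (o + 2) s1).
    by apply: steps1 => //; rewrite (step_straight _ _ e1) //; congr at_pc; lia.
  have st2 : steps P (at_pc (o + 2) s1) 1 (at_pc (o + 3) s1).
    apply: steps1 => //; rewrite /step /fetch /= e2 /= limE sx.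
    have := below km => lt; have -> : (L - (v0 + k * dv) == 0) = false by lia.
    by rewrite /goto /=; congr Config; lia.
  have ss1 : same_off X s0 s1 by apply: same_off_trans ss _; exact: same_off_setr.
  have [||t [s2 [tT st3 [ss2 x2 J2]]]] := body_ok km ss1 _ _ eb bs1.
  - by rewrite rg_setr (negPf x1).
  - by apply: stable => //; rewrite !inE eqxx orbT.
  have bs2 := steps_bounded st3.
  have x2E : rg s2 x = v0 + k * dv by rewrite x2 rg_setr (negPf x1).
  have stpE : rg s2 stp = dv by rewrite ss2 // ss1.
  set s3 := setr s2 x (rg s2 x + rg s2 stp).
  have x3E : rg s2 x + rg s2 stp = v0 + k.+1 * dv by rewrite x2E stpE; lia.
  have bs3 : bounded s3.
    apply: (@exe_bounded (Add x x stp)) => //=; rewrite x3E.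
    by apply: leq_trans fit; rewrite leq_add2l leq_mul2r; lia.
  have st4 : steps P (at_pc (o + 3 + csize body) s2) 1 (at_pc (o + 4 + csize body) s3).
    by apply: steps1 => //; rewrite (step_straight _ _ e3) //; congr at_pc; lia.
  have st5 : steps P (at_pc (o + 4 + csize body) s3) 1 (at_pc (o + 1) s3).
    apply: steps1 => //; rewrite /step /fetch /=.
    by rewrite e4.
  have [||||t' [s' [t'T st6 h]]] := IH k.+1 s3 _ _ _ _ bs3.
  - lia.
  - apply: same_off_trans ss1 _; apply: same_off_trans ss2 _; exact: same_off_setr.
  - by rewrite rg_setr eqxx.
  - by apply: stable => //; rewrite !inE eqxx.
  exists (1 + 1 + t + 1 + 1 + t'), s'; split=> //; first by rewrite mulSn; lia.
  exact: steps_trans (steps_trans (steps_trans (steps_trans (steps_trans st1 st2) st3) st4) st5) st6.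
set s1 := setr s0 x (rg s0 st + rg s0 2).
have x1E : rg s1 x = v0 + 0 * dv by rewrite rg_setr eqxx st0 z0 addn0.
have bs1 : bounded s1.
  apply: (@exe_bounded (Add x st 2)) => //=; rewrite st0 z0 addn0.
  by apply: leq_trans fit; exact: leq_addr.
have str1 : steps P (at_pc o s0) 1 (at_pc (o + 1) s1).
  by apply: steps1 => //; rewrite (step_straight _ _ e0) //; congr at_pc; lia.
have [|||t [s' [tT str2 h]]] := loop m 0 s1 _ _ x1E _ bs1.
- lia.
- exact: same_off_setr.
- by apply: stable => //; rewrite !inE eqxx.
exists (1 + t), s'; split=> //; first lia.
exact: steps_trans str1 str2.
Qed.

End ForLoop.

Definition quiet (X : pred nat) (s s' : state) : Prop :=
  [/\ same_off X s s', bf s' = bf s & em s' = em s].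

Lemma quiet_trans X s1 s2 s3 : quiet X s1 s2 -> quiet X s2 s3 -> quiet X s1 s3.
Proof.
move=> [h1 b1 e1] [h2 b2 e2]; split; last 2 first.
- by rewrite b2.
- by rewrite e2.
exact: same_off_trans h1 h2.
Qed.

Lemma quiet_sub (X Y : pred nat) s s' : subpred X Y -> quiet X s s' -> quiet Y s s'.
Proof. by move=> XY [h b e]; split=> //; exact: same_off_sub XY h. Qed.

Lemma quiet_setr (X : pred nat) s r x : X r -> quiet X s (setr s r x).
Proof. by move=> Xr; split=> //; exact: same_off_setr. Qed.

Lemma ok_for x st stp lim body s0 m v0 dv L T (X : pred nat) (J : nat -> state -> Prop) :
  [/\ X x, X 1, ~~ X 2, ~~ X stp & ~~ X lim] -> x != 1 -> rg s0 2 = 0 ->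
  [/\ rg s0 st = v0, rg s0 stp = dv & rg s0 lim = L] ->
  (forall k, k < m -> v0 + k * dv < L) -> L <= v0 + m * dv -> v0 + m * dv <= B ->
  (forall k s r v, r \in [:: x; 1] -> J k s -> J k (setr s r v)) ->
  J 0 s0 ->
  (forall k s, k < m -> quiet X s0 s -> rg s x = v0 + k * dv -> J k s ->
    ok body T s (fun s' => [/\ quiet X s s', rg s' x = rg s x & J k.+1 s'])) ->
  ok (For x st stp lim body) (m * (T + 4) + 3) s0 (fun s' => quiet X s0 s' /\ J m s').
Proof.
move=> [Xx X1 X2 Xstp Xlim] x1 z0 [st0 stp0 lim0] below stop fit stable J0 body_ok.
pose J' k s := [/\ J k s, bf s = bf s0 & em s = em s0].
apply: (@ok_weaken _ _ _ _ (fun s' => same_off X s0 s' /\ J' m s')) (leqnn _) _; last first.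
  by move=> s' _ [ss [Js b e]].
apply: (@ok_for_gen x st stp lim body s0 m v0 dv L T X J') => //.
  by move=> k s r v rx [Jk b e]; split=> //; exact: stable.
move=> k s km ss sx [Jk b e].
apply: ok_weaken (body_ok k s km _ sx Jk) (leqnn _) _; first by split.
by move=> s' _ [[ss' b' e'] x' Jk']; split=> //; split; rewrite ?b' ?e'.
Qed.

End Execution.

(** * Compiling formulas *)

(* Register 0 receives truth values, 1 is scratch, and 2-9 hold the constants below.
   The target vector is stored from register [Y] on, and [w] contains [start] bits
   followed by blocks of [n.+1] bits, one per given vector. *)
Definition layout (w : word) (n start Y len : nat) (s : state) : Prop :=
  [/\ rg s 2 = 0, rg s 3 = 1, rg s 4 = len & rg s 5 = start] /\
  [/\ rg s 6 = n.+1, rg s 7 = size w, rg s 8 = n & rg s 9 = Y].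

(** A row is named by the input position of the marker bit before it, whence the [+ 1] in
    [row_bit]. *)
Definition rows (n start m : nat) : seq nat := mkseq (fun k => start + k * n.+1) m.

Definition row_bit (w : word) (a i : nat) : bool := nth false w (a + i + 1).

Definition target (Y : nat) (s : state) (i : nat) : bool := rg s (Y + i) != 0.

(** Registers below 40 have fixed roles; from there on each nesting level takes one register for its
    variable and one for its accumulator. *)
Definition var_reg (d : nat) : nat := 40 + 2 * d.
Definition acc_reg (d : nat) : nat := 41 + 2 * d.

(** The accumulator starts at 1 and one failure clears it for good; [Const 1 0] is the idle
    branch. *)
Definition quantifier (d st stp lim : nat) (c : com) : com :=
  Do (Const (acc_reg d) 1) ;;
  For (var_reg d) st stp lim
    (c ;; IfNZ 0 (Do (Const 1 0)) (Do (Const (acc_reg d) 0))) ;;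
  Do (Add 0 (acc_reg d) 2).

Fixpoint cform (d : nat) (phi : fo_form) : com :=
  match phi with
  | FTrue => Do (Const 0 1)
  | FTarget i =>
      if i < d then Do (Add 1 9 (var_reg i)) ;; Do (LoadAt 0 1) else Do (Const 0 0)
  | FRowBit a i =>
      if (a < d) && (i < d) then
        Do (Add 1 (var_reg a) (var_reg i)) ;; Do (Add 1 1 3) ;; Do (Read 0 1)
      else Do (Const 0 0)
  | FNot phi => cform d phi ;; Do (Defs.Sub 0 3 0)
  | FAnd phi psi => cform d phi ;; IfNZ 0 (cform d psi) (Do (Const 0 0))
  | FAllIdx phi => quantifier d 2 3 4 (cform d.+1 phi)
  | FAllRow phi => quantifier d 5 6 7 (cform d.+1 phi)
  end.

Fixpoint form_time (phi : fo_form) (N : nat) : nat :=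
  match phi with
  | FTrue => 1
  | FTarget _ => 2
  | FRowBit _ _ => 3
  | FNot phi => form_time phi N + 1
  | FAnd phi psi => form_time phi N + (form_time psi N + 1 + 2)
  | FAllIdx phi | FAllRow phi => N * (form_time phi N + 3 + 4) + 5
  end.

Definition scratch (Y d : nat) : pred nat :=
  fun r => (r < 2) || (var_reg d <= r < Y).

Lemma sat_ext len rs b y y' d phi e :
  y =1 y' -> sat len rs b y d phi e = sat len rs b y' d phi e.
Proof.
move=> yy; elim: phi d e => //= [i|phi IH|phi IH1 psi IH2|phi IH|phi IH] d e.
- by rewrite yy.
- by rewrite IH.
- by rewrite IH1 IH2.
- by apply: eq_all => i; rewrite IH.
- by apply: eq_all => a; rewrite IH.
Qed.

Section FormulaCorrect.

Variables (w : word) (B Y n m start len : nat).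
Hypotheses (YB : Y + 4 * size w + 100 <= B) (len_n : len <= n) (n_w : n < start).
Hypothesis w_size : size w = start + m * n.+1.

Local Notation ok := (ok w B).
Local Notation layout := (layout w n start Y len).
Local Notation sat := (sat len (rows n start m) (row_bit w)).

Lemma quantifier_ok d st stp lim c k v0 dv L T (p : pred nat) s0 :
  layout s0 -> acc_reg d < Y ->
  [/\ 2 <= st < 10, 2 <= stp < 10 & 2 <= lim < 10] ->
  [/\ rg s0 st = v0, rg s0 stp = dv & rg s0 lim = L] ->
  (forall j, j < k -> v0 + j * dv < L) -> L <= v0 + k * dv -> v0 + k * dv <= B ->
  k <= size w ->
  (forall s j, j < k -> quiet (scratch Y d) s0 s -> rg s (var_reg d) = v0 + j * dv ->
    ok c T s (fun s' => (rg s' 0 != 0) = p (v0 + j * dv) /\ quiet (scratch Y d.+1) s s')) ->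
  ok (quantifier d st stp lim c) (size w * (T + 3 + 4) + 5) s0 (fun s' =>
    (rg s' 0 != 0) = all p (mkseq (fun j => v0 + j * dv) k) /\ quiet (scratch Y d) s0 s').
Proof.
move=> [[r2 r3 r4 r5] _] accY [hst hstp hlim] [e1 e2 e3] below stop fit kw hc.
have B1 : 1 <= B by lia.
have Xacc : scratch Y d (acc_reg d) by rewrite /scratch /acc_reg /var_reg in accY *; lia.
have Xvar : scratch Y d (var_reg d) by rewrite /scratch /acc_reg /var_reg in accY *; lia.
have nX r : 2 <= r < 10 -> ~~ scratch Y d r by rewrite /scratch /var_reg; lia.
have sub : subpred (scratch Y d.+1) (scratch Y d).
  by move=> r; rewrite /scratch /var_reg; lia.
have va : (var_reg d == acc_reg d) = false by rewrite /var_reg /acc_reg; lia.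
have av : (acc_reg d == var_reg d) = false by rewrite /var_reg /acc_reg; lia.
have an r : r < 10 -> (acc_reg d == r) = false by rewrite /acc_reg; lia.
have nacc r : r < 10 -> (r == acc_reg d) = false by rewrite /acc_reg; lia.
pose J j (s : state) := (rg s (acc_reg d) != 0) = all p (mkseq (fun j => v0 + j * dv) j).
rewrite /quantifier (_ : _ + 5 = (size w * (T + 3 + 4) + 3 + 1).+1); last lia.
apply: ok_do_seq => //=; set s1 := setr _ _ _.
have q1 : quiet (scratch Y d) s0 s1 by exact: quiet_setr.
apply: ok_seq; apply: (@ok_weaken _ _ _ (k * (T + 3 + 4) + 3) _ _
    (fun s' => quiet (scratch Y d) s1 s' /\ J k s')).
- apply: (@ok_for _ _ _ _ _ _ _ _ _ v0 dv L (T + 3)) => //.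
  + by split; rewrite ?nX.
  + by split; rewrite rg_setr nacc //; case/andP: hst hstp hlim => _ ? /andP[_ ?] /andP[_ ?].
  + move=> j s r v; rewrite !inE /J rg_setr => /orP[] /eqP ->.
      by rewrite av.
    by rewrite an.
  + by rewrite /J rg_setr eqxx.
  move=> j s jk qs sx Js; apply: ok_seq.
  apply: ok_weaken (hc s j jk (quiet_trans q1 qs) sx) (leqnn _) _ => s2 _ [p2 q2].
  have acc2 : rg s2 (acc_reg d) = rg s (acc_reg d).
    by case: q2 => h _ _; rewrite h // /scratch /acc_reg /var_reg; lia.
  have var2 : rg s2 (var_reg d) = rg s (var_reg d).
    by case: q2 => h _ _; rewrite h // /scratch /acc_reg /var_reg; lia.
  have q2' := quiet_sub sub q2.
  apply: (@ok_if _ _ _ _ _ 1).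
  rewrite /J mkseqS all_rcons -p2; case: eqP => r0; apply: ok_do => //=.
    split; [|by rewrite /= va|by rewrite /= eqxx].
    by apply: quiet_trans q2' _; exact: quiet_setr.
  split; [|by []|by rewrite /= acc2].
  by apply: quiet_trans q2' _; exact: quiet_setr.
- by rewrite leq_add2r leq_mul2r kw orbT.
move=> s2 b2 [q2 J2]; apply: ok_do => //=.
  have : rg s2 2 = 0 by case: q2 => h _ _; rewrite h ?nX // rg_setr nacc.
  by move->; rewrite addn0; exact: b2.
split; last by apply: quiet_trans q1 (quiet_trans q2 _); exact: quiet_setr.
have : rg s2 2 = 0 by case: q2 => h _ _; rewrite h ?nX // rg_setr nacc.
by move=> ->; rewrite addn0.
Qed.

Lemma layout_quiet d s s' : layout s -> quiet (scratch Y d) s s' -> layout s'.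
Proof.
move=> [[r2 r3 r4 r5] [r6 r7 r8 r9]] [h _ _].
by split; split; rewrite h // /scratch /var_reg; lia.
Qed.

Lemma target_quiet d s s' : 2 <= Y -> quiet (scratch Y d) s s' ->
  target Y s' =1 target Y s.
Proof. by move=> Y2 [h _ _] i; rewrite /target h // /scratch; lia. Qed.

Lemma cform_ok phi d s :
  layout s -> var_reg (d + depth phi) <= Y ->
  (forall l, l < d -> rg s (var_reg l) <= size w) ->
  ok (cform d phi) (form_time phi (size w)) s (fun s' =>
    (rg s' 0 != 0) = sat (target Y s) d phi (fun l => rg s (var_reg l)) /\
    quiet (scratch Y d) s s').
Proof.
move: phi d s; have B1 : 1 <= B by lia.
(* Both quantifiers run over an arithmetic progression, of step 1 for coordinates and of step [n.+1]
   for row positions, and are treated together. *)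
have quantify c x L k v0 dv st stp lim (s : state) d' phi' :
    c = cform d'.+1 phi' -> layout s -> var_reg (d' + (depth phi').+1) <= Y ->
    (forall l, l < d' -> rg s (var_reg l) <= size w) ->
    [/\ 2 <= st < 10, 2 <= stp < 10 & 2 <= lim < 10] ->
    [/\ rg s st = v0, rg s stp = dv & rg s lim = L] ->
    (forall j, j < k -> v0 + j * dv < L) -> L <= v0 + k * dv -> v0 + k * dv <= B ->
    k <= size w -> L <= size w -> x = mkseq (fun j => v0 + j * dv) k ->
    (forall t, layout t -> var_reg (d'.+1 + depth phi') <= Y ->
      (forall l, l < d'.+1 -> rg t (var_reg l) <= size w) ->
      ok (cform d'.+1 phi') (form_time phi' (size w)) t (fun s' =>
      (rg s' 0 != 0) = sat (target Y t) d'.+1 phi' (fun l => rg t (var_reg l)) /\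
      quiet (scratch Y d'.+1) t s')) ->
    ok (quantifier d' st stp lim c) (size w * (form_time phi' (size w) + 3 + 4) + 5) s
    (fun s' => (rg s' 0 != 0) = all (fun i => sat (target Y s) d'.+1 phi'
         [eta (fun l => rg s (var_reg l)) with d' |-> i]) x /\
      quiet (scratch Y d') s s').
  move=> -> ls hY small hr he below stop fit kw Lw -> IH.
  apply: (quantifier_ok (k := k) (v0 := v0) (dv := dv) (L := L)) => //.
    by move: hY; rewrite /var_reg /acc_reg; lia.
  move=> s' j jk q' xj; have lt := below j jk.
  have Y2 : 2 <= Y by move: hY; rewrite /var_reg; lia.
  have var l : l < d' -> rg s' (var_reg l) = rg s (var_reg l).
    by move=> ld; case: q' => h _ _; rewrite h // /scratch /var_reg; lia.
  apply: ok_weaken (IH s' (layout_quiet ls q') _ _) (leqnn _) _ => [|l|s2 _ [-> q2]].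
  - by rewrite addSnnS.
  - rewrite ltnS leq_eqVlt => /orP[/eqP ->|ld]; first by rewrite xj; lia.
    by rewrite var // small.
  split=> //; rewrite (sat_ext _ _ _ _ _ _ (target_quiet Y2 q')).
  apply: eq_sat => l; rewrite ltnS leq_eqVlt => /orP[/eqP ->|ld] /=.
    by rewrite eqxx xj.
  by rewrite (ltn_eqF ld) var.
elim=> /= [|i|a i|phi IH|phi IH1 psi IH2|phi IH|phi IH] d s ls hY small.
- by apply: ok_do => //=; split=> //; exact: quiet_setr.
- case: ifP => id; last by apply: ok_do => //=; split=> //; exact: quiet_setr.
  have [_ [_ _ _ r9]] := ls.
  apply: ok_do_seq => //=; first by have := small i id; lia.
  apply: ok_do => //=; split.
    have n1 : (Y + rg s (var_reg i) == 1) = false by move: hY; rewrite /var_reg; lia.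
    by rewrite r9 n1.
  by apply: quiet_trans (quiet_setr _ _ _) (quiet_setr _ _ _).
- case: ifP => [/andP[ad id]|ad]; last first.
    by rewrite andbA ad; apply: ok_do => //=; split=> //; exact: quiet_setr.
  have [[_ r3 _ _] _] := ls.
  have := small a ad; have := small i id => si sa.
  apply: ok_do_seq => //=; first lia.
  apply: ok_do_seq => //=; first by rewrite r3; lia.
  apply: ok_do => //=; split.
    by rewrite ad id r3 /row_bit; case: (nth _ _ _).
  by apply: quiet_trans (quiet_trans (quiet_setr _ _ _) (quiet_setr _ _ _)) (quiet_setr _ _ _).
- apply: ok_seq; apply: ok_weaken (IH d s ls hY small) (leqnn _) _ => s1 _ [e1 q1].
  have [[_ r3 _ _] _] := layout_quiet ls q1.
  apply: ok_do => //=; split; last by apply: quiet_trans q1 _; exact: quiet_setr.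
  by rewrite r3 -e1; case: (rg s1 0) => [|x] //=; rewrite subSS sub0n.
- have hY1 : var_reg (d + depth phi) <= Y by move: hY; rewrite /var_reg; lia.
  have hY2 : var_reg (d + depth psi) <= Y by move: hY; rewrite /var_reg; lia.
  have Y2 : 2 <= Y by move: hY; rewrite /var_reg; lia.
  apply: ok_seq; apply: ok_weaken (IH1 d s ls hY1 small) (leqnn _) _ => s1 _ [e1 q1].
  have var l : l < d -> rg s1 (var_reg l) = rg s (var_reg l).
    by move=> ld; case: q1 => h _ _; rewrite h // /scratch /var_reg; lia.
  apply: ok_if; rewrite -e1; case: eqP => r0.
    by apply: ok_do => //=; [lia | split=> //]; apply: quiet_trans q1 _; exact: quiet_setr.
  apply: ok_weaken (IH2 d s1 (layout_quiet ls q1) hY2 _) (leq_addr _ _) _ => [l ld|s2 _ [e2 q2]].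
    by rewrite var // small.
  split; last exact: quiet_trans q1 q2.
  rewrite e2 /= (sat_ext _ _ _ _ _ _ (target_quiet Y2 q1)).
  by apply: eq_sat => l ld; rewrite var.
- have [[r2 r3 r4 r5] [r6 r7 r8 r9]] := ls.
  apply: (quantify _ _ len len 0 1) => //; try lia.
  + by rewrite /mkseq (eq_map (g := id)) ?map_id // => j; lia.
  + exact: IH.
- have [[r2 r3 r4 r5] [r6 r7 r8 r9]] := ls.
  apply: (quantify _ _ (size w) m start n.+1) => //; try lia.
  + by move=> j jm; rewrite w_size ltn_add2l ltn_mul2r.
  + exact: IH.
Qed.

End FormulaCorrect.

(** * Gaussian elimination *)

(* The list [l] may repeat rows. *)
Definition in_span (m len : nat) (M : nat -> nat -> bool) : Prop :=
  exists2 l, all (fun k => 0 < k <= m) l &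
    forall j, j <= len -> M 0 j = \big[addb/false]_(k <- l) M k j.

Lemma in_span_ext m len M M' :
  (forall k j, k <= m -> j <= len -> M k j = M' k j) ->
  in_span m len M -> in_span m len M'.
Proof.
move=> e [l hl h]; exists l => // j jl; rewrite -e // h //.
by rewrite !big_seq; apply: eq_bigr => k /(allP hl) /andP[_ km]; rewrite e.
Qed.

(** Adding [M k i] times row [p] is linear in row [k], so relations survive it. Conversely a
    relation of [M'] holds in [M] up to a multiple of row [p], which one more occurrence of [p] in
    the list absorbs. *)
Lemma in_span_pivot m len M M' p i : 0 < p <= m -> i <= len ->
  (forall k j, k <= m -> j <= len -> M' k j = M k j (+) (M k i && M p j)) ->
  in_span m len M <-> in_span m len M'.
Proof.
move=> hp il e.
have sumE l j : all (fun k => 0 < k <= m) l -> j <= len ->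
    \big[addb/false]_(k <- l) M' k j = \big[addb/false]_(k <- l) M k j (+)
      ((\big[addb/false]_(k <- l) M k i) && M p j).
  move=> hl jl; rewrite big_distrl /= -big_split /= !big_seq.
  by apply: eq_bigr => k /(allP hl) /andP[_ km]; rewrite e.
split=> -[l hl h].
  by exists l => // j jl; rewrite e // sumE // !h.
exists (if M 0 i (+) \big[addb/false]_(k <- l) M k i then p :: l else l) => [|j jl].
  by case: ifP => //= _; rewrite hp.
have := h j jl; rewrite e // sumE //.
case: ifP; rewrite ?big_cons.
  by case: (M 0 i) (bigop _ _ _) (M 0 j) (bigop _ _ _) (M p j) => [] [] [] [] [].
by case: (M 0 i) (bigop _ _ _) (M 0 j) (bigop _ _ _) (M p j) => [] [] [] [] [].
Qed.

Lemma in_span_zero m len M :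
  (forall k j, 0 < k <= m -> j <= len -> M k j = false) ->
  in_span m len M <-> (forall j, j <= len -> M 0 j = false).
Proof.
move=> z; split=> [[l hl h] j jl|h].
  by rewrite h // big_seq big1 // => k /(allP hl) hk; exact: z.
by exists [::] => // j jl; rewrite h // big_nil.
Qed.

Definition nop : com := Do (Const 1 0).

(* The whole input is copied to the registers from [R_27] on, so that every given
   vector is preceded by its marker bit 1: in column 0, a sum of rows then has the
   parity of its number of terms. The target row, complemented if [c] and with [p] in
   column 0, overwrites the block just before the first vector ([R_28]). *)
Definition load_code (c p : bool) : com :=
  Do (Add 27 9 7) ;; Do (Add 27 27 3) ;; Do (Defs.Sub 28 5 6) ;; Do (Add 29 4 3) ;;
  Do (Add 32 27 28) ;;
  For 31 2 3 7 (Do (Read 26 31) ;; Do (Add 25 27 31) ;; Do (StoreAt 25 26)) ;;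
  Do (Const 26 p) ;; Do (StoreAt 32 26) ;;
  For 31 2 3 4 (Do (Add 25 9 31) ;; Do (LoadAt 26 25) ;;
    (if c then Do (Defs.Sub 26 3 26) else nop) ;;
    Do (Add 25 32 31) ;; Do (Add 25 25 3) ;; Do (StoreAt 25 26)).

Definition xor_code : com :=
  For 22 2 3 29 (Do (Add 25 23 22) ;; Do (LoadAt 26 25) ;;
    IfNZ 26 (Do (Add 25 24 22) ;; Do (LoadAt 26 25) ;; Do (Defs.Sub 26 3 26) ;;
             Do (StoreAt 25 26)) nop).

(* The pivot is the last row with a 1 in the current column: clearing the column from
   top to bottom then turns the pivot row itself into 0 after its last use. *)
Definition pivot_code : com :=
  Do (Const 23 0) ;;
  For 21 5 6 7 (Do (Add 24 27 21) ;; Do (Add 25 24 20) ;; Do (LoadAt 26 25) ;;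
    IfNZ 26 (Do (Add 23 24 2)) nop).

Definition clear_code : com :=
  For 21 28 6 7 (Do (Add 24 27 21) ;; Do (Add 25 24 20) ;; Do (LoadAt 26 25) ;;
    IfNZ 26 xor_code nop).

Definition gauss_code : com :=
  For 20 2 3 29 (pivot_code ;; IfNZ 23 clear_code nop).

Definition zero_code : com :=
  Do (Const 30 1) ;;
  For 22 2 3 29 (Do (Add 25 32 22) ;; Do (LoadAt 26 25) ;;
    IfNZ 26 (Do (Const 30 0)) nop) ;;
  Do (Add 0 30 2).

(** Resolves the register comparisons left by reading through successive updates. *)
Ltac decide_regs := repeat match goal with
  | |- context [?a == ?b :> nat] =>
      first [have -> : (a == b) = false by lia | have -> : (a == b) = true by lia]
  end.

Section GaussCorrect.

Variables (w : word) (B Y n m start len : nat).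
Hypotheses (Y40 : 40 <= Y) (YB : Y + 4 * size w + 100 <= B).
Hypotheses (len_n : len <= n) (n_w : n < start) (w_size : size w = start + m * n.+1).

Local Notation ok := (ok w B).
Local Notation layout := (layout w n start Y len).

(** The target takes at most [size w] registers from [Y] on, and the copy of the input comes after
    them. Row 0 lies one block before the first vector, where [n < start] ensures that there is
    room. *)
Definition mbase := Y + size w + 1.
Definition tbase := start - n.+1.
Definition addr k := mbase + tbase + k * n.+1.
Definition cell (s : state) k j : bool := rg s (addr k + j) != 0.

Lemma addr_inj k k' j j' : j <= len -> j' <= len ->
  (addr k + j == addr k' + j') = (k == k') && (j == j').
Proof.
move=> jl jl'; apply/eqP/andP => [e0|[/eqP-> /eqP->] //].
have e : k * n.+1 + j = k' * n.+1 + j' by move: e0; rewrite /addr; lia.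
have jn : j < n.+1 by lia.
have jn' : j' < n.+1 by lia.
have : (k * n.+1 + j) %/ n.+1 = (k' * n.+1 + j') %/ n.+1 by rewrite e.
rewrite !divnMDl // !divn_small // !addn0 => kk; split; first exact/eqP.
by apply/eqP; move: e; rewrite kk => /addnI.
Qed.

Lemma addr_bound k j : k <= m -> j <= len.+1 -> mbase <= addr k + j <= B.
Proof.
move=> km jl; have : k * n.+1 <= m * n.+1 by rewrite leq_mul2r km orbT.
by rewrite /addr /mbase /tbase; lia.
Qed.

Definition gauss_regs (s : state) : Prop :=
  [/\ rg s 27 = mbase, rg s 28 = tbase, rg s 29 = len.+1 & rg s 32 = addr 0].

Definition mem_scratch (lo : nat) : pred nat :=
  fun r => (r == 1) || (lo <= r < 27) || (mbase <= r).

Lemma layout_mem lo s s' : 20 <= lo -> layout s -> quiet (mem_scratch lo) s s' -> layout s'.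
Proof.
move=> l20 [[r2 r3 r4 r5] [r6 r7 r8 r9]] [h _ _].
by split; split; rewrite h // /mem_scratch /mbase; lia.
Qed.

Lemma gauss_regs_mem lo s s' :
  gauss_regs s -> quiet (mem_scratch lo) s s' -> gauss_regs s'.
Proof.
move=> [r1 r2 r3 r4] [h _ _].
by split; rewrite h // /mem_scratch /mbase; lia.
Qed.

Lemma cell_setr s r x k j : r < 40 -> cell (setr s r x) k j = cell s k j.
Proof.
move=> r40; rewrite /cell rg_setr.
by have -> : (addr k + j == r) = false by rewrite /addr /mbase; lia.
Qed.

Lemma xor_ok s k p : layout s -> gauss_regs s -> k <= m -> p <= m ->
  rg s 24 = addr k -> rg s 23 = addr p ->
  ok xor_code (size w * (10 + 4) + 3) s (fun s' => quiet (mem_scratch 22) s s' /\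
    rg s' 23 = rg s 23 /\ rg s' 24 = rg s 24 /\
    forall k' j, k' <= m -> j <= len ->
      cell s' k' j = cell s k' j (+) ((k' == k) && cell s p j)).
Proof.
move=> ls gs km pm r24 r23.
have [[r2 r3 r4 r5] [r6 r7 r8 r9]] := ls; have [r27 r28 r29 r32] := gs.
pose X r := (r == 1) || (r == 22) || (r == 25) || (r == 26) || (mbase <= r).
have mb : 41 <= mbase by rewrite /mbase; lia.
pose J jj s' := forall k' j, k' <= m -> j <= len ->
  cell s' k' j = cell s k' j (+) [&& k' == k, j < jj & cell s p j].
have lenw : len.+1 <= size w by lia.
apply: (@ok_weaken _ _ _ (len.+1 * (10 + 4) + 3) _ _ (fun s' => quiet X s s' /\ J len.+1 s')).
- apply: (@ok_for _ _ _ _ _ _ _ _ _ 0 1 len.+1 10) => //.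
  + by split; rewrite /X //=; lia.
  + by move=> j jl; lia.
  + by lia.
  + by lia.
  + move=> jj s' r v; rewrite !inE => hr Js' k' j k'm jl.
    by rewrite cell_setr ?Js' //; case/orP: hr => /eqP ->.
  + by move=> k' j k'm jl; rewrite ltn0 andbF addbF.
  move=> jj s' jl qs' x' Js'; rewrite add0n muln1 in x'.
  have h' : forall r, ~~ X r -> rg s' r = rg s r by case: qs' => h _ _; exact: h.
  have e23 : rg s' 23 = addr p by rewrite h' // /X; lia.
  have e24 : rg s' 24 = addr k by rewrite h' // /X; lia.
  have e3 : rg s' 3 = 1 by rewrite h' // /X; lia.
  have /andP[bp1 bp2] := addr_bound pm (leqW jl).
  have /andP[bk1 bk2] := addr_bound km (leqW jl).
  apply: ok_do_seq => //=; first by rewrite e23 x'.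
  apply: ok_do_seq => //=; apply: (@ok_if _ _ _ _ _ 6).
  rewrite /= e23 x'; decide_regs.
  (* Even when [k = p] and the row is being erased, column [jj] has not been reached yet and still
     holds its original bit. *)
  have cp : (rg s' (addr p + jj) == 0) = ~~ cell s p jj.
    have := Js' p jj pm jl; rewrite ltnn andbF addbF /cell => <-.
    by rewrite negbK.
  rewrite cp; case cpj: (cell s p jj) => /=.
    apply: ok_do_seq => //=; first by rewrite e24 x'.
    apply: ok_do_seq => //=; apply: ok_do_seq => //=; apply: ok_do => //=.
    rewrite e24 e3 x'; decide_regs.
    split.
    * split=> // r Xr; rewrite /=; move: Xr; rewrite /X => Xr; decide_regs; by [].
    * by decide_regs.
    * move=> k' j k'm jl'; rewrite [LHS]/cell /=.
      have /andP[b1 b2] := addr_bound k'm (leqW jl').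
      rewrite addr_inj //; case: (altP (k' =P k)) => [->|kk] /=.
        case: (altP (j =P jj)) => [->|jj'] /=.
          have := Js' k jj km jl; rewrite ltnn andbF addbF ltnSn cpj /= => <-.
          by rewrite /cell; case: (rg s' (addr k + jj)) => [|x] //=; rewrite subSS sub0n.
        have /andP[b3 b4] := addr_bound km (leqW jl').
        decide_regs; rewrite -/(cell s' k j) Js' //.
        by rewrite eqxx /= ltnS [j <= jj]leq_eqVlt (negPf jj').
      by decide_regs; rewrite -/(cell s' k' j) Js' // (negPf kk).
  apply: ok_do => //=; split.
  * split=> // r Xr; rewrite /=; move: Xr; rewrite /X => Xr; decide_regs; by [].
  * by decide_regs.
  * move=> k' j k'm jl'; have /andP[b1 b2] := addr_bound k'm (leqW jl').
    rewrite [LHS]/cell /=; decide_regs; rewrite -/(cell s' k' j) Js' //.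
    congr (_ (+) _); case: (k' == k) => //=; rewrite ltnS [j <= jj]leq_eqVlt.
    by case: eqP => // ->; rewrite ltnn cpj.
- by lia.
move=> s' _ [[h b e] Js']; split; last split; last split.
- split=> // r hr; apply: h; move: hr; rewrite /mem_scratch /X; lia.
- by rewrite h // /X; lia.
- by rewrite h // /X; lia.
- by move=> k' j k'm jl; rewrite Js' // ltnS jl.
Qed.

Lemma addrS k : addr k.+1 = mbase + (start + k * n.+1).
Proof. by rewrite /addr /tbase mulSn; lia. Qed.

Definition reg_scratch : pred nat := fun r => (r == 1) || (21 <= r < 27).

Lemma cell_reg_scratch s s' k j : quiet reg_scratch s s' -> cell s' k j = cell s k j.
Proof.
by move=> [h _ _]; rewrite /cell h // /reg_scratch /addr /mbase; lia.
Qed.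

(** Row addresses are positive, so 0 in register 23 can signal that there is no pivot. *)
Definition is_pivot (s : state) i (r : nat) (k : nat) : Prop :=
  rg s 23 = 0 /\ (forall k', 0 < k' <= k -> cell s k' i = false) \/
  exists p, [/\ 0 < p <= k, rg s 23 = addr p, cell s p i &
    forall k', p < k' <= k -> cell s k' i = false].

Lemma pivot_ok s i : layout s -> gauss_regs s -> rg s 20 = i -> i <= len ->
  ok pivot_code (size w * (6 + 4) + 4) s (fun s' =>
    quiet reg_scratch s s' /\ is_pivot s' i (rg s' 23) m).
Proof.
move=> ls gs r20 il.
have [[r2 r3 r4 r5] [r6 r7 r8 r9]] := ls; have [r27 r28 r29 r32] := gs.
have mb : 41 <= mbase by rewrite /mbase; lia.
pose J k s' := is_pivot s' i (rg s' 23) k.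
rewrite addnS; apply: ok_do_seq => //=; set s1 := setr _ _ _.
have q1 : quiet reg_scratch s s1 by exact: quiet_setr.
apply: (@ok_weaken _ _ _ (m * (6 + 4) + 3) _ _ (fun s' => quiet reg_scratch s1 s' /\ J m s')).
- apply: (@ok_for _ _ _ _ _ _ _ _ _ start n.+1 (size w) 6) => //.
  + by move=> j jm; rewrite w_size ltn_add2l ltn_mul2r.
  + by rewrite w_size.
  + by lia.
  + move=> k s' r v; rewrite !inE /J /is_pivot => hr.
    have -> : rg (setr s' r v) 23 = rg s' 23 by rewrite rg_setr; case/orP: hr => /eqP ->.
    have ce k' : cell (setr s' r v) k' i = cell s' k' i.
      by rewrite cell_setr //; case/orP: hr => /eqP ->.
    case=> [[e h]|[p [hp e cp h]]]; [left | right].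
      by split=> // k' hk; rewrite ce h.
    by exists p; split=> //; rewrite ?ce // => k' hk; rewrite ce h.
  + by left; split=> // k' /andP[]; case: k'.
  move=> k s' km qs' x' Js'.
  have h' r : ~~ reg_scratch r -> rg s' r = rg s r.
    by move=> hr; case: qs' => h _ _; rewrite h //; case: q1 => h1 _ _; rewrite h1.
  have e27 : rg s' 27 = mbase by rewrite h'.
  have e20 : rg s' 20 = i by rewrite h'.
  have e2 : rg s' 2 = 0 by rewrite h'.
  have /andP[b1 b2] := addr_bound km (leqW il).
  have ax : rg s' 27 + rg s' 21 = addr k.+1 by rewrite addrS e27 x'.
  apply: ok_do_seq => //=; first by rewrite ax; lia.
  apply: ok_do_seq => //=; first by rewrite ax e20; lia.
  apply: ok_do_seq => //=; apply: (@ok_if _ _ _ _ _ 1).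
  rewrite /= ax e20; decide_regs.
  have cS s2 : quiet reg_scratch s' s2 -> forall k', cell s2 k' i = cell s' k' i.
    by move=> q k'; apply: cell_reg_scratch.
  case: (altP (rg s' _ =P 0)) => c0.
    apply: ok_do => //=; set s2 := setr _ _ _.
    have q2 : quiet reg_scratch s' s2.
      split=> // r; rewrite /reg_scratch /= => hr; decide_regs; by [].
    split=> //; case: Js' => [[e h]|[p [hp e cp h]]]; [left | right].
      split=> // k' hk; rewrite cS //; have [->|kk] := eqVneq k' k.+1.
        by apply/negbTE; rewrite /cell c0.
      by apply: h; lia.
    exists p; split=> //; first by lia.
      by rewrite cS.
    move=> k' hk; rewrite cS //; have [->|kk] := eqVneq k' k.+1.
      by apply/negbTE; rewrite /cell c0.
    by apply: h; lia.
  apply: ok_do => //=; first by decide_regs; lia.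
  set s2 := setr _ _ _.
  have q2 : quiet reg_scratch s' s2.
    split=> // r; rewrite /reg_scratch /= => hr; decide_regs; by [].
  split=> //; right; exists k.+1; split.
  - by rewrite /= leqnn.
  - by rewrite /= e2; lia.
  - by rewrite cS // /cell.
  - by move=> k'; lia.
- by rewrite leq_add2r leq_mul2r; apply/orP; right; rewrite w_size; nia.
move=> s' _ [q' Js']; split=> //; exact: quiet_trans q1 q'.
Qed.

Lemma clear_ok s i p : layout s -> gauss_regs s -> rg s 20 = i -> i <= len ->
  0 < p <= m -> rg s 23 = addr p -> cell s p i ->
  (forall k, p < k <= m -> cell s k i = false) ->
  ok clear_code (size w * (size w * 14 + 12) + 3) s (fun s' =>
    quiet (mem_scratch 21) s s' /\
    forall k j, k <= m -> j <= len ->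
      cell s' k j = cell s k j (+) (cell s k i && cell s p j)).
Proof.
move=> ls gs r20 il /andP[p0 pm] r23 cp above.
have [[r2 r3 r4 r5] [r6 r7 r8 r9]] := ls; have [r27 r28 r29 r32] := gs.
have mb : 41 <= mbase by rewrite /mbase; lia.
pose J kk s' := rg s' 23 = addr p /\ forall k j, k <= m -> j <= len ->
  cell s' k j = cell s k j (+) [&& k < kk, cell s k i & cell s p j].
pose Tb := size w * 14 + 8.
have tb : tbase + n.+1 = start by rewrite /tbase; lia.
apply: (@ok_weaken _ _ _ (m.+1 * (Tb + 4) + 3) _ _
  (fun s' => quiet (mem_scratch 21) s s' /\ J m.+1 s')).
- apply: (@ok_for _ _ _ _ _ _ _ _ _ tbase n.+1 (size w) Tb) => //.
  + by split; rewrite /mem_scratch //=; lia.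
  + move=> j jm; have : j * n.+1 <= m * n.+1 by rewrite leq_mul2r -[j <= m]ltnS jm orbT.
    by lia.
  + by rewrite mulSn; lia.
  + by rewrite mulSn; lia.
  + move=> kk s' r v; rewrite !inE => hr [e23 Js']; split.
      by rewrite rg_setr; case/orP: hr => /eqP ->.
    by move=> k j km jl; rewrite cell_setr ?Js' //; case/orP: hr => /eqP ->.
  + by split=> // k j km jl; rewrite ltn0 addbF.
  move=> kk s' km qs' x' [e23 Js']; rewrite ltnS in km.
  have h' r : ~~ mem_scratch 21 r -> rg s' r = rg s r by case: qs' => h _ _; exact: h.
  have e27 : rg s' 27 = mbase by rewrite h' // /mem_scratch; lia.
  have e20 : rg s' 20 = i by rewrite h' // /mem_scratch; lia.
  have e2 : rg s' 2 = 0 by rewrite h' // /mem_scratch; lia.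
  have /andP[b1 b2] := addr_bound km (leqW il).
  have ax : rg s' 27 + rg s' 21 = addr kk by rewrite e27 x' /addr addnA.
  have cpJ j : j <= len -> cell s' p j = cell s p j (+) ((p < kk) && cell s p j).
    by move=> jl; rewrite Js' // cp.
  rewrite /Tb (_ : _ + 8 = (size w * (10 + 4) + 3 + 2).+3); last lia.
  apply: ok_do_seq => //=; first by rewrite ax; lia.
  apply: ok_do_seq => //=; first by rewrite ax e20; lia.
  apply: ok_do_seq => //=; set s1 := setr _ 26 _.
  have q1 : quiet (mem_scratch 21) s' s1.
    split=> // r; rewrite /mem_scratch /= => hr; decide_regs; by [].
  have c1 k j : k <= m -> j <= len -> cell s1 k j = cell s' k j.
    move=> km' jl; have /andP[b3 b4] := addr_bound km' (leqW jl).
    by rewrite /cell /=; decide_regs.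
  have e26 : rg s1 26 = rg s' (addr kk + i) by rewrite /= ax e20; decide_regs.
  have ckk : (rg s1 26 != 0) = cell s kk i.
    by rewrite e26 -[_ != 0]/(cell s' kk i) Js' // ltnn addbF.
  apply: (@ok_if _ _ _ _ _ (size w * (10 + 4) + 3)).
  case: eqP ckk => r0 /= ckk.
    apply: ok_do => //=; first by lia.
    split; [| by [] | split; [exact: e23 |]].
      by apply: quiet_trans q1 _; exact: quiet_setr.
    move=> k j km' jl; rewrite cell_setr // c1 // Js' //; congr (_ (+) _).
    rewrite ltnS [k <= kk]leq_eqVlt; case: (altP (k =P kk)) => [->|//].
    by rewrite -ckk ltnn.
  (* Past the pivot the column is already 0, so whenever row [p] is added it has not yet been
     altered. *)
  have kp : kk <= p.
    by rewrite leqNgt; apply/negP => lt; move: ckk; rewrite above // lt km.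
  have ls1 := layout_mem (lo := 21) isT (layout_mem (lo := 21) isT ls qs') q1.
  have gs1 := gauss_regs_mem (gauss_regs_mem gs qs') q1.
  apply: ok_weaken (xor_ok ls1 gs1 km pm _ _) (leqnn _) _ => [||s2 _ [q2 [f23 [f24 cE]]]].
  - by rewrite /= ax.
  - exact: e23.
  have sub22 : subpred (mem_scratch 22) (mem_scratch 21).
    by move=> r; rewrite /mem_scratch; lia.
  split.
  - by apply: quiet_trans q1 (quiet_sub sub22 q2).
  - by case: q2 => h _ _; rewrite h // /mem_scratch; lia.
  split; first by rewrite f23.
  move=> k j km' jl; rewrite cE // !c1 // !Js' // ltnS [k <= kk]leq_eqVlt.
  rewrite (ltnNge p) kp /= addbF.
  case: (altP (k =P kk)) => [->|kk'] /=; last by rewrite addbF.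
  by rewrite ltnn -ckk addbF.
- rewrite leq_add2r /Tb -addnA leq_mul2r; apply/orP; right.
  by rewrite w_size; nia.
move=> s' _ [q' [_ Js']]; split=> // k j km jl.
by rewrite Js' // ltnS km.
Qed.

(** No echelon form is kept: a pivot row erases itself together with its column, and span membership
    is preserved. Once all columns are done the given rows are zero, and the target was in their
    span iff it has been reduced to 0. *)
Lemma gauss_ok s : layout s -> gauss_regs s ->
  ok gauss_code (size w * (size w * (size w * 14 + 22) + 14) + 3) s (fun s' =>
    quiet (mem_scratch 20) s s' /\
    (in_span m len (cell s) <-> forall j, j <= len -> cell s' 0 j = false)).
Proof.
move=> ls gs.
have [[r2 r3 r4 r5] [r6 r7 r8 r9]] := ls; have [r27 r28 r29 r32] := gs.
have mb : 41 <= mbase by rewrite /mbase; lia.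
pose J i s' := (in_span m len (cell s) <-> in_span m len (cell s')) /\
  forall k j, 0 < k <= m -> j < i -> j <= len -> cell s' k j = false.
pose Tb := size w * (size w * 14 + 22) + 10.
apply: (@ok_weaken _ _ _ (len.+1 * (Tb + 4) + 3) _ _
  (fun s' => quiet (mem_scratch 20) s s' /\ J len.+1 s')).
- apply: (@ok_for _ _ _ _ _ _ _ _ _ 0 1 len.+1 Tb) => //.
  + by split; rewrite /mem_scratch //=; lia.
  + by move=> j; lia.
  + by lia.
  + by lia.
  + move=> i s' r v; rewrite !inE => hr [sp z].
    have ce k j : cell (setr s' r v) k j = cell s' k j.
      by rewrite cell_setr //; case/orP: hr => /eqP ->.
    split; last by move=> k j hk ji jl; rewrite ce z.
    by apply: iff_trans sp _; split; apply: in_span_ext => k j _ _; rewrite ce.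
  move=> i s' il qs' x' [sp z]; rewrite ltnS in il; rewrite add0n muln1 in x'.
  have ls' := layout_mem (lo := 20) isT ls qs'; have gs' := gauss_regs_mem gs qs'.
  rewrite /Tb (_ : _ + 10 = (size w * (6 + 4) + 4) + ((size w * (size w * 14 + 12) + 3) + 3)); last by nia.
  apply: ok_seq; apply: ok_weaken (pivot_ok ls' gs' x' il) (leqnn _) _ => s1 _ [q1 pv].
  have sub1 : subpred reg_scratch (mem_scratch 21).
    by move=> r; rewrite /reg_scratch /mem_scratch; lia.
  have sub2 : subpred (mem_scratch 21) (mem_scratch 20).
    by move=> r; rewrite /mem_scratch; lia.
  have q1' := quiet_sub sub1 q1.
  have c1 k j : cell s1 k j = cell s' k j by exact: cell_reg_scratch q1.
  have r20 : rg s1 20 = i by case: q1 => h _ _; rewrite h.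
  have r201 : rg s1 20 = rg s' 20 by rewrite r20.
  have sp1 : in_span m len (cell s) <-> in_span m len (cell s1).
    by apply: iff_trans sp _; split; apply: in_span_ext => k j _ _; rewrite c1.
  rewrite (_ : _ + 3 = (size w * (size w * 14 + 12) + 3 + 1) + 2); last lia.
  apply: ok_if; case: pv => [[r23 none]|[p [hp r23 cp above]]].
    rewrite r23 /=; apply: ok_do => //=; first by lia.
    split; [| by [] |split].
    - by apply: quiet_trans (quiet_sub sub2 q1') _; exact: quiet_setr.
    - apply: iff_trans sp1 _; split; apply: in_span_ext => k j _ _; by rewrite cell_setr.
    - move=> k j hk; rewrite cell_setr // ltnS leq_eqVlt => /orP[/eqP -> _|ji jl].
        by rewrite none.
      by rewrite c1 z.
  have /andP[b1 b2] := addr_bound (proj2 (andP hp)) (leqW il).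
  have -> : (rg s1 23 == 0) = false by rewrite r23 /addr; lia.
  have ls1 := layout_mem (lo := 21) isT ls' q1'; have gs1 := gauss_regs_mem gs' q1'.
  apply: ok_weaken (clear_ok ls1 gs1 r20 il hp r23 cp above) _ _ => [|s2 _ [q2 c2]]; first lia.
  split.
  - by apply: quiet_sub sub2 _; exact: quiet_trans q1' q2.
  - by case: q2 => h _ _; rewrite h // /mem_scratch; lia.
  split; first by apply: iff_trans sp1 _; exact: in_span_pivot hp il c2.
  move=> k j hk ji jl; have /andP[_ km] := hk; have /andP[_ pm] := hp.
  rewrite c2 //; move: ji; rewrite ltnS leq_eqVlt => /orP[/eqP ->|ji].
    by rewrite cp andbT addbb.
  by rewrite !c1 (z _ j hk) // (z p j hp) // andbF.
- rewrite leq_add2r /Tb; apply: leq_mul; lia.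
move=> s' _ [q' [sp z]]; split=> //; apply: iff_trans sp _.
by apply: in_span_zero => k j hk jl; apply: z.
Qed.

Definition gauss_scratch : pred nat :=
  fun r => (r < 2) || (20 <= r < 33) || (mbase <= r).

Lemma layout_gauss s s' : layout s -> quiet gauss_scratch s s' -> layout s'.
Proof.
move=> [[r2 r3 r4 r5] [r6 r7 r8 r9]] [h _ _].
by split; split; rewrite h // /gauss_scratch /mbase; lia.
Qed.

Lemma zero_ok s : layout s -> gauss_regs s ->
  ok zero_code (size w * (5 + 4) + 5) s (fun s' => quiet gauss_scratch s s' /\
    (rg s' 0 != 0) = all (fun j => ~~ cell s 0 j) (iota 0 len.+1)).
Proof.
move=> ls gs.
have [[r2 r3 r4 r5] [r6 r7 r8 r9]] := ls; have [r27 r28 r29 r32] := gs.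
have mb : 41 <= mbase by rewrite /mbase; lia.
pose X r := (r == 1) || (20 <= r < 27) || (r == 30).
have XG r : X r -> gauss_scratch r by rewrite /X /gauss_scratch; lia.
pose J jj s' := (rg s' 30 != 0) = all (fun j => ~~ cell s 0 j) (iota 0 jj).
rewrite addnS; apply: ok_do_seq => //=; first by lia.
set s1 := setr _ _ _; have q1 : quiet X s s1 by exact: quiet_setr.
rewrite (_ : _ + 4 = size w * (5 + 4) + 3 + 1); last lia.
apply: ok_seq; apply: (@ok_weaken _ _ _ (len.+1 * (5 + 4) + 3) _ _
  (fun s' => quiet X s1 s' /\ J len.+1 s')).
- apply: (@ok_for _ _ _ _ _ _ _ _ _ 0 1 len.+1 5) => //.
  + by move=> j; lia.
  + by lia.
  + by lia.
  + move=> jj s' r v; rewrite !inE /J => hr.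
    by rewrite rg_setr; case/orP: hr => /eqP ->.
  move=> j s' jl qs' x' Js'; rewrite add0n muln1 in x'.
  have h' r : ~~ X r -> rg s' r = rg s r.
    by move=> hr; case: qs' => h _ _; rewrite h //; case: q1 => h1 _ _; rewrite h1.
  have e32 : rg s' 32 = addr 0 by rewrite h'.
  have /andP[b1 b2] := addr_bound (leq0n m) (leqW jl).
  have cj : rg s' (addr 0 + j) = rg s (addr 0 + j) by apply: h'; rewrite /X; lia.
  apply: ok_do_seq => //=; first by rewrite e32 x'.
  apply: ok_do_seq => //=; apply: (@ok_if _ _ _ _ _ 1).
  rewrite /= e32 x'; decide_regs; rewrite cj.
  have tail : all (fun j => ~~ cell s 0 j) (iota 0 j.+1) =
      all (fun j => ~~ cell s 0 j) (iota 0 j) && (rg s (addr 0 + j) == 0).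
    by rewrite -addn1 iotaD all_cat /= andbT negbK.
  case: eqP tail => c0 tail; apply: ok_do => //=.
  - split=> //; last by rewrite /J tail andbT.
    split=> // r; rewrite /X /= => hr; decide_regs; by [].
  - split=> //; last by rewrite /J tail andbF.
    split=> // r; rewrite /X /= => hr; decide_regs; by [].
- by rewrite leq_add2r leq_mul2r; lia.
move=> s2 bs2 [q2 J2]; have e2 : rg s2 2 = 0 by case: q2 => h _ _; rewrite h.
apply: ok_do => //=; first by rewrite e2 addn0; exact: bs2.
split; last by rewrite e2 addn0.
apply: quiet_trans (quiet_sub XG (quiet_trans q1 q2)) _.
by exact: quiet_setr.
Qed.

Lemma load_ok c p s : layout s ->
  (forall k, k < m -> nth false w (start + k * n.+1)) ->
  ok (load_code c p) (size w * 17 + 13) s (fun s' =>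
    [/\ quiet gauss_scratch s s', gauss_regs s',
        cell s' 0 0 = p /\ forall i, i < len -> cell s' 0 i.+1 = c (+) target Y s i &
        forall k, k < m -> cell s' k.+1 0 /\
          forall i, i < len -> cell s' k.+1 i.+1 = row_bit w (start + k * n.+1) i]).
Proof.
move=> ls marker.
have [[r2 r3 r4 r5] [r6 r7 r8 r9]] := ls.
have mb : 41 <= mbase by rewrite /mbase; lia.
have mw : mbase + size w <= B by rewrite /mbase; lia.
rewrite (_ : _ + 13 = (size w * (3 + 4) + 3 + (size w * (6 + 4) + 3).+2).+4.+1); last lia.
apply: ok_do_seq => //=; first by lia.
apply: ok_do_seq => //=; first by lia.
apply: ok_do_seq => //=; apply: ok_do_seq => //=; first by lia.
apply: ok_do_seq => //=; first by rewrite r9 r7 r3 r5 r6; lia.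
set s1 := setr _ _ _.
have q1 : quiet gauss_scratch s s1.
  split=> // r; rewrite /gauss_scratch /= => hr; decide_regs; by [].
have ls1 := layout_gauss ls q1.
have gs1 : gauss_regs s1.
  split; rewrite /= ?r3 ?r4 ?r5 ?r6 ?r7 ?r9 //; rewrite /addr /mbase /tbase; lia.
move: s1 q1 ls1 gs1 => s1 q1 ls1 gs1.
pose X r := (r == 1) || (r == 25) || (r == 26) || (r == 31) || (mbase <= r).
have XG r : X r -> gauss_scratch r by rewrite /X /gauss_scratch; lia.
have [[f2 f3 f4 f5] [f6 f7 f8 f9]] := ls1; have [f27 f28 f29 f32] := gs1.
pose J x s' := forall q, q < x -> (rg s' (mbase + q) != 0) = nth false w q.
apply: ok_seq; apply: (@ok_weaken _ _ _ _ _ _ (fun s' => quiet X s1 s' /\ J (size w) s')).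
- apply: (@ok_for _ _ _ _ _ _ _ _ _ 0 1 (size w) 3) => //.
  + by split; rewrite /X //=; lia.
  + by move=> j; lia.
  + by lia.
  + by lia.
  + move=> jj s' r v; rewrite !inE => hr Js' q qj; rewrite rg_setr -Js' //.
    by case/orP: hr => /eqP ->; decide_regs.
  move=> x s' xw qs' x' Js'; rewrite add0n muln1 in x'.
  have e27 : rg s' 27 = mbase by case: qs' => h _ _; rewrite h // /X; lia.
  apply: ok_do_seq => //=; first by lia.
  apply: ok_do_seq => //=; first by rewrite e27 x'; lia.
  apply: ok_do => //=; rewrite e27 x'; split.
  + split=> // r; rewrite /X /= => hr; decide_regs; by [].
  + by decide_regs.
  move=> q; rewrite ltnS leq_eqVlt /= => /orP[/eqP ->|qx].
    by rewrite eqxx; case: (nth _ _ _).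
  by decide_regs; exact: Js'.
- by [].
move=> s2 _ [q2 J2].
have h2 r : ~~ X r -> rg s2 r = rg s1 r by case: q2 => h _ _; exact: h.
have g32 : rg s2 32 = addr 0 by rewrite h2 // /X; lia.
have g9 : rg s2 9 = Y by rewrite h2 // /X; lia.
have g3 : rg s2 3 = 1 by rewrite h2 // /X; lia.
apply: ok_do_seq => //=; first by case: (p); lia.
apply: ok_do_seq => //=; rewrite g32; set s3 := setr _ _ _.
have /andP[b1 b2] := addr_bound (leq0n m) (leq0n len.+1); rewrite addn0 in b1 b2.
have q3 : quiet X s2 s3.
  split=> // r; rewrite /X /= => hr; decide_regs; by [].
have q13 := quiet_trans q2 q3.
have low k j : k <= m -> j <= len -> addr k + j < mbase + size w.
  move=> km jl; have : k * n.+1 <= m * n.+1 by rewrite leq_mul2r km orbT.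
  by rewrite /addr /tbase; lia.
have rowE k j : k < m -> j <= len -> cell s3 k.+1 j = nth false w (start + k * n.+1 + j).
  move=> km jl; have := low k.+1 j km jl; rewrite addrS -addnA ltn_add2l => lt.
  rewrite -J2 // /cell /= addrS -addnA.
  have a0 : addr 0 < mbase + (start + k * n.+1 + j) by rewrite /addr /tbase; lia.
  by decide_regs.
pose J' i s' := [/\ cell s' 0 0 = p, forall i', i' < i -> cell s' 0 i'.+1 = c (+) target Y s i' &
  forall k j, k < m -> j <= len -> cell s' k.+1 j = nth false w (start + k * n.+1 + j)].
apply: (@ok_weaken _ _ _ (len * (6 + 4) + 3) _ _ (fun s' => quiet X s3 s' /\ J' len s')).
- have s3E r : ~~ X r -> rg s3 r = rg s1 r by case: q13 => h _ _; exact: h.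
  apply: (@ok_for _ _ _ _ _ _ _ _ _ 0 1 len 6) => //.
  + by split; rewrite /X //=; lia.
  + by rewrite s3E // /X; lia.
  + by split; rewrite s3E // /X; lia.
  + by move=> j; lia.
  + by lia.
  + by lia.
  + move=> i s' r v; rewrite !inE => hr [c0 ci cr].
    have ce k j : cell (setr s' r v) k j = cell s' k j.
      by rewrite cell_setr //; case/orP: hr => /eqP ->.
    by split=> [|i' hi'|k j km jl]; rewrite ce; auto.
  + split=> //; rewrite /cell /= addn0 eqxx; by case: (p).
  move=> i s' il qs' x' [c0 ci cr]; rewrite add0n muln1 in x'.
  have s'E r : ~~ X r -> rg s' r = rg s1 r.
    by move=> hr; case: qs' => h _ _; rewrite h // s3E.
  have e9 : rg s' 9 = Y by rewrite s'E // /X; lia.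
  have e3 : rg s' 3 = 1 by rewrite s'E // /X; lia.
  have e32 : rg s' 32 = addr 0 by rewrite s'E // /X; lia.
  have yE : rg s' (Y + i) = rg s (Y + i).
    rewrite s'E; last by rewrite /X /mbase; lia.
    by case: q1 => h _ _; rewrite h // /gauss_scratch /mbase; lia.
  have li := low 0 i.+1 (leq0n m) il.
  apply: ok_do_seq => //=; first by lia.
  apply: ok_do_seq => //=; set s4 := setr _ 26 _.
  have e26 : rg s4 26 = rg s (Y + i) by rewrite /= e9 x'; decide_regs.
  have q4 : quiet X s' s4.
    split=> // r; rewrite /X /= => hr; decide_regs; by [].
  have f31 : rg s4 31 = i by [].
  have m4 r : 27 <= r -> rg s4 r = rg s' r by move=> hr /=; decide_regs.
  have low4 r : r < 25 -> rg s4 r = rg s' r by move=> hr /=; decide_regs.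
  move: s4 e26 q4 f31 m4 low4 => s4 e26 q4 f31 m4 low4.
  apply: (@ok_seq _ _ _ _ 1).
  apply: (@ok_weaken _ _ _ 1 _ _ (fun s5 => [/\ quiet X s4 s5, (rg s5 26 != 0) = c (+) target Y s i
     & forall r, r != 1 -> r != 26 -> rg s5 r = rg s4 r])) => //.
    rewrite /target -e26; case: (c); apply: ok_do => //=.
    - split; first exact: quiet_setr.
        by rewrite low4 // e3; case: (rg s4 26) => [|x] //=; rewrite subSS sub0n.
      by move=> r _ r26; rewrite (negPf r26).
    - split=> //; first exact: quiet_setr.
      by move=> r r1 _; rewrite (negPf r1).
  move=> s5 _ [q5 f26 s5E].
  have g31 : rg s5 31 = i by rewrite s5E.
  have k32 : rg s5 32 = addr 0 by rewrite s5E // m4.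
  have k3 : rg s5 3 = 1 by rewrite s5E // low4.
  apply: ok_do_seq => //=; first by rewrite k32 g31; lia.
  apply: ok_do_seq => //=; first by rewrite k32 g31 k3; lia.
  apply: ok_do => //=; rewrite k32 g31 k3.
  split.
  + apply: quiet_trans q4 (quiet_trans q5 _).
    split=> // r; rewrite /X /= => hr; decide_regs; by [].
  + by decide_regs; rewrite x'.
  have cE k j : k <= m -> j <= len -> (k == 0) && (j == i.+1) = false ->
      cell (setr (setr (setr s5 25 (addr 0 + i)) 25 (addr 0 + i + 1)) (addr 0 + i + 1)
        (rg s5 26)) k j = cell s' k j.
    move=> km jl kj; have /andP[b3 b4] := addr_bound km (leqW jl).
    rewrite /cell /= -addnA addn1 addr_inj // kj; decide_regs.
    by rewrite s5E ?m4 //; lia.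
  split.
  + by rewrite -c0; apply: cE => //; rewrite andbF.
  + move=> i'; rewrite ltnS leq_eqVlt => /orP[/eqP ->|ii].
      by rewrite /cell /= -addnA addn1 eqxx.
    rewrite -ci //; apply: cE => //; first exact: leq_trans (ltnW il).
    by apply/negbTE; rewrite eqSS neq_ltn ii.
  + move=> k j km jl; rewrite -cr //; exact: cE.
- by rewrite leq_add2r leq_mul2r; lia.
move=> s' _ [q' [c0 ci cr]]; split=> //.
- by apply: quiet_trans q1 (quiet_sub XG (quiet_trans q13 q')).
- have q1s' := quiet_trans q13 q'.
  by split; case: q1s' => h _ _; rewrite h // /X; lia.
move=> k km; split; first by rewrite cr // addn0 marker.
by move=> i il; rewrite cr // /row_bit addn1 addnS.
Qed.

Definition span_time (N : nat) : nat := N * 17 + 13 + (N * (N * (N * 14 + 22) + 14) + 3 + (N * 9 + 5)).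

Definition span_code c p : com := load_code c p ;; gauss_code ;; zero_code.

Lemma span_ok c p s : layout s ->
  (forall k, k < m -> nth false w (start + k * n.+1)) ->
  ok (span_code c p) (span_time (size w)) s (fun s' => quiet gauss_scratch s s' /\
    (rg s' 0 != 0 <-> exists2 l, all (fun a => a \in rows n start m) l &
      odd (size l) = p /\ forall i, i < len ->
        c (+) target Y s i = \big[addb/false]_(a <- l) row_bit w a i)).
Proof.
move=> ls marker; rewrite /span_time; apply: ok_seq.
apply: ok_weaken (@load_ok c p s ls marker) (leqnn _) _ => s1 _ [q1 gs1 [c00 c0i] ck].
have ls1 := layout_gauss ls q1.
apply: ok_seq; apply: ok_weaken (gauss_ok ls1 gs1) (leqnn _) _ => s2 _ [q2 sp].
have ls2 := layout_mem (lo := 20) isT ls1 q2; have gs2 := gauss_regs_mem gs1 q2.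
have sub r : mem_scratch 20 r -> gauss_scratch r.
  by rewrite /mem_scratch /gauss_scratch; lia.
apply: ok_weaken (zero_ok ls2 gs2) (leqnn _) _ => s3 _ [q3 ->]; split.
  by apply: quiet_trans q1 (quiet_trans (quiet_sub sub q2) q3).
have -> : all (fun j => ~~ cell s2 0 j) (iota 0 len.+1) <-> in_span m len (cell s1).
  apply: iff_trans (iff_sym sp); split=> [/allP h j jl|h].
    by apply/negbTE/h; rewrite mem_iota ltnS.
  by apply/allP => j; rewrite mem_iota ltnS => /andP[_ jl]; rewrite h.
(* Matrix row 0 is the target, so row [k] holds the given vector number [k - 1]. *)
pose f k := start + k.-1 * n.+1.
have sumE l i : all (fun k => 0 < k <= m) l -> i < len ->
    \big[addb/false]_(k <- l) cell s1 k i.+1 = \big[addb/false]_(a <- map f l) row_bit w a i.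
  move=> hl il; rewrite big_map !big_seq; apply: eq_bigr => -[|k] /(allP hl) //= km.
  by have [_ ->] := ck k km.
have sum0 l : all (fun k => 0 < k <= m) l ->
    \big[addb/false]_(k <- l) cell s1 k 0 = odd (size l).
  elim: l => [|[|k] l IH] //=; first by rewrite big_nil.
  by case/andP=> km /IH; rewrite big_cons => ->; have [-> _] := ck k km.
split=> [[l hl h]|[l hl [pl h]]].
  exists (map f l).
    apply/allP => a /mapP[k /(allP hl) /andP[k0 km] ->].
    by apply/mapP; exists k.-1 => //; rewrite mem_iota; lia.
  split; first by rewrite size_map -sum0 // -h // c00.
  by move=> i il; rewrite -c0i // h // sumE.
have [l' hl' lE] : exists2 l', all (fun k => 0 < k <= m) l' & l = map f l'.
  elim: l hl {pl h} => [|a l IH] /=; first by exists [::].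
  case/andP=> /mapP[k]; rewrite mem_iota add0n => /andP[_ km] -> /IH [l' hl' ->].
  by exists (k.+1 :: l'); rewrite //= km.
exists l' => // -[_|i il]; first by rewrite c00 -pl lE size_map sum0.
by rewrite c0i // h // lE sumE.
Qed.

End GaussCorrect.

(** * Polynomial-time membership *)

Definition poly_bounded (f : nat -> nat) : Prop :=
  exists p : {poly nat}, forall x, f x <= p.[x]%R.

Lemma poly_bounded_const c : poly_bounded (fun=> c).
Proof. by exists (c%:P)%R => x; rewrite hornerC. Qed.

Lemma poly_bounded_id : poly_bounded id.
Proof. by exists 'X%R => x; rewrite hornerX. Qed.

Lemma poly_bounded_add f g :
  poly_bounded f -> poly_bounded g -> poly_bounded (fun x => f x + g x).
Proof.
move=> [p hp] [q hq]; exists (p + q)%R => x; rewrite hornerD.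
exact: leq_add (hp x) (hq x).
Qed.

Lemma poly_bounded_mul f g :
  poly_bounded f -> poly_bounded g -> poly_bounded (fun x => f x * g x).
Proof.
move=> [p hp] [q hq]; exists (p * q)%R => x; rewrite hornerM.
exact: leq_mul (hp x) (hq x).
Qed.

Ltac poly_bound := repeat first
  [ exact: poly_bounded_const | exact: poly_bounded_id
  | apply: poly_bounded_add | apply: poly_bounded_mul | assumption ].

Lemma poly_bounded_form_time phi : poly_bounded (form_time phi).
Proof. by elim: phi => *; rewrite /form_time -/form_time; poly_bound. Qed.

Lemma poly_bounded_span_time : poly_bounded span_time.
Proof. rewrite /span_time; poly_bound. Qed.

Definition member (F : seq (operation bool)) (w : word) (n start m len : nat)
    (y : nat -> bool) : Prop :=
  clo F (rowset (rows n start m) (row_bit w)) (fun i : 'I_len => y i).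

(** A tester must preserve the layout, the target, and registers 10 to 19, where the enclosing
    programs keep their own data. *)
Definition private (Y n : nat) : pred nat :=
  fun r => (r < 2) || (20 <= r < Y) || (Y + n <= r).

(* The vectors occupy the end of [w], each of them preceded by a bit 1. *)
Definition input_shape (w : word) (n start m : nat) : Prop :=
  [/\ n < start, size w = start + m * n.+1 &
      forall k, k < m -> nth false w (start + k * n.+1)].

Definition tester (F : seq (operation bool)) (Y : nat) (c : com) (T : nat -> nat) : Prop :=
  forall w n start m B len s, Y + 4 * size w + 100 <= B -> len <= n ->
    input_shape w n start m -> layout w n start Y len s ->
    ok w B c (T (size w)) s (fun s' => quiet (private Y n) s s' /\
      (rg s' 0 != 0 <-> member F w n start m len (target Y s))).

Lemma tester_fo F : fo_definable F ->
  exists Y c T, [/\ 40 <= Y, poly_bounded T & tester F Y c T].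
Proof.
case=> phi def; exists (var_reg (depth phi)), (cform 0 phi), (form_time phi).
split; [by rewrite /var_reg; lia | exact: poly_bounded_form_time |].
move=> w n start m B len s YB ln [ns wE _] ls.
have h := @cform_ok w B _ n m start len YB ln ns wE phi 0 s ls.
apply: ok_weaken (h _ _) (leqnn _) _ => [||s' _ [-> q]]; rewrite ?add0n //.
split; first by apply: quiet_sub q => r; rewrite /scratch /private /var_reg; lia.
rewrite /member def (@eq_sat _ _ _ _ 0 phi _ (fun=> 0)) //.
Qed.

(** * Membership for affine operations *)

Section AffineTester.

Variable F : seq (operation bool).
Hypotheses (aff : forall f, List.In f F -> affine (@ap f)) (hmin : has_minority F).

Definition in_unary (b : Prop) c p : bool := holds (unary_in F b c p).

(** [size w - start] is nonzero iff there is a given vector, and selects which of the two built-in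
    bits applies. Register 33, just above those used by the elimination, collects the disjunction
    over the four cases. *)
Definition affine_case (cp : bool * bool) : com :=
  span_code cp.1 cp.2 ;;
  IfNZ 0 (Do (Defs.Sub 1 7 5) ;;
          IfNZ 1 (Do (Const 0 (in_unary True cp.1 cp.2)))
                 (Do (Const 0 (in_unary False cp.1 cp.2)))) nop ;;
  IfNZ 0 (Do (Const 33 1)) nop.

Definition affine_code : com :=
  Do (Const 33 0) ;;
  foldr (fun cp c => affine_case cp ;; c) (Do (Add 0 33 2))
    [seq (c, p) | c <- [:: false; true], p <- [:: false; true]].

Section Correct.

Variables (w : word) (B n start m len : nat).
Hypotheses (YB : 40 + 4 * size w + 100 <= B) (len_n : len <= n).
Hypothesis shape : input_shape w n start m.

Local Notation ok := (ok w B).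
Local Notation layout := (layout w n start 40 len).
Local Notation S := (@rowset len (rows n start m) (row_bit w)).

(* The closure consists of the vectors [c + \sum_(s in l) s] such that the function
   [x |-> c + p x], where [p] is the parity of [size l], is in the clone. *)
Definition affine_sol (y : nat -> bool) (cp : bool * bool) : Prop :=
  unary_in F (exists s, S s) cp.1 cp.2 /\
  exists2 l, all (fun a => a \in rows n start m) l & odd (size l) = cp.2 /\
    forall i, i < len -> cp.1 (+) y i = \big[addb/false]_(a <- l) row_bit w a i.

Lemma member_affine y : member F w n start m len y <-> exists cp, affine_sol y cp.
Proof.
apply: iff_trans (clo_affineP _ _ aff hmin) _; split=> [[c [l [u Sl yE]]]|[[c p] [u [l hl [lp yE]]]]].
  have [la hla lE] : exists2 la, all (fun a => a \in rows n start m) la &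
      size la = size l /\ forall i : 'I_len, xor_list l i = \big[addb/false]_(a <- la) row_bit w a i.
    elim: l Sl {u yE} => [_|s l IH [[a ra sE] /IH [la hla [sz e]]]].
      by exists [::] => //; split=> // i; rewrite /xor_list !big_nil.
    exists (a :: la); rewrite /= ?ra ?sz //; split=> // i.
    by rewrite /xor_list !big_cons sE -e.
  exists (c, odd (size l)); split=> //; exists la => //; split; first by case: lE => ->.
  move=> i il; have /= -> := yE (Ordinal il); case: lE => _ e.
  by rewrite addbA addbb -(e (Ordinal il)).
exists c, [seq (fun i : 'I_len => row_bit w a i) | a <- l]; split.
- by rewrite size_map lp.
- by elim: l hl {yE lp} => //= a l IH /andP[ra /IH]; split=> //; exists a.
- by move=> i; rewrite /xor_list big_map -yE // addbA addbb.
Qed.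

Lemma affine_case_ok cp s : layout s ->
  ok (affine_case cp) (span_time (size w) + 9) s (fun s' =>
    quiet (private 40 n) s s' /\
    (rg s' 33 != 0 <-> rg s 33 != 0 \/ affine_sol (target 40 s) cp)).
Proof.
move=> ls; have [ns wE marker] := shape.
rewrite (_ : _ + 9 = span_time (size w) + (6 + 3)); last lia.
apply: ok_seq.
apply: ok_weaken (@span_ok w B 40 n m start len isT YB len_n ns wE cp.1 cp.2 s ls marker)
  (leqnn _) _ => s1 _ [q1 sp].
have q1' : quiet (private 40 n) s s1.
  by apply: quiet_sub q1 => r; rewrite /gauss_scratch /mbase /private; lia.
have s1E r : 2 <= r < 20 -> rg s1 r = rg s r.
  by move=> hr; case: q1 => h _ _; rewrite h // /gauss_scratch /mbase; lia.
have [[r2 r3 r4 r5] [r6 r7 r8 r9]] := ls.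
have s33 : rg s1 33 = rg s 33.
  by case: q1 => h _ _; rewrite h // /gauss_scratch /mbase; lia.
have mE : (size w - start == 0) = (m == 0).
  by rewrite wE addKn muln_eq0 orbF.
have ne : (exists s, S s) <-> m != 0.
  split=> [[r [a /mapP[k]]]|m0]; first by rewrite mem_iota add0n => km; lia.
  exists (fun i => row_bit w (start + 0 * n.+1) i), (start + 0 * n.+1) => //.
  by apply/mapP; exists 0; rewrite ?mem_iota //; lia.
apply: (@ok_seq _ _ _ _ 6); apply: (@ok_weaken _ _ _ 6 _ _ (fun s2 =>
    quiet (fun r => r < 2) s1 s2 /\ (rg s2 0 != 0 <-> affine_sol (target 40 s) cp))) => //.
  apply: (@ok_if _ _ _ _ _ 4); case: eqP sp => r0 sp.
    apply: ok_do => //=; split; first exact: quiet_setr.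
    by split=> [|[_ h]]; [rewrite r0 | rewrite r0; apply/sp].
  apply: ok_do_seq => //=; apply: (@ok_if _ _ _ _ _ 1).
  rewrite /= !s1E // r7 r5 mE; case: eqP ne => m0 ne; apply: ok_do => //=.
  - by case: (in_unary _ _ _); lia.
  - split; first by apply: quiet_trans (quiet_setr _ _ _) (quiet_setr _ _ _).
    have nF : False <-> exists s, S s by split=> // /ne.
    split=> [h|[u _]].
      split; last exact/sp/eqP.
      by apply: unary_in_eq nF _; apply/holdsP; move: h; rewrite /in_unary; case: holds.
    by rewrite /in_unary; case: holdsP => // nu; case: nu; apply: unary_in_eq (iff_sym nF) u.
  - by case: (in_unary _ _ _); lia.
  - split; first by apply: quiet_trans (quiet_setr _ _ _) (quiet_setr _ _ _).
    have nT : True <-> exists s, S s by split=> // _; apply/ne.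
    split=> [h|[u _]].
      split; last exact/sp/eqP.
      by apply: unary_in_eq nT _; apply/holdsP; move: h; rewrite /in_unary; case: holds.
    by rewrite /in_unary; case: holdsP => // nu; case: nu; apply: unary_in_eq (iff_sym nT) u.
move=> s2 _ [q2 sol].
have q2' : quiet (private 40 n) s s2.
  by apply: quiet_trans q1' (quiet_sub _ q2) => r; rewrite /private => ->.
have s233 : rg s2 33 = rg s 33 by rewrite -s33; case: q2 => h _ _; rewrite h.
apply: (@ok_if _ _ _ _ _ 1); case: eqP sol => r0 sol; apply: ok_do => //=.
- split; first by apply: quiet_trans q2' _; exact: quiet_setr.
  by rewrite s233; split=> [|[|/sol]] //; left.
- by lia.
- split; first by apply: quiet_trans q2' _; exact: quiet_setr.
  by split=> // _; right; apply/sol.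
Qed.

Lemma affine_code_ok s : layout s ->
  ok affine_code (4 * (span_time (size w) + 9) + 2) s (fun s' =>
    quiet (private 40 n) s s' /\
    (rg s' 0 != 0 <-> member F w n start m len (target 40 s))).
Proof.
move=> ls; rewrite /affine_code addnS.
apply: ok_do_seq => //=; set s0 := setr _ _ _.
have q0 : quiet (private 40 n) s s0 by exact: quiet_setr.
have tE i : target 40 s0 i = target 40 s i by [].
have lay s' : quiet (private 40 n) s s' -> layout s'.
  move=> [h _ _]; case: ls => [[r2 r3 r4 r5] [r6 r7 r8 r9]].
  by split; split; rewrite h // /private; lia.
pose cps := [seq (c, p) | c <- [:: false; true], p <- [:: false; true]].
suff gen l s1 : quiet (private 40 n) s s1 ->
    ok (foldr (fun cp c => affine_case cp ;; c) (Do (Add 0 33 2)) l)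
      (size l * (span_time (size w) + 9) + 1) s1 (fun s' => quiet (private 40 n) s s' /\
      (rg s' 0 != 0 <-> rg s1 33 != 0 \/
         exists2 cp, cp \in l & affine_sol (target 40 s) cp)).
  apply: ok_weaken (gen cps s0 q0) (leqnn _) _ => s' _ [q' e]; split=> //.
  apply: iff_trans e _; apply: iff_trans _ (iff_sym (member_affine _)).
  split=> [[//|[cp _ h]]|[cp h]]; first by exists cp.
  by right; exists cp => //; case: cp {h} => [[] []].
elim: l s1 => [|cp l IH] s1 q1 /=.
  have e2 : rg s1 2 = 0 by case: (lay s1 q1) => [[]].
  apply: ok_bounded => b1; apply: ok_do => //=; first by rewrite e2 addn0.
  split; first by apply: quiet_trans q1 _; exact: quiet_setr.
  by rewrite e2 addn0; split=> [|[//|[]//]]; left.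
rewrite mulSn -addnA; apply: ok_seq.
apply: ok_weaken (@affine_case_ok cp s1 (lay _ q1)) (leqnn _) _ => s2 _ [q2 e2].
have q12 := quiet_trans q1 q2.
apply: ok_weaken (IH s2 q12) (leqnn _) _ => s' _ [q' e']; split=> //.
apply: iff_trans e' _.
have same : affine_sol (target 40 s1) cp <-> affine_sol (target 40 s) cp.
  have t1 i : i < len -> target 40 s1 i = target 40 s i.
    by move=> il; case: q1 => h _ _; rewrite /target h // /private; lia.
  by split=> -[u [la hla [sz h]]]; split=> //; exists la => //; split=> // i il;
    rewrite -h // t1.
split=> [[/e2 [h|/same h]|[cp' cl h]]|[h|[cp' + h]]].
- by left.
- by right; exists cp; rewrite ?inE ?eqxx.
- by right; exists cp'; rewrite // inE cl orbT.
- by left; apply/e2; left.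
- rewrite inE => /orP[/eqP e|cl]; last by right; exists cp'.
  by left; apply/e2; right; apply/same; rewrite -e.
Qed.

End Correct.

Lemma tester_affine : exists Y c T, [/\ 40 <= Y, poly_bounded T & tester F Y c T].
Proof.
exists 40, affine_code, (fun N => 4 * (span_time N + 9) + 2); split=> //.
  by have h := poly_bounded_span_time; poly_bound.
by move=> w n start m B len s YB ln shape ls; exact: affine_code_ok.
Qed.

End AffineTester.

Lemma exists_tester F : exists Y c T, [/\ 40 <= Y, poly_bounded T & tester F Y c T].
Proof.
case: (fo_definable_or_affine F) => [|[aff hmin]]; first exact: tester_fo.
exact: tester_affine.
Qed.

(** * Closures of sets of tuples, and encoded instances *)

Lemma all_In (T : Type) (a : pred T) (l : seq T) x : List.In x l -> all a l -> a x.
Proof. by elim: l => //= y l IH [->|/IH h] /andP[] // _ /h. Qed.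

Lemma In_all (T : Type) (a : pred T) (l : seq T) : (forall x, List.In x l -> a x) -> all a l.
Proof. by elim: l => //= y l IH h; rewrite h ?IH //; [move=> x lx; apply: h; right | left]. Qed.

(** The tuples satisfying [clo] form one of the closed sets in the intersection; conversely a
    derivation stays inside each of these sets. *)
Lemma mem_Cl (F : seq (operation bool)) n (S : {set n.-tuple bool}) v :
  v \in Cl F S <-> clo F (fun s => exists2 t, t \in S & s =1 tnth t) (tnth v).
Proof.
set G := fun s => _; split=> [/bigcapP h|c].
  pose C := [set t | holds (clo F G (tnth t))].
  suff /h : (S \subset C) && closed_under F C by rewrite inE => /holdsP.
  apply/andP; split.
    apply/subsetP => t St; rewrite inE; apply/holdsP; apply: clo_mem.
    by exists t.
  apply: In_all => f Ff; apply/forallP => vs; apply/implyP => /allP Cvs.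
  rewrite inE; apply/holdsP; apply: (@clo_ext _ _ _ (fun i => ap (fun j => tnth (tnth vs j) i))).
    by move=> i; rewrite tnth_mktuple.
  apply: (@clo_app _ _ _ f (fun j => tnth (tnth vs j))) => // j; apply/holdsP.
  have Cj : tnth vs j \in C by apply: Cvs; exact: mem_tnth.
  by move: Cj; rewrite inE => ->.
apply/bigcapP => C /andP[/subsetP SC cC].
suff cl u : clo F G u -> [tuple u i | i < n] \in C.
  by have := cl _ c; congr (_ \in C); apply: eq_from_tnth => i; rewrite tnth_mktuple.
elim=> {c v u} [s v [t /SC Ct st] sv|f vs v Ff _ IH vE].
  suff -> : [tuple v i | i < n] = t by [].
  by apply: eq_from_tnth => i; rewrite tnth_mktuple -sv st.
have /forallP/(_ [tuple [tuple vs j i | i < n] | j < tag f]) := all_In Ff cC.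
move/implyP => h; have {}h : apply_op (tagged f) [tuple [tuple vs j i | i < n] | j < tag f] \in C.
  by apply: h; apply/allP => _ /tnthP[j ->]; rewrite tnth_mktuple; exact: IH.
move: h; congr (_ \in C); apply: eq_from_tnth => i; rewrite !tnth_mktuple vE.
by apply: eq_ap => j; rewrite !tnth_mktuple.
Qed.

Section Encoding.

Variables (n : nat) (s : seq (n.-tuple bool)) (pre : word).

Local Notation w := (pre ++ encode_vectors s).

Lemma size_encode_vectors : size (encode_vectors s) = size s * n.+1.
Proof. by elim: s => //= v l IH; rewrite size_cat /= size_tuple IH mulSn. Qed.

Lemma nth_encode_vectors k j : k < size s -> j <= n ->
  nth false (encode_vectors s) (k * n.+1 + j) =
  nth false (true :: nth [::] (map val s) k) j.
Proof.
elim: s k => // v l IH [|k] kl jn.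
  rewrite mul0n add0n -[encode_vectors _]/((true :: v) ++ encode_vectors l).
  by rewrite nth_cat /= size_tuple ltnS jn.
rewrite -[encode_vectors _]/((true :: v) ++ encode_vectors l).
rewrite nth_cat /= size_tuple mulSn ifN -?leqNgt; last by lia.
by rewrite (_ : _ - _ = k * n.+1 + j) ?IH //; lia.
Qed.

Lemma encoding_shape : n < size pre -> input_shape w n (size pre) (size s).
Proof.
move=> np; split=> //; first by rewrite size_cat size_encode_vectors.
move=> k ks; rewrite nth_cat ltnNge leq_addr /= addKn -[k * _]addn0.
by rewrite nth_encode_vectors.
Qed.

Lemma encoding_row k i : k < size s -> i < n ->
  row_bit w (size pre + k * n.+1) i = nth false (nth [::] (map val s) k) i.
Proof.
move=> ks il; rewrite /row_bit nth_cat -!addnA ltnNge leq_addr /= addKn addn1.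
by rewrite nth_encode_vectors.
Qed.

Lemma member_encoding F (S : {set n.-tuple bool}) (y : nat -> bool) : s =i S ->
  member F w n (size pre) (size s) n y <-> [tuple y i | i < n] \in Cl F S.
Proof.
move=> sS; apply: iff_trans _ (iff_sym (mem_Cl _ _ _)).
have rowE k i : k < size s -> row_bit w (size pre + k * n.+1) (i : 'I_n) =
    tnth (nth [tuple false | _ < n] s k) i.
  by move=> ks; rewrite encoding_row // (nth_map [tuple false | _ < n]) // (tnth_nth false).
split=> h.
  apply: (@clo_ext _ _ _ (fun i : 'I_n => y i)) => [i|]; first by rewrite tnth_mktuple.
  apply: clo_eq_gen h => r [a /mapP[k]]; rewrite mem_iota add0n => /andP[_ ks] -> rE.
  exists r => //; exists (nth [tuple false | _ < n] s k); first by rewrite -sS mem_nth.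
  by move=> i; rewrite rE rowE.
apply: (@clo_ext _ _ _ (tnth [tuple y i | i < n])) => [i|]; first by rewrite tnth_mktuple.
apply: clo_eq_gen h => r [t]; rewrite -sS => ts rE; exists r => //.
exists (size pre + index t s * n.+1) => [|i].
  by apply/mapP; exists (index t s) => //; rewrite mem_iota add0n index_mem.
by rewrite rE rowE ?index_mem // nth_index.
Qed.

End Encoding.

Lemma nth_encode_len n i w : i <= n -> nth false (encode_len n ++ w) i = (i < n).
Proof.
move=> il; rewrite nth_cat size_rcons size_nseq ltnS il nth_rcons size_nseq nth_nseq.
by case: ltnP => // ni; rewrite if_same.
Qed.

Lemma size_encode_len n : size (encode_len n) = n.+1.
Proof. by rewrite size_rcons size_nseq. Qed.

(** * Lexicographic enumeration *)

Section Lexicographic.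

Variables (n : nat) (P : pred word).
Hypothesis P_step : forall p, size p < n -> P p = P (rcons p false) || P (rcons p true).

(** Exploring the bit 0 first makes the order lexicographic. *)
Fixpoint sols (m : nat) (p : word) : seq word :=
  if m is m'.+1 then sols m' (rcons p false) ++ sols m' (rcons p true)
  else if P p then [:: p] else [::].

(* The solutions that follow all the extensions of the first [l] bits of [y] *)
Fixpoint later (y : nat -> bool) (l : nat) : seq word :=
  if l is l'.+1 then
    (if y l' then [::] else sols (n - l) (rcons (mkseq y l') true)) ++ later y l'
  else [::].

Lemma sols_nil m p : size p + m = n -> ~~ P p -> sols m p = [::].
Proof.
elim: m p => [|m IH] p /= pm np; first by rewrite (negPf np).
move: np; rewrite P_step; last lia.
have e b : size (rcons p b) + m = n by rewrite size_rcons; lia.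
by rewrite negb_or => /andP[n0 n1]; rewrite !IH.
Qed.

Lemma mem_sols m p y : (y \in sols m p) = [&& P y, size y == size p + m & take (size p) y == p].
Proof.
elim: m p => [|m IH] p /=.
  rewrite addn0; case Pp: (P p); rewrite ?inE; last first.
    apply/esym/negbTE/and3P => -[Py /eqP sy /eqP e]; move: e.
    by rewrite take_oversize ?sy // => e; rewrite -e Py in Pp.
  apply/eqP/and3P => [->|[_ /eqP sy /eqP]]; first by rewrite Pp eqxx take_size.
  by rewrite take_oversize ?sy.
rewrite mem_cat !IH !size_rcons !addSnnS; case: (P y) => //=.
case: (altP (size y =P size p + m.+1)) => //= sy; have sy' : size p < size y by rewrite sy addnS ltnS leq_addr.
rewrite (take_nth false sy') !eqseq_rcons.
by case: (take _ _ == p); case: (nth _ _ _).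
Qed.

Lemma sols_uniq m p : uniq (sols m p).
Proof.
elim: m p => [|m IH] p /=; first by case: ifP.
rewrite cat_uniq !IH andbT /=; apply/hasPn => y; rewrite !mem_sols !size_rcons.
case/and3P=> _ /eqP sy /eqP e; rewrite negb_and; apply/orP; right.
rewrite negb_and; apply/orP; right; rewrite e eqseq_rcons eqxx.
by [].
Qed.

Lemma eq_later y y' l : (forall i, i < l -> y i = y' i) -> later y l = later y' l.
Proof.
elim: l => //= l IH e; rewrite e // IH => [|i il]; last by rewrite e // ltnW.
suff -> : mkseq y l = mkseq y' l by [].
by apply/eq_in_map => i; rewrite mem_iota add0n => /andP[_ il]; rewrite e // ltnW.
Qed.

(* The solutions that remain when the first [l] bits are [y] *)
Definition remaining (y : nat -> bool) (l : nat) : seq word :=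
  sols (n - l) (mkseq y l) ++ later y l.

Lemma eq_remaining y y' l : (forall i, i < l -> y i = y' i) -> remaining y l = remaining y' l.
Proof.
move=> e; rewrite /remaining (eq_later e); congr (sols _ _ ++ _).
by apply/eq_in_map => i; rewrite mem_iota add0n => /andP[_ il]; rewrite e.
Qed.

(** Only the filing changes: the solutions with bit 1 at [l] pass from the first part of the list to
    [later]. *)
Lemma remaining_false (y : nat -> bool) l : l < n -> ~~ y l -> remaining y l = remaining y l.+1.
Proof.
move=> ln yl; rewrite /remaining /= (negPf yl) mkseqS (negPf yl) catA.
by rewrite -(subnSK ln).
Qed.

Lemma remaining_true (y : nat -> bool) l : l < n -> y l -> ~~ P (rcons (mkseq y l) false) ->
  remaining y l = remaining y l.+1.
Proof.
move=> ln yl nP; rewrite /remaining /= yl mkseqS yl -(subnSK ln) /=.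
by rewrite (sols_nil _ nP) // size_rcons size_mkseq; lia.
Qed.

Lemma remaining_full (y : nat -> bool) : P (mkseq y n) -> remaining y n = mkseq y n :: later y n.
Proof. by move=> Py; rewrite /remaining subnn /= Py. Qed.

Lemma later_next (y y' : nat -> bool) l : ~~ y l -> y' l ->
  (forall i, i < l -> y' i = y i) -> later y l.+1 = remaining y' l.+1.
Proof.
move=> yl yl' e; rewrite /remaining mkseqS /= (negPf yl) yl' /= (eq_later e).
congr (sols _ (rcons _ _) ++ _).
by apply/eq_in_map => i; rewrite mem_iota add0n => /andP[_ il]; rewrite e.
Qed.

Lemma later_skip (y : nat -> bool) l : l < n ->
  y l || ~~ P (rcons (mkseq y l) true) -> later y l.+1 = later y l.
Proof.
move=> ln h; rewrite /=; case yl: (y l) h => //= np.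
by rewrite sols_nil // size_rcons size_mkseq; lia.
Qed.

End Lexicographic.

Definition prefix_of_member F w n start m : pred word :=
  fun p => holds (member F w n start m (size p) (nth false p)).

Lemma member_ext F w n start m len y y' : (forall i, i < len -> y i = y' i) ->
  member F w n start m len y -> member F w n start m len y'.
Proof. by move=> e; apply: clo_ext => i; rewrite e. Qed.

Lemma member_mkseq F w n start m len y :
  member F w n start m len y <-> prefix_of_member F w n start m (mkseq y len).
Proof.
rewrite /prefix_of_member size_mkseq.
by split=> [h|/holdsP]; [apply/holdsP; move: h|];
  apply: member_ext => i il; rewrite nth_mkseq.
Qed.

(** A last bit can always be dropped ([clo_sub]), and a derivation of the prefix lifts to one more
    coordinate ([clo_lift]), whose value is the bit to append. *)
Lemma prefix_of_member_step F w n start m p :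
  prefix_of_member F w n start m p =
  prefix_of_member F w n start m (rcons p false) ||
  prefix_of_member F w n start m (rcons p true).
Proof.
have up c : member F w n start m (size (rcons p c)) (nth false (rcons p c)) ->
    member F w n start m (size p) (nth false p).
  rewrite size_rcons => h; pose e (i : 'I_(size p)) := widen_ord (leqnSn _) i.
  apply: (@clo_ext _ _ _ ((fun i : 'I_(size p).+1 => nth false (rcons p c) i) \o e)).
    by move=> i; rewrite /= nth_rcons ltn_ord.
  by apply: clo_sub h => r [a ra rE]; apply: clo_mem; exists a => // i; rewrite /= rE.
apply/holdsP/orP => [h|[/holdsP|/holdsP]]; [|exact: up|exact: up].
pose e (i : 'I_(size p)) := widen_ord (leqnSn _) i.
have [v cv vE] : exists2 v, clo F (@rowset (size p).+1 (rows n start m) (row_bit w)) v &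
    (fun i : 'I_(size p) => nth false p i) =1 v \o e.
  apply: clo_lift; apply: clo_eq_gen h => r [a ra rE]; exists r => //.
  by exists (fun i => row_bit w a i); [exists a | move=> i; rewrite rE].
suff h' : prefix_of_member F w n start m (rcons p (v ord_max)).
  by case: (v ord_max) h'; [right | left].
apply/holdsP; rewrite size_rcons; apply: clo_ext cv => i; rewrite nth_rcons.
case: (ltngtP i (size p)) => [ip|ip|ip].
- by have /= -> := vE (Ordinal ip); congr v; apply: val_inj.
- by have := ltn_ord i; rewrite ltnS leqNgt ip.
- by congr v; apply: val_inj.
Qed.

(** * Reading the input, and the decision procedure *)

Definition setup_code (Y r : nat) : com :=
  Do (Const 3 1) ;; Do (Length 7) ;; Do (Const 9 Y) ;;
  For 12 2 3 7 (IfNZ 11 nop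
    (Do (Read 13 12) ;; IfNZ 13 (Do (Add 8 8 3)) (Do (Const 11 1)))) ;;
  Do (Add 6 8 3) ;; Do (Add 5 6 r).

Definition start_state : state := State (fun=> 0) [::] [::].

(** The unary length ends at the first 0, recorded in register 11; the loop cannot be left early and
    scans all of [w]. Choosing 8 for [r] adds [n] to [start], to skip the target vector of a
    membership instance; register 2 adds nothing. *)
Lemma setup_ok w B Y n r start w' : Y + 4 * size w + 100 <= B ->
  w = encode_len n ++ w' -> start = n.+1 + (if r == 8 then n else 0) ->
  r \in [:: 2; 8] -> start <= size w ->
  ok w B (setup_code Y r) (size w * 10 + 8) start_state (fun s =>
    [/\ layout w n start Y (rg s 4) s, bf s = [::] & em s = [::]]).
Proof.
move=> YB wE stE hr sw.
have nw : n < size w by rewrite wE size_cat size_encode_len; lia.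
pose X q := (q == 1) || (q == 8) || (10 <= q).
pose J x s := (rg s 11 != 0) = (n < x) /\ rg s 8 = minn x n.
rewrite (_ : _ + 8 = (size w * (6 + 4) + 3 + 2).+3); last lia.
apply: ok_do_seq => //=; first lia.
apply: ok_do_seq => //=; first lia.
apply: ok_do_seq => //=; first lia.
set s1 := setr _ _ _.
apply: ok_seq; apply: (@ok_weaken _ _ _ _ _ _ (fun s => quiet X s1 s /\ J (size w) s)).
- apply: (@ok_for _ _ _ _ _ _ _ _ _ 0 1 (size w) 6) => //.
  + by move=> j; lia.
  + by lia.
  + by lia.
  + move=> k s q v; rewrite !inE /J => /orP[] /eqP -> //.
  + by rewrite /J min0n.
  move=> x s xw qs x' [J11 J8]; rewrite add0n muln1 in x'.
  have e3 : rg s 3 = 1 by case: qs => h _ _; rewrite h.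
  apply: (@ok_if _ _ _ _ _ 4); case: eqP J11 => r0 /= /esym J11.
    apply: ok_do_seq => //=; first lia.
    have xn : x <= n by lia.
    apply: (@ok_if _ _ _ _ _ 1).
    rewrite /= x' wE nth_encode_len //; case: ltnP => xn' /=; apply: ok_do => //=.
    * by rewrite J8 e3; lia.
    * split=> //; first by split=> // q; rewrite /X /= => hq; decide_regs; by [].
      by split=> /=; rewrite ?r0 ?J8 ?e3; lia.
    * lia.
    * split=> //; first by split=> // q; rewrite /X /= => hq; decide_regs; by [].
      by split=> /=; rewrite ?r0 ?J8 ?e3; lia.
  apply: ok_do => //=; split=> //.
    by split=> // q; rewrite /X /= => hq; decide_regs; by [].
  by split=> /=; rewrite ?J8; lia.
- by [].
move=> s _ [[h b e] [J11 J8]].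
have e8 : rg s 8 = n by rewrite J8; lia.
have s3 : rg s 3 = 1 by rewrite h.
have s2 : rg s 2 = 0 by rewrite h.
have s7 : rg s 7 = size w by rewrite h.
have s9 : rg s 9 = Y by rewrite h.
apply: ok_do_seq => //=; first by rewrite e8 s3; lia.
move: stE; rewrite !inE in hr; case/orP: hr => /eqP -> /= stE; apply: ok_do => //=;
  rewrite ?e8 ?s2 ?s3; try lia.
- by split=> //; split; split=> //=; rewrite ?e8 ?s2 ?s3 ?s7 ?s9 //; lia.
- by split=> //; split; split=> //=; rewrite ?e8 ?s2 ?s3 ?s7 ?s9 //; lia.
Qed.

Definition copy_code : com :=
  For 12 2 3 8 (Do (Add 13 12 6) ;; Do (Read 14 13) ;; Do (Add 15 9 12) ;;
                Do (StoreAt 15 14)).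

Lemma copy_ok w B Y n start s : Y + 4 * size w + 100 <= B -> n <= size w -> 40 <= Y ->
  layout w n start Y (rg s 4) s ->
  ok w B copy_code (size w * 8 + 3) s (fun s' => layout w n start Y (rg s' 4) s' /\
    forall i, i < n -> target Y s' i = nth false w (n.+1 + i)).
Proof.
move=> YB nw Y40 ls; have [[r2 r3 r4 r5] [r6 r7 r8 r9]] := ls.
pose X q := (q == 1) || (10 <= q).
pose J k s' := forall i, i < k -> target Y s' i = nth false w (n.+1 + i).
apply: (@ok_weaken _ _ _ (n * (4 + 4) + 3) _ _ (fun s' => quiet X s s' /\ J n s')).
- apply: (@ok_for _ _ _ _ _ _ _ _ _ 0 1 n 4) => //.
  + by move=> j; lia.
  + by lia.
  + by lia.
  + move=> k s' q v; rewrite !inE /J => hq Js' i ik; rewrite -Js' // /target rg_setr.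
    by case/orP: hq => /eqP ->; decide_regs.
  move=> k s' kn qs' x' Js'; rewrite add0n muln1 in x'.
  have h r : r < 10 -> r != 1 -> rg s' r = rg s r.
    by move=> r10 r1; case: qs' => h _ _; rewrite h // /X; lia.
  apply: ok_do_seq => //=; first by rewrite (h 6) // r6 x'; lia.
  apply: ok_do_seq => //=; first by lia.
  apply: ok_do_seq => //=; first by rewrite (h 9) // r9 x'; lia.
  apply: ok_do => //=; rewrite (h 6) // (h 9) // r6 r9 x'; split.
  + by split=> // q; rewrite /X /= => hq; decide_regs; by [].
  + by decide_regs.
  move=> i; rewrite ltnS leq_eqVlt /target /= => /orP[/eqP ->|ik].
    by rewrite eqxx addnC; case: (nth _ _ _).
  by decide_regs; exact: Js'.
- by rewrite leq_add2r leq_mul2r; lia.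
move=> s' _ [[h _ _] Js']; split=> //.
by split; split=> //; rewrite h.
Qed.

Lemma embedded_self c : embedded (compile 0 c) 0 (compile 0 c).
Proof. by []. Qed.

Theorem membership_polynomial F : polynomial_time (Membership F).
Proof.
have [Y [c [T [Y40 [pT hT] test]]]] := exists_tester F.
pose code := setup_code Y 8 ;; copy_code ;; Do (Add 4 8 2) ;; c.
pose time N := N * 10 + 8 + (N * 8 + 3 + (T N + 1)).
have [p hp] : poly_bounded time.
  by rewrite /time; have h : poly_bounded T := ex_intro _ pT hT; poly_bound.
exists (compile 0 code), p => -[n S v] _ [s [us sS] ->] /=.
set w := _ ++ _ ++ _; pose B := Y + 4 * size w + 100.
pose pre := encode_len n ++ tval v.
have preE : size pre = n.+1 + n by rewrite size_cat size_encode_len size_tuple.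
have wE : w = pre ++ encode_vectors s by rewrite /pre -catA.
have np : n < size pre by rewrite preE; lia.
have shape := encoding_shape s np; rewrite -wE in shape.
have sw : n.+1 + n <= size w by rewrite wE size_cat preE; lia.
have : ok w B code (time (size w)) start_state (fun s' => rg s' 0 != 0 <-> v \in Cl F S).
  apply: ok_seq; apply: ok_weaken (setup_ok (start := n.+1 + n) (leqnn B) erefl _ _ _)
    (leqnn _) _ => // s1 _ [ls1 _ _].
  have nw : n <= size w by lia.
  apply: ok_seq; apply: ok_weaken (copy_ok (leqnn B) nw Y40 ls1) (leqnn _) _.
  move=> s2 b2 [ls2 y2]; have [[r2 r3 _ r5] [r6 r7 r8 r9]] := ls2.
  rewrite addn1; apply: ok_do_seq => //=; first by rewrite r2 addn0; exact: b2.
  set s3 := setr _ _ _.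
  have ls3 : layout w n (size pre) Y n s3.
    by rewrite preE; split; split=> //=; rewrite r8 r2 addn0.
  apply: ok_weaken (test _ _ _ _ _ _ _ (leqnn B) (leqnn n) shape ls3) (leqnn _) _.
  move=> s4 _ [_ e]; apply: iff_trans e _.
  have := @member_encoding n s pre F S (target Y s3) sS; rewrite -wE => e.
  apply: iff_trans e _; suff -> : [tuple target Y s3 i | i < n] = v by [].
  apply: eq_from_tnth => i; rewrite tnth_mktuple.
  have -> : target Y s3 i = target Y s2 i by rewrite /target /=; decide_regs.
  rewrite y2 // /w nth_cat size_encode_len ltnNge leq_addr /= addKn.
  by rewrite nth_cat size_tuple ltn_ord (tnth_nth false).
case/(_ _ _ (@embedded_self code)) => [r //|k [s' [kT [run_k _] e]]].
exists k; rewrite /run (_ : init = at_pc 0 start_state) // run_k.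
split=> //; first exact: leq_trans kT (hp _).
(* The final position is past the end of the code, where [Halt] is read by default. *)
by rewrite /halted /fetch /= add0n nth_default // size_compile.
Qed.

(** * Polynomial delay *)

(** Register 10 counts the bits already fixed, register 4 is the length tested. If the bit 0 fails,
    the bit 1 must succeed because the prefix before it extends, so a single test per position
    suffices. *)
Definition greedy_code (c : com) : com :=
  For 12 10 3 8 (Do (Add 13 9 12) ;; Do (StoreAt 13 2) ;; Do (Add 4 12 3) ;; c ;;
    IfNZ 0 nop (Do (Add 13 9 12) ;; Do (StoreAt 13 3))).

Definition write_code : com :=
  For 12 2 3 8 (Do (Add 13 9 12) ;; Do (LoadAt 14 13) ;; Do (Write 14)).

(** Register 11 marks success, after which the remaining iterations idle. The final increment of
    register 10 makes the new 1 part of the fixed prefix. *)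
Definition search_code (c : com) : com :=
  Do (Const 11 0) ;; Do (Add 10 8 2) ;;
  For 12 2 3 8 (IfNZ 11 nop
    (Do (Defs.Sub 10 10 3) ;; Do (Add 13 9 10) ;; Do (LoadAt 14 13) ;;
     IfNZ 14 nop
       (Do (StoreAt 13 3) ;; Do (Add 4 10 3) ;; c ;;
        IfNZ 0 (Do (Const 11 1) ;; Do (Add 10 10 3)) nop))).

Definition body_code (c : com) : com :=
  greedy_code c ;; write_code ;; Do Emit ;; search_code c.

(** Testing the empty prefix tells whether the closure is empty. From then on register 11 says
    whether a solution remains, and register 10 how many of its bits are fixed. *)
Definition prelude_code (Y : nat) (c : com) : com :=
  setup_code Y 2 ;; Do (Const 4 0) ;; c ;; Do (Add 11 0 2) ;; Do (Const 10 0).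

Lemma eq_mkseq_lt (y y' : nat -> bool) l :
  (forall i, i < l -> y i = y' i) -> mkseq y l = mkseq y' l.
Proof.
by move=> e; apply/eq_in_map => i; rewrite mem_iota add0n => /andP[_ il]; rewrite e.
Qed.

Section Delay.

Variables (F : seq (operation bool)) (Y : nat) (c : com) (T : nat -> nat).
Hypotheses (Y40 : 40 <= Y) (test : tester F Y c T).
Variables (w : word) (n start m B : nat).
Hypotheses (YB : Y + 4 * size w + 100 <= B) (shape : input_shape w n start m).

Local Notation ok := (ok w B).
Local Notation P := (prefix_of_member F w n start m).
Local Notation sols := (sols P).
Local Notation later := (later n P).
Local Notation remaining := (remaining n P).

Definition lay (s : state) : Prop := layout w n start Y (rg s 4) s.

(* All the registers but those fixed by the layout *)
Definition variable_regs : pred nat := fun r => r \notin [:: 2; 3; 5; 6; 7; 8; 9].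

Lemma lay_quiet s s' : lay s -> same_off variable_regs s s' -> lay s'.
Proof.
move=> [[r2 r3 r4 r5] [r6 r7 r8 r9]] h.
have hv r : r \in [:: 2; 3; 5; 6; 7; 8; 9] -> rg s' r = rg s r.
  by move=> hr; apply: h; rewrite /variable_regs negbK.
by split; split=> //; rewrite hv.
Qed.

Lemma variable_private : subpred (private Y n) variable_regs.
Proof. by move=> r; rewrite /private /variable_regs !inE; lia. Qed.

Lemma member_step_lt p : size p < n -> P p = P (rcons p false) || P (rcons p true).
Proof. by move=> _; exact: prefix_of_member_step. Qed.

Lemma n_lt_w : n < size w.
Proof. by case: shape => ns -> _; lia. Qed.

Lemma target_setr s r v i : target Y (setr s r v) i =
  if Y + i == r then v != 0 else target Y s i.
Proof. by rewrite /target rg_setr; case: (_ == r). Qed.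

Lemma target_set s i v j : target Y (setr s (Y + i) v) j =
  if j == i then v != 0 else target Y s j.
Proof. by rewrite target_setr eqn_add2l. Qed.

Lemma target_low s r v i : r < 40 -> target Y (setr s r v) i = target Y s i.
Proof.
by move=> r40; rewrite target_setr; have -> : (Y + i == r) = false by lia.
Qed.

Lemma target_private s s' i : quiet (private Y n) s s' -> i < n ->
  target Y s' i = target Y s i.
Proof. by move=> [h _ _] il; rewrite /target h // /private; lia. Qed.

Lemma test_ok s len : lay s -> rg s 4 = len -> len <= n ->
  ok c (T (size w)) s (fun s' => quiet (private Y n) s s' /\
    (rg s' 0 != 0) = P (mkseq (target Y s) len)).
Proof.
move=> ls <- ln; apply: ok_weaken (test YB ln shape ls) (leqnn _) _ => s' _ [q e].
split=> //; apply/idP/idP; first by move/e/member_mkseq.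
by move/member_mkseq/e.
Qed.

Lemma greedy_ok s : lay s -> rg s 10 <= n -> P (mkseq (target Y s) (rg s 10)) ->
  ok (greedy_code c) (size w * (T (size w) + 11) + 3) s (fun s' =>
    [/\ quiet variable_regs s s', P (mkseq (target Y s') n) &
        remaining (target Y s') n = remaining (target Y s) (rg s 10)]).
Proof.
move=> ls ln Pl; have [[r2 r3 r4 r5] [r6 r7 r8 r9]] := ls; have nw := n_lt_w.
move El: (rg s 10) ln Pl => l ln Pl.
pose J k s' := remaining (target Y s') (l + k) = remaining (target Y s) l /\
  P (mkseq (target Y s') (l + k)).
apply: (@ok_weaken _ _ _ ((n - l) * (T (size w) + 7 + 4) + 3) _ _
  (fun s' => quiet variable_regs s s' /\ J (n - l) s')).
- apply: (@ok_for _ _ _ _ _ _ _ _ _ l 1 n (T (size w) + 7)) => //.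
  + by move=> j; lia.
  + by lia.
  + by lia.
  + move=> k s' q v; rewrite !inE /J => hq [e Pk].
    have te i : target Y (setr s' q v) i = target Y s' i.
      by rewrite target_low //; case/orP: hq => /eqP ->.
    by rewrite (@eq_remaining n P _ (target Y s') _) // (@eq_mkseq_lt _ (target Y s') _).
  + by rewrite /J addn0.
  move=> k s1 kn q1 x1 [e1 P1]; rewrite muln1 in x1; set i := l + k in x1 e1 P1.
  have il : i < n by rewrite /i; lia.
  have ls1 : lay s1 by case: q1 => h _ _; exact: lay_quiet ls h.
  have [[f2 f3 f4 f5] [f6 f7 f8 f9]] := ls1.
  rewrite (_ : _ + 7 = (T (size w) + 4).+3); last lia.
  apply: ok_do_seq => //=; first by rewrite f9 x1; lia.
  apply: ok_do_seq => //=; rewrite f9 x1 f2.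
  apply: ok_do_seq => //=; first by decide_regs; rewrite x1 f3; lia.
  decide_regs; rewrite x1 f3; set s2 := setr _ 4 _.
  have q2 : quiet variable_regs s1 s2.
    split=> // r; rewrite /variable_regs negbK !inE /= => hr; decide_regs; by [].
  have ls2 : lay s2 by case: q2 => h _ _; exact: lay_quiet ls1 h.
  have t2 j : target Y s2 j = if j == i then false else target Y s1 j.
    by rewrite target_low // target_set target_low.
  have s2_12 : rg s2 12 = i by rewrite /=; decide_regs; rewrite x1.
  have s2_4 : rg s2 4 = i.+1 by rewrite /= addn1.
  move: s2 q2 ls2 t2 s2_12 s2_4 => s2 q2 ls2 t2 s2_12 s2_4.
  apply: ok_seq; apply: ok_weaken (test_ok ls2 s2_4 il) (leqnn _) _ => s3 _ [q3 p3].
  have q13 : quiet variable_regs s1 s3.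
    by apply: quiet_trans q2 (quiet_sub variable_private q3).
  have t3 j : j < n -> target Y s3 j = if j == i then false else target Y s1 j.
    by move=> jn; rewrite (target_private q3).
  have s3_12 : rg s3 12 = rg s1 12.
    by case: q3 => h _ _; rewrite h ?s2_12 ?x1 // /private; lia.
  have t3i j : j < i -> target Y s3 j = target Y s1 j.
    by move=> ji; rewrite t3 ?(ltn_eqF ji) //; lia.
  have p3' : P (mkseq (target Y s2) i.+1) = P (rcons (mkseq (target Y s1) i) false).
    rewrite mkseqS t2 eqxx (@eq_mkseq_lt _ (target Y s1) _) // => j ji.
    by rewrite t2 (ltn_eqF ji).
  apply: (@ok_if _ _ _ _ _ 2); case: eqP p3 => r0 /= p3.
    have ls3 : lay s3 by case: q13 => h _ _; exact: lay_quiet ls1 h.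
    have [[g2 g3 g4 g5] [g6 g7 g8 g9]] := ls3.
    apply: ok_do_seq => //=; first by rewrite g9 s3_12 x1; lia.
    apply: ok_do => //=; rewrite g9 g3 s3_12 x1.
    set s4 := setr _ _ _; split.
    * apply: quiet_trans q13 _; split=> // r; rewrite /variable_regs negbK !inE /= => hr.
      by decide_regs.
    * by rewrite /=; decide_regs.
    have t4 j : j < n -> target Y s4 j = if j == i then true else target Y s1 j.
      by move=> jn; rewrite target_set target_low // t3 //; case: eqP.
    have t4i j : j < i -> target Y s4 j = target Y s1 j.
      by move=> ji; rewrite t4 ?(ltn_eqF ji) //; lia.
    have y4 : target Y s4 i by rewrite t4 // eqxx.
    rewrite /J addnS -/i; split.
      rewrite -remaining_true //.
      - by rewrite -e1; apply: eq_remaining.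
      - exact: member_step_lt.
      by rewrite (@eq_mkseq_lt _ _ _ t4i) -p3' -p3.
    rewrite mkseqS y4 (@eq_mkseq_lt _ _ _ t4i); move: P1; rewrite prefix_of_member_step.
    by rewrite -p3' -p3.
  apply: ok_do => //=; split.
  - by apply: quiet_trans q13 _; exact: quiet_setr.
  - by rewrite s3_12 x1.
  have te j : target Y (setr s3 1 0) j = target Y s3 j by rewrite target_low.
  rewrite /J addnS -/i (@eq_remaining n P _ (target Y s3) _) // (@eq_mkseq_lt _ (target Y s3) _) //.
  have y3 : target Y s3 i = false by rewrite t3 // eqxx.
  split.
    by rewrite -remaining_false ?y3 // -e1; apply: eq_remaining.
  by rewrite mkseqS y3 (eq_mkseq_lt t3i) -p3' -p3.
- by rewrite leq_add2r -addnA leq_mul2r; lia.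
move=> s' _ [q' [e' P']]; rewrite subnKC // in e' P'.
Qed.

Lemma write_ok s : lay s -> bf s = [::] ->
  ok write_code (size w * 7 + 3) s (fun s' =>
    [/\ same_off variable_regs s s', bf s' = mkseq (target Y s) n, em s' = em s &
        target Y s' =1 target Y s]).
Proof.
move=> ls b0; have [[r2 r3 r4 r5] [r6 r7 r8 r9]] := ls; have nw := n_lt_w.
pose X r := (r == 1) || (10 <= r < 20).
pose J k s' := bf s' = mkseq (target Y s) k /\ em s' = em s.
apply: (@ok_weaken _ _ _ (n * (3 + 4) + 3) _ _ (fun s' => same_off X s s' /\ J n s')).
(* [ok_for] would demand an unchanged buffer, hence the more general rule. *)
- apply: (@ok_for_gen _ _ _ _ _ _ _ _ _ 0 1 n 3) => //.
  + by move=> j; lia.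
  + by lia.
  + by lia.
  move=> k s1 kn q1 x1 [b1 e1]; rewrite add0n muln1 in x1.
  have f9 : rg s1 9 = Y by rewrite q1.
  apply: ok_do_seq => //=; first by rewrite f9 x1; lia.
  apply: ok_do_seq => //=; apply: ok_do => //=.
  rewrite f9 x1; decide_regs; split.
  + by move=> r; rewrite /X /= => hr; decide_regs.
  + by decide_regs.
  by rewrite /J /= mkseqS -b1 /target q1 // /X; lia.
- by rewrite leq_add2r leq_mul2r; lia.
move=> s' _ [h [b e]]; split=> //.
- apply: same_off_sub h => r; rewrite /X /variable_regs !inE; lia.
by move=> i; rewrite /target h // /X; lia.
Qed.

Definition search_result (s s' : state) : Prop :=
  rg s' 11 = 0 /\ later (target Y s) n = [::] \/
  [/\ rg s' 11 != 0, rg s' 10 <= n, P (mkseq (target Y s') (rg s' 10)) &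
      later (target Y s) n = remaining (target Y s') (rg s' 10)].

Lemma search_ok s : lay s ->
  ok (search_code c) (size w * (T (size w) + 17) + 5) s (fun s' =>
    quiet variable_regs s s' /\ search_result s s').
Proof.
move=> ls; have [[r2 r3 r4 r5] [r6 r7 r8 r9]] := ls; have nw := n_lt_w.
(* While the search fails, no position from [n - k] on can be raised, so the later solutions all
   branch off below [n - k]; after success the result is kept. *)
pose J k s' := [/\ rg s' 11 = 0, rg s' 10 = n - k &
    later (target Y s) n = later (target Y s') (n - k)] \/
  [/\ rg s' 11 != 0, rg s' 10 <= n, P (mkseq (target Y s') (rg s' 10)) &
      later (target Y s) n = remaining (target Y s') (rg s' 10)].
rewrite !addnS; apply: ok_do_seq => //=; apply: ok_do_seq => //=.
  by rewrite r8 r2; lia.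
rewrite r8 r2 !addn0; set s0 := setr _ _ _.
have q0 : quiet variable_regs s s0.
  split=> // r; rewrite /variable_regs negbK !inE /= => hr; decide_regs; by [].
apply: (@ok_weaken _ _ _ (n * (T (size w) + 13 + 4) + 3) _ _
  (fun s' => quiet variable_regs s0 s' /\ J n s')).
- apply: (@ok_for _ _ _ _ _ _ _ _ _ 0 1 n (T (size w) + 13)) => //.
  + by move=> j; lia.
  + by lia.
  + by lia.
  + move=> k s' q v; rewrite !inE /J => hq.
    have te i : target Y (setr s' q v) i = target Y s' i.
      by rewrite target_low //; case/orP: hq => /eqP ->.
    have e11 : rg (setr s' q v) 11 = rg s' 11 by rewrite rg_setr; case/orP: hq => /eqP ->.
    have e10 : rg (setr s' q v) 10 = rg s' 10 by rewrite rg_setr; case/orP: hq => /eqP ->.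
    case=> [[h11 h10 hl]|[h11 h10 hP hl]]; [left | right]; rewrite ?e11 ?e10; split=> //.
    * by rewrite hl; apply: eq_later => i _; rewrite te.
    * by rewrite (@eq_mkseq_lt _ (target Y s') _).
    * by rewrite hl; apply: eq_remaining => i _; rewrite te.
  + left; split; [by [] | by rewrite subn0 | rewrite subn0].
    by apply: eq_later => i _; rewrite !target_low.
  move=> k s1 kn q1 x1 J1.
  have ls1 : lay s1 by case: q1 => h _ _; apply: lay_quiet h; case: q0 => h' _ _; exact: lay_quiet ls h'.
  have [[f2 f3 f4 f5] [f6 f7 f8 f9]] := ls1.
  rewrite (_ : _ + 13 = (T (size w) + 11) + 2); last lia.
  apply: ok_if; case: eqP => r11; last first.
    apply: ok_do => //=; first lia.
    split; [exact: quiet_setr | by [] |].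
    have te i : target Y (setr s1 1 0) i = target Y s1 i by rewrite target_low.
    case: J1 => [[/r11 //]|[h11 h10 hP hl]].
    right; split=> //; first by rewrite (@eq_mkseq_lt _ (target Y s1) _).
    by rewrite hl; apply: eq_remaining => i _; rewrite te.
  case: J1 => [[_ r10 hl]|[]]; last by rewrite r11.
  have [l [ln nkE nkE']] : exists l, [/\ l < n, n - k = l.+1 & n - k.+1 = l].
    by exists (n - k.+1); split; lia.
  rewrite nkE in r10 hl.
  rewrite (_ : _ + 11 = (T (size w) + 6 + 2).+3); last lia.
  apply: ok_do_seq => //=; apply: ok_do_seq => //=; first by rewrite f9 r10 f3; lia.
  apply: ok_do_seq => //=; rewrite f9 r10 f3 subSS subn0; set s2 := setr _ 14 _.
  have q2 : quiet variable_regs s1 s2.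
    split=> // r; rewrite /variable_regs negbK !inE /= => hr; decide_regs; by [].
  have ls2 : lay s2 by case: q2 => h _ _; exact: lay_quiet ls1 h.
  have t2 j : target Y s2 j = target Y s1 j by rewrite !target_low.
  have y2 : (rg s2 14 != 0) = target Y s1 l.
    by rewrite /= /target; decide_regs.
  have s2_10 : rg s2 10 = l by [].
  have s2_13 : rg s2 13 = Y + l by [].
  have s2_11 : rg s2 11 = 0 by exact: r11.
  have s2_12 : rg s2 12 = rg s1 12 by [].
  move: s2 q2 ls2 t2 y2 s2_10 s2_13 s2_11 s2_12 => s2 q2 ls2 t2 y2 s2_10 s2_13 s2_11 s2_12.
  apply: ok_if; case: eqP y2 => r14 /= /esym y2; last first.
    apply: ok_do => //=; first lia.
    split; [by apply: quiet_trans q2 _; exact: quiet_setr | by [] |].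
    left; rewrite /= nkE'; split=> //; rewrite hl (later_skip (P := P)) ?y2 //.
      by apply: eq_later => i _; rewrite target_low.
    exact: member_step_lt.
  have [[g2 g3 g4 g5] [g6 g7 g8 g9]] := ls2.
  rewrite (_ : _ + 6 = (T (size w) + 4).+2); last lia.
  apply: ok_do_seq => //=; rewrite s2_13 g3.
  apply: ok_do_seq => //=; first by decide_regs; rewrite s2_10 g3; lia.
  decide_regs; rewrite s2_10 g3; set s3 := setr _ 4 _.
  have q3 : quiet variable_regs s2 s3.
    split=> // r; rewrite /variable_regs negbK !inE /= => hr; decide_regs; by [].
  have ls3 : lay s3 by case: q3 => h _ _; exact: lay_quiet ls2 h.
  have t3 j : target Y s3 j = if j == l then true else target Y s1 j.
    by rewrite target_low // target_set t2.
  have s3E r : r < 40 -> r != 4 -> rg s3 r = rg s2 r.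
    by move=> r40 r4'; rewrite /=; decide_regs.
  have s3_4 : rg s3 4 = l.+1 by rewrite /= addn1.
  move: s3 q3 ls3 t3 s3E s3_4 => s3 q3 ls3 t3 s3E s3_4.
  apply: ok_seq; apply: ok_weaken (test_ok ls3 s3_4 ln) (leqnn _) _ => s4 _ [q4 p4].
  have q14 : quiet variable_regs s1 s4.
    by apply: quiet_trans q2 (quiet_trans q3 (quiet_sub variable_private q4)).
  have s4E r : 2 <= r < 20 -> r != 4 -> rg s4 r = rg s2 r.
    by move=> hr r4'; case: q4 => h _ _; rewrite h ?s3E // /private; lia.
  have t4 j : j < n -> target Y s4 j = if j == l then true else target Y s1 j.
    by move=> jn; rewrite (target_private q4).
  have t4l j : j < l -> target Y s4 j = target Y s1 j.
    by move=> jl; rewrite t4 ?(ltn_eqF jl) //; lia.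
  have t4' j : j < l.+1 -> target Y s3 j = target Y s4 j.
    by move=> jl; rewrite t4 ?t3 //; lia.
  have y4 : target Y s4 l by rewrite t4 // eqxx.
  have p4' : P (mkseq (target Y s3) l.+1) = P (rcons (mkseq (target Y s1) l) true).
    rewrite mkseqS t3 eqxx (@eq_mkseq_lt _ (target Y s1) _) // => j jl.
    by rewrite t3 (ltn_eqF jl).
  apply: (@ok_if _ _ _ _ _ 2); case: eqP p4 => r0 /= p4.
    apply: ok_do => //=; split.
    - by apply: quiet_trans q14 _; exact: quiet_setr.
    - by rewrite s4E.
    (* The failed 1 stays at position [l]; [later] looks only at the bits below. *)
    have te j : j < l -> target Y (setr s4 1 0) j = target Y s1 j.
      by move=> jl; rewrite target_low // t4l.
    left; rewrite /= nkE' !s4E //; split=> //.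
    rewrite (@eq_later n P _ _ _ te) hl (later_skip (P := P)) //; first exact: member_step_lt.
    by rewrite -p4' -p4 orbT.
  apply: ok_do_seq => //=; first lia.
  have s4_10 : rg s4 10 = l by rewrite s4E.
  have s4_3 : rg s4 3 = 1 by rewrite s4E.
  apply: ok_do => //=; first by rewrite s4_10 s4_3; lia.
  rewrite s4_10 s4_3 addn1; set s5 := setr _ _ _; split.
  - apply: quiet_trans q14 _; split=> // r; rewrite /variable_regs negbK !inE /= => hr.
    by decide_regs.
  - by rewrite /= s4E.
  have te j : target Y s5 j = target Y s4 j by rewrite !target_low.
  right; split=> //=.
    by rewrite (@eq_mkseq_lt _ (target Y s4) _) // -(@eq_mkseq_lt _ _ _ t4') -p4.
  rewrite hl; apply: later_next; rewrite ?y2 ?te // => j jl.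
  by rewrite te t4l.
- by have := leq_mul (ltnW nw) (leqnn (T (size w) + 17)); lia.
move=> s' _ [q' J']; split; first exact: quiet_trans q0 q'.
case: J' => [[h11 _ h]|h]; [left | right]; last exact: h.
by split=> //; rewrite h subnn.
Qed.

(* [R] lists the solutions still to be output. *)
Definition loop_inv (s : state) (R : seq word) : Prop :=
  [/\ lay s, bf s = [::] &
    rg s 11 = 0 /\ R = [::] \/
    [/\ rg s 11 != 0, rg s 10 <= n, P (mkseq (target Y s) (rg s 10)) &
        R = remaining (target Y s) (rg s 10)]].

Definition body_time (N : nat) : nat :=
  N * (T N + 11) + 3 + (N * 7 + 3 + (N * (T N + 17) + 6)).

Lemma body_ok s R : loop_inv s R -> rg s 11 != 0 ->
  ok (body_code c) (body_time (size w)) s (fun s' => exists x R',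
    [/\ R = x :: R', loop_inv s' R' & em s' = rcons (em s) x]).
Proof.
move=> [ls b0 [[-> //]|[_ ln Pl RE]]] _; rewrite /body_time.
apply: ok_seq; apply: ok_weaken (greedy_ok ls ln Pl) (leqnn _) _ => s1 _ [[h1 b1 e1] P1 rem1].
have ls1 := lay_quiet ls h1; rewrite b0 in b1.
apply: ok_seq; apply: ok_weaken (write_ok ls1 b1) (leqnn _) _ => s2 _ [h2 b2 e2 t2].
have ls2 := lay_quiet ls1 h2.
rewrite addnS; apply: ok_do_seq => //=; set s3 := State _ _ _.
have ls3 : lay s3 by exact: ls2.
apply: ok_weaken (search_ok ls3) (leqnn _) _ => s4 _ [[h4 b4 e4] res].
exists (mkseq (target Y s1) n), (later (target Y s1) n); split.
- by rewrite RE -rem1 remaining_full.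
- split; [exact: lay_quiet ls3 h4 | by rewrite b4 |].
  have tE : later (target Y s3) n = later (target Y s1) n.
    by apply: eq_later => i _; rewrite -t2.
  by move: res; rewrite /search_result tE.
- by rewrite e4 /= e2 b2 e1.
Qed.

Lemma prelude_ok w' : w = encode_len n ++ w' -> start = n.+1 ->
  ok (prelude_code Y c) (size w * 10 + 8 + (T (size w) + 3)) start_state (fun s =>
    loop_inv s (sols n [::]) /\ em s = [::]).
Proof.
move=> wE sE; have [ns wsz _] := shape.
have sw : start <= size w by rewrite wsz leq_addr.
apply: ok_seq.
have stE : start = n.+1 + (if 2 == 8 then n else 0) by rewrite addn0.
apply: ok_weaken (@setup_ok w B Y n 2 start w' YB wE stE isT sw) (leqnn _) _ => s1 _ [ls1 b1 e1].
rewrite addnS; apply: ok_do_seq => //=; set s2 := setr _ _ _.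
have ls2 : lay s2.
  by case: ls1 => [[r2 r3 _ r5] [r6 r7 r8 r9]]; split; split.
apply: ok_seq; apply: ok_weaken (test_ok (len := 0) ls2 erefl (leq0n n)) (leqnn _) _.
move=> s3 bs3 [q3 p3]; have [h3 b3 e3] := quiet_sub variable_private q3.
have ls3 := lay_quiet ls2 h3; have [[r2 _ _ _] _] := ls3.
apply: ok_do_seq => //=; first by rewrite r2 addn0; exact: bs3.
apply: ok_do => //=; rewrite r2 addn0; set s4 := setr _ _ _.
have h4 : same_off variable_regs s3 s4.
  by move=> r; rewrite /variable_regs negbK !inE /= => hr; decide_regs.
split; last by rewrite /= e3.
split; [exact: lay_quiet ls3 h4 | by rewrite /= b3 |].
rewrite /= /remaining subn0 cats0 /=; case: eqP p3 => r0 /= p3; [left | right].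
  split=> //; apply: (sols_nil (n := n)) => //; last by rewrite -p3.
  exact: member_step_lt.
by split.
Qed.

End Delay.

Lemma halted_iter P w k cf : halted P cf -> iter k (step P w) cf = cf.
Proof.
rewrite /halted => h; elim: k => //= k ->; rewrite /step.
by case: (fetch P cf) h.
Qed.

Lemma emitted_step P w cf : size (emitted cf) <= size (emitted (step P w cf)).
Proof. by rewrite /step; case: (fetch P cf) => //= *; rewrite ?size_rcons. Qed.

Lemma emitted_iter P w k cf : size (emitted cf) <= size (emitted (iter k (step P w) cf)).
Proof. by elim: k => //= k IH; apply: leq_trans IH (emitted_step _ _ _). Qed.

(** * From single rounds of the loop to the delay of the whole run *)

Section MainLoop.

Variables (P : program) (w : word) (B Q head : nat) (fin : nat).
Variable inv : state -> seq word -> Prop.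

Local Notation run_from k cf := (iter k (step P w) cf).
Local Notation at_head s := (at_pc head s).

Hypothesis stop : forall s, inv s [::] -> bounded B s ->
  steps w B P (at_head s) 1 (at_pc fin s).
Hypothesis fin_halted : forall s, halted P (at_pc fin s).
Hypothesis round : forall s x R, inv s (x :: R) -> bounded B s ->
  exists k s', [/\ k <= Q, steps w B P (at_head s) k (at_head s'),
    inv s' R & em s' = rcons (em s) x].

Definition progress cf k d : Prop :=
  halted P (run_from (k + d) cf) \/
  size (emitted (run_from k cf)) < size (emitted (run_from (k + d) cf)).

Lemma progress_head s R : inv s R -> bounded B s ->
  exists2 d, d <= Q.+1 & progress (at_head s) 0 d.
Proof.
case: R => [|x R] is_ bs; rewrite /progress.
  exists 1 => //; left; have [e _] := stop is_ bs.
  by have := fin_halted s; rewrite -e.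
have [k [s' [kQ [e _] _ em']]] := round is_ bs.
exists k; first exact: leqW.
right; change (size (em s) < size (emitted (run_from k (at_head s)))).
by rewrite e /= em' size_rcons.
Qed.

Lemma progress_before cf k0 s R k : inv s R -> bounded B s -> k <= k0 ->
  run_from k0 cf = at_head s -> exists2 d, d <= k0 + Q.+1 & progress cf k d.
Proof.
move=> is_ bs kk e; have [d dQ prog] := progress_head is_ bs.
exists (k0 - k + d); first lia.
have eE j : run_from (k + (k0 - k + j)) cf = run_from j (at_head s).
  by rewrite addnA subnKC // addnC iterD e.
rewrite /progress eE; case: prog => [|lt]; [by left | right].
apply: leq_ltn_trans lt; change (size (emitted (run_from k cf)) <= size (em s)).
rewrite -[em s]/(emitted (at_head s)) -e -(subnK kk) iterD.
exact: emitted_iter.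
Qed.

(** Inside a round at most [Q] steps lead to the next head, and from there at most [Q.+1] to an
    output or to the halt. Induction on the finite list of pending solutions gives termination. *)
Lemma loop_runs s R : inv s R -> bounded B s ->
  [/\ forall k, exists2 d, d <= Q + Q.+1 & progress (at_head s) k d,
      forall k i, reg (run_from k (at_head s)) i <= B &
      exists k, halted P (run_from k (at_head s)) /\
        emitted (run_from k (at_head s)) = em s ++ R].
Proof.
elim: R s => [|x R IH] s is_ bs.
  have [e1 b1] := stop is_ bs.
  have after k : run_from k.+1 (at_head s) = at_pc fin s.
    by rewrite -addn1 iterD e1 halted_iter.
  split=> [[|k]|[|k] i|].
  - by exists 1; [lia | left; rewrite after].
  - by exists 0 => //; left; rewrite addn0 after.
  - exact: (b1 0).
  - by rewrite after; have := b1 1 isT i; rewrite e1.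
  - by exists 1; rewrite after cats0.
have [k0 [s' [k0Q st is' em']]] := round is_ bs.
have bs' := steps_bounded st; have [e0 b0] := st.
have [prog bnd [k [hk ek]]] := IH s' is' bs'.
have after j : run_from (k0 + j) (at_head s) = run_from j (at_head s').
  by rewrite addnC iterD e0.
split=> [j|j i|].
- have [jk|/ltnW kj] := leqP j k0.
    have [d dQ pd] := progress_before is' bs' jk e0.
    by exists d => //; lia.
  have [d dQ pd] := prog (j - k0); exists d => //.
  by move: pd; rewrite /progress -!after addnA !subnKC.
- have [jk|/ltnW kj] := leqP j k0; first exact: b0.
  by rewrite -(subnKC kj) after.
- exists (k0 + k); rewrite after; split=> //.
  by rewrite ek em' cat_rcons.
Qed.

End MainLoop.

Definition enum_program (pre body : com) : program :=
  compile 0 pre ++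
  JumpZ 11 (csize pre + csize body + 2) :: compile (csize pre + 1) body ++
  [:: Jump (csize pre)].

Section EnumProgram.

Variables (pre body : com).

Local Notation P := (enum_program pre body).

Lemma nth_enum_program i : nth Halt P (csize pre + i) =
  nth Halt (JumpZ 11 (csize pre + csize body + 2) :: compile (csize pre + 1) body ++
    [:: Jump (csize pre)]) i.
Proof. by rewrite nth_cat size_compile ltnNge leq_addr addKn. Qed.

Lemma embedded_pre : embedded P 0 (compile 0 pre).
Proof. by move=> i il; rewrite nth_cat il. Qed.

Lemma embedded_body : embedded P (csize pre + 1) (compile (csize pre + 1) body).
Proof. by move=> i il; rewrite -addnA nth_enum_program add1n /= nth_cat il. Qed.

Lemma step_head w s : step P w (at_pc (csize pre) s) =
  at_pc (if rg s 11 == 0 then csize pre + csize body + 2 else csize pre + 1) s.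
Proof.
rewrite /step /fetch /=; have := nth_enum_program 0; rewrite addn0 => -> /=.
by rewrite addn1.
Qed.

Lemma step_back w s : step P w (at_pc (csize pre + 1 + csize body) s) =
  at_pc (csize pre) s.
Proof.
rewrite /step /fetch /= -addnA nth_enum_program add1n /= nth_cat.
by rewrite size_compile ltnn subnn.
Qed.

Lemma enum_program_halted s : halted P (at_pc (csize pre + csize body + 2) s).
Proof.
rewrite /halted /fetch /= nth_default // size_cat /= size_cat !size_compile /=; lia.
Qed.

End EnumProgram.

Theorem enum_delayP F : DelayP (EnumClosure F).
Proof.
have [Y [c [T [Y40 [pT hT] test]]]] := exists_tester F.
have bT : poly_bounded T by exists pT.
pose pre := prelude_code Y c; pose body := body_code c.
pose T0 N := N * 10 + 8 + (T N + 3); pose Q N := body_time T N + 2.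
pose delay N := T0 N + (Q N + Q N + 2).
have bdelay : poly_bounded delay.
  by rewrite /delay /T0 /Q /body_time; poly_bound.
(* A polynomial above the values of the registers is a generous exponent, since [x < 2 ^ x]. *)
have bB : poly_bounded (fun N => Y + 4 * N + 101) by poly_bound.
have [q hq] := bdelay; have [r hr] := bB.
(* The precomputation is declared empty: the prelude is counted in the delay, through [T0]. *)
exists (enum_program pre body), 0%R, q, r => -[n S] _ [s [us sS] ->] /=.
set w := encode_len n ++ _; pose B := Y + 4 * size w + 100.
have np : n < size (encode_len n) by rewrite size_encode_len.
have shape := encoding_shape s np; rewrite -/w in shape.
set P := enum_program pre body.
set start := size (encode_len n) in shape; set m := size s in shape.
pose inv := loop_inv F Y w n start m.
have startE : start = n.+1 by rewrite /start size_encode_len.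
have YB : Y + 4 * size w + 100 <= B by [].
have b0 : bounded B start_state by [].
have [k0 [s0 [k0T st0 [inv0 em0]]]] :=
  prelude_ok Y40 test YB shape (erefl w) startE (@embedded_pre pre body) b0.
rewrite add0n in st0; have bs0 := steps_bounded st0; have [e0 bd0] := st0.
have stop st : inv st [::] -> bounded B st ->
    steps w B P (at_pc (csize pre) st) 1 (at_pc (csize pre + csize body + 2) st).
  move=> [ls b [[r11 _]|[r11 ln Pl E]]] bs.
    by apply: steps1 => //; rewrite step_head r11.
  (* A nonzero register 11 would let a round output an element of the empty list. *)
  have := body_ok Y40 test YB shape (And3 ls b (or_intror (And4 r11 ln Pl E))) r11
    (@embedded_body pre body) bs.
  by case=> [k [st' [_ _ [x [R' []]]]]].
have round st x R : inv st (x :: R) -> bounded B st -> exists k st',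
    [/\ k <= Q (size w), steps w B P (at_pc (csize pre) st) k (at_pc (csize pre) st'),
    inv st' R & em st' = rcons (em st) x].
  move=> is_ bs; have r11 : rg st 11 != 0 by case: is_ => _ _ [[] //|[]].
  have [k [st' [kT str [x' [R' [[<- <-] is' em']]]]]] :=
    body_ok Y40 test YB shape is_ r11 (@embedded_body pre body) bs.
  exists (1 + k + 1), st'; split=> //; first by rewrite /Q; lia.
  have bs' := steps_bounded str.
  have st1 : steps w B P (at_pc (csize pre) st) 1 (at_pc (csize pre + 1) st).
    by apply: steps1 => //; rewrite step_head (negPf r11).
  apply: steps_trans (steps_trans st1 str) _.
  by apply: steps1 => //; rewrite step_back.
have fin st := enum_program_halted pre body st.
have [prog bnd [kf [hf ef]]] := loop_runs stop fin round inv0 bs0.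
have runE j : run P w (k0 + j) = iter j (step P w) (at_pc (csize pre) s0).
  by rewrite /run addnC iterD -e0.
split.
- exists 0; split=> // k _.
  have [kk|/ltnW kk] := leqP k k0.
    have [d dQ pd] := progress_before stop fin round inv0 bs0 kk e0.
    exists d; split; last exact: pd.
    apply: leq_trans dQ (leq_trans _ (hq _)); rewrite /delay /T0; lia.
  have [d dQ pd] := prog (k - k0); exists d; split.
    by apply: leq_trans dQ (leq_trans _ (hq _)); rewrite /delay; lia.
  by move: pd; rewrite /progress -!runE addnA !subnKC.
- move=> k i; apply: (@leq_ltn_trans B); last first.
    apply: leq_ltn_trans _ (ltn_expl _ (leqnn 2)); apply: leq_trans _ (hr _).
    by rewrite /B; lia.
  have [kk|/ltnW kk] := leqP k k0; first exact: bd0.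
  by rewrite -(subnKC kk) runE.
- exists (k0 + kf); rewrite runE ef em0 cat0s; split=> // [|y].
    exact: sols_uniq.
  rewrite mem_sols; split=> [/and3P[/holdsP Py /eqP sy _]|[v Cv ->]].
    rewrite add0n in sy; rewrite sy in Py.
    exists [tuple nth false y i | i < n].
      exact: ((@member_encoding n s (encode_len n) F S (nth false y) sS).1 Py).
    apply: (@eq_from_nth _ false) => [|i il]; first by rewrite size_tuple sy.
    rewrite sy in il; rewrite -[i]/(val (Ordinal il)) -tnth_nth.
    by rewrite tnth_mktuple.
  rewrite take0 eqxx size_tuple eqxx !andbT; apply/holdsP; rewrite size_tuple.
  apply: ((@member_encoding n s (encode_len n) F S (nth false v) sS).2).
  suff -> : [tuple nth false v i | i < n] = v by [].
  by apply: eq_from_tnth => i; rewrite tnth_mktuple (tnth_nth false).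
Qed.

Theorem theorem7 (F : seq (operation bool)) :
  polynomial_time (Membership F) /\ DelayP (EnumClosure F).
Proof. by split; [exact: membership_polynomial | exact: enum_delayP]. Qed.
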